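(* Given a macroscopic stress $S\in\mathcal M_3^s(\mathbb R)$, there exists a unique tensor field $\sigma_S\in\mathbb T(S)$ that satisfies $$g(\sigma_S)=\inf_{\sigma\in\mathbb T(S)}g(\sigma),\qquad\text{where}\quad g(\sigma)=\frac12\int_Y\langle D\sigma,\sigma\rangle\,dy\quad\text{for all }\sigma\in\mathbb L^2_{\#s}.$$ Moreover, $\sigma_S$ is the solution of the variational formulation: find $\sigma_S\in\mathbb T(S)$ such that $\int_Y\langle D\sigma_S,\mu\rangle\,dy=0$ for all $\mu\in\mathbb T(0)$; and $D\sigma_S=\nabla_s u_A$, where $u_A$ is the solution, for the matrix $A$ with $S=C^HA$, of: find $u_A\in LP_0\cap LP(A)$ such that $\int_Y\langle C\,\nabla_s u_A,\nabla_s v\rangle\,dy=0$ for all $v\in H^1_{\#0}$.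
   Context: Let $\mathcal G\subset\mathbb R^3$ be the lattice (additive group) generated by three linearly independent vectors $g_1,g_2,g_3$, and let $Y=\{s_1g_1+s_2g_2+s_3g_3: s_1,s_2,s_3\in[0,1]\}$. A function on $\mathbb R^3$ is $\mathcal G$-periodic if it is invariant under translations by vectors of $\mathcal G$. $\mathcal M_3^s(\mathbb R)$ is the space of real symmetric $3\times3$ matrices, $\langle\cdot,\cdot\rangle$ is the Frobenius inner product of matrices, $\nabla_s v$ is the symmetric part of the gradient of $v$, and $(\operatorname{div}\mu)_i=\sum_j\partial_j\mu_{ij}$ in the sense of distributions on $\mathbb R^3$. $H^1_\#$ is the space of $\mathcal G$-periodic vector fields in $H^1_{\rm loc}(\mathbb R^3,\mathbb R^3)$, with the $H^1(Y)$ norm; $H^1_{\#0}=\{v\in H^1_\#\mid\int_Y v\,dy=0\}$. For $A\in\mathcal M_3^s(\mathbb R)$, $LP(A)=\{u \mid u(y)=Ay+\varphi(y),\ \varphi\in H^1_\#\}$; $LP=\bigcup_{A\in\mathcal M_3^s(\mathbb R)}LP(A)$ and $LP_0=\{v\in LP\mid\int_Y v\,dy=0\}$. $\mathbb L^2_{\#s}$ is the space of $\mathcal G$-periodic symmetric $3\times 3$ matrix fields in $L^2_{\rm loc}(\mathbb R^3)$, with the $L^2(Y)$ norm. For $S\in\mathcal M_3^s(\mathbb R)$, $\mathbb T(S)=\{\mu\in\mathbb L^2_{\#s}\mid\operatorname{div}\mu=0,\ \frac1{|Y|}\int_Y\mu\,dy=S\}$. The rigidity tensor $C$ is a $\mathcal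 G$-periodic, measurable, essentially bounded field of fourth-order tensors on $\mathbb R^3$, with the usual symmetries of elasticity (for a.e. $y$, $C(y)$ is a self-adjoint linear map of $\mathcal M_3^s(\mathbb R)$ into itself), and uniformly positive definite: there is $\alpha>0$ with $\langle C(y)\xi,\xi\rangle\ge\alpha|\xi|^2$ for all $\xi\in\mathcal M_3^s(\mathbb R)$ and a.e. $y$. The compliance tensor is $D(y)=C(y)^{-1}$ (inverse on $\mathcal M_3^s(\mathbb R)$). The homogenized tensor $C^H:\mathcal M_3^s(\mathbb R)\to\mathcal M_3^s(\mathbb R)$ is the linear map $C^HA=\frac1{|Y|}\int_Y C\,\nabla_s u_A\,dy$, where $u_A\in LP_0\cap LP(A)$ is the unique solution of $\int_Y\langle C\,\nabla_s u_A,\nabla_s v\rangle\,dy=0$ for all $v\in H^1_{\#0}$; it is invertible. *)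

(* Defs.v *)
From HB Require Import structures.
From mathcomp Require Import all_boot all_order all_algebra.
From mathcomp Require Import all_classical all_reals all_analysis.
From mathcomp Require Import ring lra.

Set Implicit Arguments.
Unset Strict Implicit.
Unset Printing Implicit Defensive.

Import Order.TTheory GRing.Theory Num.Theory.
Import numFieldNormedType.Exports.

Local Open Scope classical_set_scope.
Local Open Scope ring_scope.

(* R^3 is 'cV[R]_3.  Its sigma-algebra is the one generated by the coordinates,
   i.e. the Borel one, as the library does for n.-tuple. *)
Section measurable_cV.
Variables (R : realType) (n : nat).

Let coors : 'I_n -> 'cV[R]_n -> measurableTypeR R := fun i x => x i 0.

Let cV_set0 : g_sigma_preimage coors set0.
Proof. exact: sigma_algebra0. Qed.

Let cV_setC A : g_sigma_preimage coors A -> g_sigma_preimage coors (~` A).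
Proof. exact: sigma_algebraC. Qed.

Let cV_bigcup (F : _^nat) : (forall i, g_sigma_preimage coors (F i)) ->
  g_sigma_preimage coors (\bigcup_i (F i)).
Proof. exact: sigma_algebra_bigcup. Qed.

HB.instance Definition _ :=
  @isMeasurable.Build (measure_tuple_display (R.-ocitv.-measurable).-sigma)
    'cV[R]_n (g_sigma_preimage coors) cV_set0 cV_setC cV_bigcup.

End measurable_cV.

(* Lebesgue measure on R^3 is the threefold product of lebesgue_measure,
   transported along col3. *)
Definition col3 (R : realType)
    (p : measurableTypeR R * measurableTypeR R * measurableTypeR R) :
    'cV[R]_3 :=
  \col_i [tuple p.1.1; p.1.2; p.2]`_i.

Lemma measurable_col3 (R : realType) : measurable_fun setT (@col3 R).
Proof.
have mf : measurable_fun setT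
  (@fst (measurableTypeR R * measurableTypeR R) (measurableTypeR R)).
  exact: measurable_fst.
have mi (i : 'I_3) :
    measurable_fun setT (fun p => @col3 R p i 0 : measurableTypeR R).
  case: i => [[|[|[|//]]] i3].
  - rewrite (_ : (fun _ => _) = fst \o fst); first exact: measurableT_comp.
    by apply/funext => p /=; rewrite mxE.
  - rewrite (_ : (fun _ => _) = snd \o fst); first exact: measurableT_comp.
    by apply/funext => p /=; rewrite mxE.
  - rewrite (_ : (fun _ => _) = snd); first exact: measurable_snd.
    by apply/funext => p /=; rewrite mxE.
suff h : g_sigma_preimage (fun i p => @col3 R p i 0 : measurableTypeR R)
    `<=` measurable.
  move=> _ A mA; rewrite setTI; apply: h.
  rewrite (g_sigma_preimage_comp
    (fun i (x : 'cV[R]_3) => x i 0 : measurableTypeR R)).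
  by exists A => //; rewrite setTI.
apply: smallest_sub; first exact: sigma_algebra_measurable.
rewrite -bigcup_mkord_ord; apply: bigcup_sub => i Ii.
by move=> A [B mB <-]; exact: mi.
Qed.

Section lebesgue3.
Variable R : realType.
Local Open Scope ereal_scope.

Definition lebesgue3 : set 'cV[R]_3 -> \bar R :=
  pushforward ((@lebesgue_measure R \x @lebesgue_measure R)
               \x @lebesgue_measure R) (@col3 R).

Let lebesgue30 : lebesgue3 set0 = 0.
Proof. by rewrite /lebesgue3 /pushforward preimage_set0 measure0. Qed.

Let lebesgue3_ge0 A : 0 <= lebesgue3 A.
Proof. by rewrite /lebesgue3 /pushforward; apply: measure_ge0. Qed.

Let lebesgue3_sigma_additive : semi_sigma_additive lebesgue3.
Proof.
move=> F mF tF mUF; rewrite /lebesgue3 /pushforward preimage_bigcup.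
apply: measure_semi_sigma_additive.
- by move=> n; rewrite -[X in measurable X]setTI; exact: measurable_col3.
- apply/trivIsetP => /= i j _ _ ij; rewrite -preimage_setI.
  by move/trivIsetP : tF => /(_ _ _ _ _ ij) ->//; rewrite preimage_set0.
- rewrite -preimage_bigcup -[X in measurable X]setTI.
  exact: measurable_col3.
Qed.

HB.instance Definition _ := isMeasure.Build _ _ _ lebesgue3
  lebesgue30 lebesgue3_ge0 lebesgue3_sigma_additive.

End lebesgue3.
Arguments lebesgue3 {R}.

Section tensors.
Variable R : realType.
Implicit Types (xi eta : 'M[R]_3) (c : 'M[R]_(3 * 3)).

Definition frob xi eta : R := \tr (xi^T *m eta).

Definition symmx : set 'M[R]_3 := [set xi | xi^T = xi].

Definition sympart xi : 'M[R]_3 := 2^-1 *: (xi + xi^T).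

(* A fourth-order tensor is a linear endomorphism of 'M_3, encoded as in lin_mx
   by a 9 x 9 matrix; [tens c xi] is its value c xi. *)
Definition tens c xi : 'M[R]_3 := vec_mx (mxvec xi *m c).

(* The inverse of c on symmetric matrices.  Since c only matters (and is only
   invertible) there, it is first extended by the identity on skew-symmetric
   matrices; see complianceP. *)
Definition compliance c : 'M[R]_(3 * 3) :=
  invmx (lin_mx (fun xi => tens c (sympart xi) + (xi - sympart xi))).

Lemma complianceP c :
    (forall xi, symmx xi -> symmx (tens c xi)) ->
    (forall xi, symmx xi -> tens c xi = 0 -> xi = 0) ->
  forall xi, symmx xi ->
    [/\ symmx (tens (compliance c) xi), tens c (tens (compliance c) xi) = xi
      & tens (compliance c) (tens c xi) = xi].
Proof.
move=> cS cI.
have sP xi : symmx (sympart xi).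
  by apply/matrixP => i j; rewrite !mxE addrC.
have sI xi : symmx xi -> sympart xi = xi.
  move=> /matrixP xiE; apply/matrixP => i j.
  move: (xiE i j); rewrite !mxE => ->; lra.
have skew xi : symmx (xi - sympart xi) -> sympart xi = xi.
  move=> /matrixP xiE; apply/matrixP => i j.
  by move: (xiE i j); rewrite !mxE; lra.
pose f xi := tens c (sympart xi) + (xi - sympart xi).
have fl : linear f.
  move=> a x y; rewrite /f /tens.
  have -> : sympart (a *: x + y) = a *: sympart x + sympart y.
    by apply/matrixP => i j; rewrite !mxE; ring.
  rewrite linearP mulmxDl -scalemxAl linearP.
  by apply/matrixP => i j; rewrite !mxE; ring.
pose F : {linear 'M[R]_3 -> 'M[R]_3} :=
  HB.pack f (GRing.isLinear.Build R _ _ _ f fl).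
have FE xi : mxvec xi *m lin_mx f = mxvec (f xi) by exact: (mul_vec_lin F xi).
have fS xi : symmx (f xi) -> sympart xi = xi.
  move=> fxi; apply: skew; rewrite -[_ - _](addKr (tens c (sympart xi))).
  move: (cS _ (sP xi)) fxi; rewrite /symmx /= -/(f xi) => h1 h2.
  by rewrite linearD linearN /= h1 h2.
have uL : lin_mx f \in unitmx.
  rewrite -row_free_unit; apply: inj_row_free => v.
  rewrite -[v]vec_mxK FE => /(congr1 vec_mx); rewrite mxvecK linear0 => f0.
  have sv : sympart (vec_mx v) = vec_mx v.
    by apply: fS; rewrite f0 /symmx /= trmx0.
  rewrite (cI (vec_mx v)) ?linear0//; first by rewrite -sv; exact: sP.
  by move: f0; rewrite /f sv subrr addr0.
move=> xi sxi.
have fD : f (tens (compliance c) xi) = xi.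
  by apply: (can_inj mxvecK); rewrite -FE vec_mxK mulmxKV.
have sD : sympart (tens (compliance c) xi) = tens (compliance c) xi.
  by apply: fS; rewrite fD.
split.
- by rewrite -sD; exact: sP.
- by rewrite -[RHS]fD /f sD subrr addr0.
- have <- : f xi = tens c xi by rewrite /f sI// subrr addr0.
  by rewrite /tens -FE mulmxK// mxvecK.
Qed.

End tensors.

Section periodic_spaces.
Variable R : realType.
Local Notation E := 'cV[R]_3.
Local Notation M := 'M[R]_3.
Local Notation mu := (@lebesgue3 R).
(* the basis (g_1, g_2, g_3) of the lattice, assumed free in statements *)
Variable b : 3.-tuple E.

Definition lattice : set E :=
  [set a | exists m : 'I_3 -> int, a = \sum_i tnth b i *~ m i].

Definition cell : set E :=
  [set y | exists2 s : 'I_3 -> R, (forall i, 0 <= s i <= 1) &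
           y = \sum_i s i *: tnth b i].

Definition cell_vol : R := fine (mu cell).

Definition cell_int (f : E -> R) : R := \int[mu]_(y in cell) f y.

Definition cell_mean (f : E -> M) : M :=
  cell_vol^-1 *: \matrix_(i, j) cell_int (fun y => f y i j).

(* Fields are represented by measurable functions; as for elements of L^2,
   properties of their values are required almost everywhere. *)
Definition periodic T (f : E -> T) : Prop :=
  forall a, lattice a -> {ae mu, forall y, f (y + a) = f y}.

Definition L2loc (f : E -> R) : Prop :=
  measurable_fun setT f /\
  forall K : set E, compact K -> (\int[mu]_(y in K) ((f y) ^+ 2)%:E < +oo)%E.

Definition partial (j : 'I_3) (f : E -> R) : E -> R :=
  'D_(delta_mx j 0 : E) f.

(* C^oo: all iterated partial derivatives exist and are Frechet differentiable
   (hence continuous) everywhere. *)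
Definition smooth (f : E -> R) : Prop :=
  forall (s : seq 'I_3) (y : E), differentiable (foldr partial f s) y.

Definition test_function : set (E -> R) :=
  [set phi | smooth phi /\ compact (closure [set y | phi y != 0])].

Definition weak_partial (j : 'I_3) (f w : E -> R) : Prop :=
  forall phi, test_function phi ->
    \int[mu]_(y in setT) (f y * partial j phi y) =
    - \int[mu]_(y in setT) (w y * phi y).

Definition weak_gradient (u : E -> E) (W : E -> M) : Prop :=
  forall i j, L2loc (fun y => W y i j) /\
    weak_partial j (fun y => u y i 0) (fun y => W y i j).

Definition H1loc (u : E -> E) : Prop :=
  (forall i, L2loc (fun y => u y i 0)) /\ exists W, weak_gradient u W.

(* For u in H1loc, the weak gradient, which is unique up to null sets. *)
Definition grad (u : E -> E) : E -> M :=
  xget (fun=> 0) [set W | weak_gradient u W].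

Definition symgrad (u : E -> E) : E -> M := fun y => sympart (grad u y).

Definition zero_mean (u : E -> E) : Prop :=
  forall i, cell_int (fun y => u y i 0) = 0.

Definition H1per : set (E -> E) := [set v | H1loc v /\ periodic v].

Definition H1per0 : set (E -> E) := [set v | H1per v /\ zero_mean v].

Definition LPA (A : M) : set (E -> E) :=
  [set u | exists2 phi, H1per phi & forall y, u y = A *m y + phi y].

Definition LP : set (E -> E) := \bigcup_(A in @symmx R) LPA A.

Definition LP0 : set (E -> E) := [set u | LP u /\ zero_mean u].

Definition L2per_sym : set (E -> M) :=
  [set s : E -> M | [/\ forall i j, L2loc (fun y => s y i j), periodic s
             & {ae mu, forall y, symmx (s y)}]].

(* <(div s)_i, phi> *)
Definition distr_div (s : E -> M) (i : 'I_3) (phi : E -> R) : R :=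
  - \sum_j \int[mu]_(y in setT) (s y i j * partial j phi y).

Definition admissible (S : M) : set (E -> M) :=
  [set s : E -> M | [/\ L2per_sym s,
              forall i phi, test_function phi -> distr_div s i phi = 0
            & cell_mean s = S]].

Definition rigidity_tensor (C : E -> 'M[R]_(3 * 3)) : Prop :=
  [/\ periodic C,
      forall i j, measurable_fun setT (fun y => C y i j),
      exists B : R, {ae mu, forall y, forall i j, `|C y i j| <= B},
      {ae mu, forall y, (forall xi, symmx xi -> symmx (tens (C y) xi)) /\
        forall xi eta, symmx xi -> symmx eta ->
          frob (tens (C y) xi) eta = frob xi (tens (C y) eta)}
    & exists2 alpha : R, 0 < alpha &
        {ae mu, forall y, forall xi, symmx xi ->
          alpha * frob xi xi <= frob (tens (C y) xi) xi}].

Variable C : E -> 'M[R]_(3 * 3).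

Definition compliance_field (y : E) : 'M[R]_(3 * 3) := compliance (C y).

Definition cell_solution (A : M) : set (E -> E) :=
  [set u | [/\ LP0 u, LPA A u & forall v, H1per0 v ->
     cell_int (fun y => frob (tens (C y) (symgrad u y)) (symgrad v y)) = 0]].

(* For symmetric A, the solution of the cell problem, unique up to null sets. *)
Definition cell_sol (A : M) : E -> E := xget (fun=> 0) (cell_solution A).

Definition homogenized (A : M) : M :=
  cell_mean (fun y => tens (C y) (symgrad (cell_sol A) y)).

Definition comp_energy (s : E -> M) : R :=
  2^-1 * cell_int (fun y => frob (tens (compliance_field y) (s y)) (s y)).

Definition stress_minimizer (S : M) : set (E -> M) :=
  [set s : E -> M | admissible S s /\
    comp_energy s = inf [set comp_energy t | t in admissible S]].

Definition stress_solution (S : M) : set (E -> M) :=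
  [set s : E -> M | admissible S s /\ forall m, admissible 0 m ->
    cell_int (fun y => frob (tens (compliance_field y) (s y)) (m y)) = 0].

End periodic_spaces.

(* Main.v *)
(** For periodic square-integrable g and f the correlation
    corr g f z = \int_Y g(y) f(y + z) dy is continuous at z = 0, because the
    functions g for which it is form a closed subspace containing all
    convolutions with test functions, and a function orthogonal to all of those
    vanishes.  Integrating a correlation against a test function moves weak
    derivatives from one factor to the other, so mollification at z = 0 gives:
    periodic divergence-free fields are orthogonal to periodic gradients, whence
    Korn's inequality (apply this to the field (d_i v_j) e_j - (d_j v_j) e_i),
    and translations displace v by at most a constant times its gradient, whence
    Poincare's inequality.  The cell problem is then an orthogonal projection
    for the energy form, and C^H is injective, hence bijective.
    For sigma = C symgrad u_A one has D sigma = symgrad u_A, which is orthogonal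
    to admissible 0; expanding the complementary energy at sigma gives
    minimality and uniqueness.  That sigma is divergence-free in the sense of
    distributions is seen by testing the cell problem against convolutions. *)
Require Import Defs.
From HB Require Import structures.
From mathcomp Require Import all_boot all_order all_algebra.
From mathcomp Require Import all_classical all_reals all_analysis.
From mathcomp Require Import measurable_realfun ring lra.
Set Implicit Arguments.
Unset Strict Implicit.
Unset Printing Implicit Defensive.
Import Order.TTheory GRing.Theory Num.Theory.
Import numFieldNormedType.Exports.
Local Open Scope classical_set_scope.
Local Open Scope ring_scope.

(** * A smooth step function *)

Section smooth_step.
Variable R : realType.
Implicit Types (f g : R -> R) (p : {poly R}).

(** Weak derivatives are tested with compactly supported functions on all of space, whereas every
    inner product lives on one cell. A correlation bridges the two: its variable [z] ranges over all
    of space and can be paired with a test function, while each value is a cell integral, unchanged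
    when both factors are translated together. Only its behaviour at 0 needs analysis, which
    replaces density of smooth fields, Fourier series and traces on the faces of the cell. Fields
    are functions rather than classes and are periodic only almost everywhere. Hence the projection
    theorem is stated for a positive semidefinite form on a set of functions, limits are chosen by
    pointwise formulas, and uniqueness of a field means equality almost everywhere. Most test
    functions are products of three functions of one variable: they still determine a locally
    integrable function, their mixed derivatives commute by inspection, and only one-variable
    smoothness has to be constructed. The inverse of C^H comes from [complianceP], the
    finite-dimensional lemma that also inverts C(y). *)

Fixpoint Cn (n : nat) f : Prop :=
  if n is n'.+1 then
    exists2 g, (forall x, is_derive (x : R^o) (1 : R^o) (f : R^o -> R^o) (g x)) &
      Cn n' g
  else True.

Lemma CnW n f : Cn n.+1 f -> Cn n f.
Proof. by elim: n f => [|n IH] f //= [g fg [h gh hn]]; exists g => //; apply: IH; exists h. Qed.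

Lemma Cn_cst n (a : R) : Cn n (cst a).
Proof. by elim: n a => [//|n IH] a; exists (cst 0) => // x; exact: is_derive_cst. Qed.

Lemma Cn_id n : Cn n (id : R -> R).
Proof.
case: n => [//|n]; exists (cst 1); last exact: Cn_cst.
by move=> x; exact: is_derive_id.
Qed.

Lemma CnD n f g : Cn n f -> Cn n g -> Cn n (fun x => f x + g x).
Proof.
elim: n f g => [//|n IH] f g [f' hf cf] [g' hg cg].
exists (fun x => f' x + g' x); last exact: IH.
by move=> x; exact: (is_deriveD (hf x) (hg x)).
Qed.

Lemma CnM n f g : Cn n f -> Cn n g -> Cn n (fun x => f x * g x).
Proof.
elim: n f g => [//|n IH] f g cf cg.
have [[f' hf cf'] [g' hg cg']] := (cf, cg).
exists (fun x => f x * g' x + g x * f' x).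
  by move=> x; exact: (is_deriveM (hf x) (hg x)).
by apply: CnD; apply: IH => //; exact: CnW.
Qed.

Lemma Cn_comp n f g : Cn n f -> Cn n g -> Cn n (fun x => f (g x)).
Proof.
elim: n f g => [//|n IH] f g cf cg.
have [[f' hf cf'] [g' hg cg']] := (cf, cg).
exists (fun x => f' (g x) * g' x).
  by move=> x; exact: (is_derive1_comp (hf (g x)) (hg x)).
by apply: CnM => //; apply: IH => //; exact: CnW.
Qed.

Lemma Cn_affine n (a b : R) : Cn n (fun x => a * x + b).
Proof.
by apply: CnD; [apply: CnM; [exact: Cn_cst|exact: Cn_id]|exact: Cn_cst].
Qed.

(* The functions p(1/x) e^(-1/x) on x > 0, extended by 0, form a class that is
   closed under differentiation. *)
Definition flatp p (x : R) : R :=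
  if 0 < x then p.[x^-1] * expR (- x^-1) else 0.

Lemma horner_le_pow p : exists C d, forall t : R, 1 <= t ->
  `|p.[t]| <= C * t ^+ d.
Proof.
elim/poly_ind: p => [|p c [C [d h]]].
  by exists 0, 0%N => t _; rewrite horner0 normr0 mul0r.
exists (C + `|c|), d.+1 => t t1; rewrite !hornerE.
apply: (le_trans (ler_normD _ _)); rewrite normrM mulrDl.
have t0 : 0 <= t by apply: le_trans t1.
apply: lerD.
  by rewrite exprSr mulrA (ger0_norm t0); apply: ler_wpM2r => //; exact: h.
by rewrite ler_peMr// exprn_ege1.
Qed.

(** With t = 1/x, one term of the exponential series gives t^(d+2) / (d+2)! <= e^t, which beats the
    growth t^d of the polynomial and leaves a factor x^2. The square is what makes the derivative at
    0 exist and vanish. *)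
Lemma flatp_le p : exists2 C : R, 0 <= C & forall x, `|x| <= 1 ->
  `|flatp p x| <= C * x ^+ 2.
Proof.
have [C [d h]] := horner_le_pow p.
have C0 : 0 <= C.
  have := h 1 (lexx _); rewrite expr1n mulr1; exact: le_trans.
exists (C * (d.+2)`!%:R) => [|x x1]; first by rewrite mulr_ge0.
rewrite /flatp; case: ifPn => x0; last by rewrite normr0 mulr_ge0 ?sqr_ge0// mulr_ge0.
have t1 : 1 <= x^-1.
  by rewrite -[1]invr1 lef_pV2 ?posrE//; move: x1; rewrite gtr0_norm.
rewrite normrM (gtr0_norm (expR_gt0 _)).
apply: (@le_trans _ _ (C * x^-1 ^+ d * expR (- x^-1))).
  by apply: ler_wpM2r; [exact: expR_ge0|exact: h].
rewrite -!mulrA; apply: ler_wpM2l => //.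
have xV0 : 0 <= x^-1 by rewrite invr_ge0 ltW.
have := expR_ge1Dxn d.+1 xV0.
rewrite expRN ler_pdivrMr ?expR_gt0// => e.
have : x^-1 ^+ d.+2 / (d.+2)`!%:R <= expR x^-1.
  by apply: le_trans e; rewrite lerDr.
rewrite ler_pdivrMr ?ltr0n ?fact_gt0// => e2.
rewrite (_ : x^-1 ^+ d = x ^+ 2 * x^-1 ^+ d.+2); last first.
  rewrite -(add2n d) exprD mulrA (_ : x ^+ 2 * x^-1 ^+ 2 = 1) ?mul1r//.
  by field; rewrite gt_eqF.
by rewrite [leRHS]mulrAC [leRHS]mulrC ler_wpM2l ?sqr_ge0// mulrC.
Qed.

(** For x > 0 the chain rule gives (p - p')(1/x) x^-2 e^(-1/x), hence the factor X^2 in the new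
    polynomial; at x = 0 the quadratic bound [flatp_le] settles the difference quotient. *)
Lemma is_derive_flatp p x :
  is_derive (x : R^o) (1 : R^o) (flatp p : R^o -> R^o) (flatp ('X^2 * (p - p^`())) x).
Proof.
have [x0|x0|<-] := ltgtP 0 x.
- have xn0 : x != 0 by rewrite gt_eqF.
  have dV : is_derive (x : R^o) (1 : R^o) (fun y : R => y^-1) (- x ^- 2).
    apply: DeriveDef; first exact: derivableV.
    by rewrite deriveV// derive_id scaler1.
  apply: (near_eq_is_derive (f := (horner p \o (fun y => y^-1)) *
     (expR \o (fun y => - y^-1)))).
    near=> y; rewrite /flatp ifT//.
    by near: y; exact: lt_nbhsr.
  have d1 : is_derive (x : R^o) (1 : R^o) (horner p \o (fun y => y^-1))
      (p^`().[x^-1] * - x ^- 2).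
    exact: (is_derive1_comp (is_derive_poly p _) dV).
  have d2 : is_derive (x : R^o) (1 : R^o) (expR \o (fun y => - y^-1))
      (expR (- x^-1) * x ^- 2).
    have h := is_deriveN dV; rewrite opprK in h.
    exact: (is_derive1_comp (g := fun y => - y^-1) (is_derive_expR (- x^-1)) h).
  apply: (is_derive_eq (is_deriveM d1 d2)).
  rewrite /flatp x0 !hornerE /= !exprVn; rewrite /GRing.scale /=; ring.
- apply: (near_eq_is_derive (f := cst 0)).
    near=> y; rewrite /flatp ifF//; apply/negbTE; rewrite -leNgt ltW//.
    by near: y; exact: lt_nbhsl.
  by rewrite /flatp ltNge ltW//=; exact: is_derive_cst.
- have [C C0 h] := flatp_le p.
  have fl0 q : flatp q 0 = 0 by rewrite /flatp ltxx.
  rewrite fl0.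
  suff H : (fun h0 : R => h0^-1 *: ((flatp p \o shift 0) (h0 *: 1) - flatp p 0))
      @ 0^' --> (0 : R).
    apply: DeriveDef; first by apply/cvg_ex; exists 0.
    by apply: cvg_lim H.
  apply/cvgr0Pnorm_le => e e0.
  have C1 : 0 < C + 1 by rewrite ltr_wpDl.
  have eC : 0 < e / (C + 1) by rewrite divr_gt0.
  near=> t; rewrite /= fl0 subr0 addr0 normrZ /GRing.scale /= mulr1.
  have t0 : t != 0 by near: t; exact: nbhs_dnbhs_neq.
  have t1 : `|t| <= 1 by near: t; exact: dnbhs0_le.
  have te : C * `|t| <= e.
    have : `|t| <= e / (C + 1) by near: t; exact: dnbhs0_le.
    by rewrite ler_pdivlMr// mulrDr mulr1 mulrC; apply: le_trans; rewrite lerDl.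
  rewrite normfV ler_pdivrMl ?normr_gt0//.
  apply: (le_trans (h t t1)); rewrite -(ger0_norm (sqr_ge0 t)) normrX expr2 mulrA mulrC.
  by apply: ler_wpM2l.
Unshelve. all: by end_near. Qed.

Lemma Cn_flatp n p : Cn n (flatp p).
Proof.
elim: n p => [//|n IH] p; exists (flatp ('X^2 * (p - p^`()))) => // x.
exact: is_derive_flatp.
Qed.

Definition flat (x : R) : R := flatp 1 x.

Lemma flatE x : flat x = if 0 < x then expR (- x^-1) else 0.
Proof. by rewrite /flat /flatp hornerE mul1r. Qed.

Lemma flat_ge0 x : 0 <= flat x.
Proof. by rewrite flatE; case: ifP => // _; exact: expR_ge0. Qed.

Lemma flat_gt0 x : 0 < x -> 0 < flat x.
Proof. by move=> x0; rewrite flatE x0 expR_gt0. Qed.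

Lemma flat_le0 x : x <= 0 -> flat x = 0.
Proof. by move=> x0; rewrite flatE ltNge x0. Qed.

Lemma flat_homo : {homo flat : x y / x <= y}.
Proof.
move=> x y xy; have [x0|x0] := leP x 0; first by rewrite flat_le0// flat_ge0.
have y0 : 0 < y by exact: lt_le_trans xy.
by rewrite !flatE x0 y0 ler_expR lerN2 lef_pV2.
Qed.

(** For x >= 1 the inner [flat (1 - x)] vanishes, and for x <= 0 it is at least [flat 1], so the
    outer [flat] is constant on both ends. Nesting [flat] in this way keeps the denominator a
    constant, where the usual cutoff divides by a function. *)
Definition step (x : R) : R :=
  flat (flat 1 - flat (1 - x)) / flat (flat 1).

Lemma step_den_gt0 : 0 < flat (flat 1).
Proof. by rewrite flat_gt0// flat_gt0. Qed.

Lemma step_le0 x : x <= 0 -> step x = 0.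
Proof.
move=> x0; rewrite /step flat_le0 ?mul0r// subr_le0.
by apply: flat_homo; lra.
Qed.

Lemma step_ge1 x : 1 <= x -> step x = 1.
Proof.
move=> x0; rewrite /step (@flat_le0 (1 - x)) ?subr0 ?subr_le0//.
by rewrite mulfV// gt_eqF// step_den_gt0.
Qed.

Lemma step_homo : {homo step : x y / x <= y}.
Proof.
move=> x y xy; rewrite /step ler_pM2r ?invr_gt0 ?step_den_gt0//.
by apply: flat_homo; rewrite lerB// flat_homo// lerB.
Qed.

Lemma step_ge0 x : 0 <= step x.
Proof.
have [x0|/ltW x0] := leP x 0; first by rewrite step_le0.
by rewrite -(step_le0 (lexx 0)); exact: step_homo.
Qed.

Lemma step_le1 x : step x <= 1.
Proof.
have [x0|/ltW x0] := leP 1 x; first by rewrite step_ge1.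
by rewrite -(step_ge1 (lexx 1)); exact: step_homo.
Qed.


Lemma Cn_step n : Cn n step.
Proof.
apply: CnM; last exact: Cn_cst.
apply: (Cn_comp (f := flat) (g := fun x => flat 1 - flat (1 - x))).
  exact: Cn_flatp.
have := CnD (Cn_cst n (flat 1))
  (CnM (Cn_cst n (-1)) (Cn_comp (Cn_flatp n 1) (Cn_affine n (-1) 1))).
congr (Cn n _); apply/funext => x /=.
by rewrite mulN1r mulN1r (addrC _ 1).
Qed.


Definition smooth1 f := forall n, Cn n f.

Lemma smooth1_is_derive f x : smooth1 f ->
  is_derive (x : R^o) (1 : R^o) (f : R^o -> R^o) (derive1 f x).
Proof.
move=> /(_ 1%N) [g fg _]; rewrite derive1E.
by have [df _] := fg x; split.
Qed.

Lemma smooth1_derive1 f : smooth1 f -> smooth1 (derive1 f).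
Proof.
move=> sf n; have [g fg cg] := sf n.+1.
suff -> : derive1 f = g by [].
by apply/funext => x; rewrite derive1E; have [_ ->] := fg x.
Qed.

Lemma smooth1_derivable f x : smooth1 f -> derivable (f : R^o -> R^o) x 1.
Proof. by move=> /(smooth1_is_derive x) []. Qed.

Lemma smooth1_continuous f : smooth1 f -> continuous f.
Proof.
move=> sf x; apply: (@differentiable_continuous _ R^o R^o x f).
exact/derivable1_diffP/smooth1_derivable.
Qed.

Lemma smooth1M f g : smooth1 f -> smooth1 g -> smooth1 (fun x => f x * g x).
Proof. by move=> sf sg n; exact: CnM. Qed.

Lemma smooth1D f g : smooth1 f -> smooth1 g -> smooth1 (fun x => f x + g x).
Proof. by move=> sf sg n; exact: CnD. Qed.

Lemma smooth1Z (a : R) f : smooth1 f -> smooth1 (fun x => a * f x).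
Proof. by move=> sf; apply: smooth1M => // n; exact: Cn_cst. Qed.

Lemma smooth1_affine f (a b : R) : smooth1 f -> smooth1 (fun x => f (a * x + b)).
Proof. by move=> sf n; apply: Cn_comp => //; exact: Cn_affine. Qed.

Lemma derive1_affine f (a b x : R) : smooth1 f ->
  derive1 (fun x => f (a * x + b)) x = a * derive1 f (a * x + b).
Proof.
move=> sf; rewrite derive1E.
have da : is_derive (x : R^o) (1 : R^o) (fun x : R^o => a * x + b : R^o) a.
  apply: (is_derive_eq (is_deriveD (is_deriveZ a (is_derive_id x 1)) (is_derive_cst b x 1))).
  by rewrite addr0 /GRing.scale/= mulr1.
have [_ ->] := is_derive1_comp (g := fun x => a * x + b) (smooth1_is_derive (a * x + b) sf) da.
by rewrite mulrC.
Qed.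

Lemma smooth1_step : smooth1 step.
Proof. by move=> n; exact: Cn_step. Qed.

Lemma derive1_eq0 f (a x : R) (A : set R) : open A -> A x ->
  (forall y, A y -> f y = a) -> derive1 f x = 0.
Proof.
move=> oA Ax fA; rewrite derive1E (@near_eq_derive _ _ _ _ (cst a)) ?derive_cst//.
by near=> y; apply: fA; near: y; exact: open_nbhs_nbhs.
Unshelve. all: by end_near. Qed.

Lemma derive1_step_out x : x < 0 \/ 1 < x -> derive1 step x = 0.
Proof.
move=> [x0|x1].
  apply: (@derive1_eq0 _ 0 _ `]-oo, 0[%classic) => //.
  by move=> y; rewrite /= in_itv/= => y0; rewrite step_le0// ltW.
apply: (@derive1_eq0 _ 1 _ `]1, +oo[%classic) => //; first by rewrite /= in_itv/= x1.
by move=> y; rewrite /= in_itv/= andbT => y0; rewrite step_ge1// ltW.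
Qed.

Lemma derive1_step_ge0 x : 0 <= derive1 step x.
Proof.
have d : derivable (step : R^o -> R^o) x 1 by exact: smooth1_derivable smooth1_step.
rewrite derive1E; apply: limr_ge => //; near=> h.
have [h0|h0|->] := ltgtP h 0; last by rewrite invr0 scale0r.
- rewrite /GRing.scale /= mulr_le0// ?invr_le0 ?(ltW h0)//.
  by rewrite subr_le0 step_homo// mulr1 gerDr ltW.
- rewrite /GRing.scale /= mulr_ge0// ?invr_ge0 ?(ltW h0)//.
  by rewrite subr_ge0 step_homo// mulr1 lerDr ltW.
Unshelve. all: by end_near. Qed.

End smooth_step.

(** * Lebesgue measure on R^3 *)

Section lebesgue3_theory.
Variable R : realType.
Local Notation E := 'cV[R]_3.
Local Notation mu := (@lebesgue3 R).
Local Notation leb := (@lebesgue_measure R).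

Lemma measurable_coord (i : 'I_3) : measurable_fun setT (fun x : E => x i 0).
Proof.
move=> _ A mA; rewrite setTI; apply: sub_sigma_algebra => /=.
rewrite -bigcup_mkord_ord; exists i => //=.
by exists A => //; rewrite setTI inord_val.
Qed.

Lemma measurable_cV d (T : measurableType d) (f : T -> E) :
  (forall i, measurable_fun setT (fun t => f t i 0)) -> measurable_fun setT f.
Proof.
move=> mf.
suff h : g_sigma_preimage (fun i t => f t i 0 : measurableTypeR R) `<=` measurable.
  move=> _ A mA; rewrite setTI; apply: h.
  rewrite (g_sigma_preimage_comp
    (fun i (x : 'cV[R]_3) => x i 0 : measurableTypeR R)).
  by exists A => //; rewrite setTI.
apply: smallest_sub; first exact: sigma_algebra_measurable.
rewrite -bigcup_mkord_ord; apply: bigcup_sub => i Ii.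
by move=> A [B mB <-]; exact: mf.
Qed.

Lemma measurable_addv d (T : measurableType d) (f g : T -> E) :
  measurable_fun setT f -> measurable_fun setT g ->
  measurable_fun setT (fun t => f t + g t).
Proof.
move=> mf mg; apply: measurable_cV => i.
under eq_fun do rewrite mxE.
apply: measurable_funD; apply: (measurableT_comp (measurable_coord i)) => //.
Qed.

Lemma measurable_scalev d (T : measurableType d) (a : R) (f : T -> E) :
  measurable_fun setT f -> measurable_fun setT (fun t => a *: f t).
Proof.
move=> mf; apply: measurable_cV => i.
under eq_fun do rewrite mxE.
apply: measurable_funM => //; exact: (measurableT_comp (measurable_coord i)).
Qed.

Lemma lebesgue_measure_shift (a : R) (A : set R) : measurable A ->
  leb ((fun x => x + a) @^-1` A) = leb A.
Proof.
have mf : measurable_fun setT (fun x : measurableTypeR R => x + a : measurableTypeR R).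
  by apply: measurable_funD.
pose f : {mfun measurableTypeR R >-> measurableTypeR R} :=
  HB.pack (fun x : measurableTypeR R => x + a) (isMeasurableFun.Build _ _ _ _ _ mf).
move=> mA; apply/esym.
apply: (@lebesgue_measure_unique R (pushforward leb f)) => // _ [[u v]] _ <-.
rewrite [RHS](_ : _ = leb `](u - a), (v - a)]%classic); last first.
  by congr leb; apply/seteqP; split => x /=; rewrite !in_itv/= ltrBlDr lerBrDr.
by rewrite !lebesgue_measure_itv/= !lte_fin ltrD2r -!EFinB; congr (if _ then _%:E else _); ring.
Qed.

Lemma lebesgue_measure_shiftN (s : bool) (a : R) (A : set R) : measurable A ->
  leb ((fun x => (-1) ^+ s * x + a) @^-1` A) = leb A.
Proof.
case: s => mA.
  rewrite -[RHS](lebesgue_measure_shift a)//.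
  rewrite -[RHS]lebesgue_measureN//; last first.
    rewrite -[X in measurable X]setTI.
    by apply: (_ : measurable_fun setT (fun x : R => x + a)) => //; exact: measurable_funD.
  by rewrite /pushforward /=; congr leb; apply/seteqP; split => x /=; rewrite expr1 mulN1r.
rewrite -[RHS](lebesgue_measure_shift a)//.
by congr leb; apply/seteqP; split => x /=; rewrite expr0 mul1r.
Qed.

Lemma measurable_affine1 (s : bool) (a : R) :
  measurable_fun setT (fun x : R => (-1) ^+ s * x + a).
Proof. by apply: measurable_funD => //; exact: measurable_funM. Qed.

Lemma product_shiftN d1 d2 (T1 : measurableType d1) (T2 : measurableType d2)
    (m1 : {sigma_finite_measure set T1 -> \bar R})
    (m2 : {sigma_finite_measure set T2 -> \bar R}) (f1 : T1 -> T1) (f2 : T2 -> T2) :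
  measurable_fun setT f1 -> measurable_fun setT f2 ->
  (forall A, measurable A -> m1 (f1 @^-1` A) = m1 A) ->
  (forall A, measurable A -> m2 (f2 @^-1` A) = m2 A) ->
  forall A, measurable A ->
    (m1 \x m2)%E ((fun p => (f1 p.1, f2 p.2)) @^-1` A) = (m1 \x m2)%E A.
Proof.
move=> mf1 mf2 h1 h2.
have mf : measurable_fun setT (fun p : T1 * T2 => (f1 p.1, f2 p.2)).
  by apply: measurable_fun_pair; apply: measurableT_comp.
pose f : {mfun (T1 * T2)%type >-> (T1 * T2)%type} :=
  HB.pack (fun p : T1 * T2 => (f1 p.1, f2 p.2)) (isMeasurableFun.Build _ _ _ _ _ mf).
move=> A mA; apply/esym.
apply: (@product_measure_unique _ _ _ _ _ m1 m2 (pushforward (m1 \x m2)%E f)) => //.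
move=> B C mB mC.
have e : (fun p => (f1 p.1, f2 p.2)) @^-1` (B `*` C) = (f1 @^-1` B) `*` (f2 @^-1` C).
  by apply/seteqP; split => -[].
transitivity ((m1 \x m2)%E ((f1 @^-1` B) `*` (f2 @^-1` C))).
  exact: (congr1 (m1 \x m2)%E e).
have mP (d : measure_display) (T : measurableType d) (g : T -> T) (D : set T) :
  measurable_fun setT g -> measurable D -> measurable (g @^-1` D).
  by move=> mg mD; rewrite -[X in measurable X]setTI; exact: mg.
have mB' : measurable (f1 @^-1` B) by exact: mP.
have mC' : measurable (f2 @^-1` C) by exact: mP.
by rewrite product_measure1E//; congr (_ * _)%E; [exact: h1|exact: h2].
Qed.

(** A named planar measure, so that it can carry the sigma-finite structure that the product
    theorems ask of their first factor. *)
Definition lebesgue2 : set (measurableTypeR R * measurableTypeR R) -> \bar R :=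
  (leb \x leb)%E.

HB.instance Definition _ := Measure.on lebesgue2.

Lemma lebesgue2_sigma_finite : sigma_finite setT lebesgue2.
Proof.
rewrite /lebesgue2.
pose I n : set (measurableTypeR R) := `]- n%:R, n%:R[%classic.
exists (fun n => I n `*` I n).
  apply/seteqP; split => // -[x y] _.
  exists (maxn (Num.truncn `|x|).+1 (Num.truncn `|y|).+1) => //.
  split; rewrite /I /= in_itv /= -ltr_norml.
    by apply: (lt_le_trans (truncnS_gt _)); rewrite ler_nat leq_maxl.
  by apply: (lt_le_trans (truncnS_gt _)); rewrite ler_nat leq_maxr.
move=> n; have mI : measurable (I n) by exact: measurable_itv.
split; first exact: measurableX.
have Ioo : (leb (I n) < +oo)%E.
  by rewrite lebesgue_measure_itv/=; case: ifP => _; rewrite -?EFinB ltry.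
by rewrite product_measure1E// lte_mul_pinfty// ge0_fin_numE.
Qed.

HB.instance Definition _ := Measure_isSigmaFinite.Build _ _ _
  lebesgue2 lebesgue2_sigma_finite.

(** Translation by [v] for [s = false], point reflection x |-> v - x for [s = true]: convolutions
    need both, and one change of variables serves them. *)
Definition aff3 (s : bool) (v : E) (x : E) : E := (-1) ^+ s *: x + v.

Lemma measurable_aff3 s v : measurable_fun setT (aff3 s v).
Proof. by apply: measurable_addv => //; exact: measurable_scalev. Qed.

Lemma lebesgue3_aff s v (A : set E) : measurable A ->
  mu (aff3 s v @^-1` A) = mu A.
Proof.
move=> mA; rewrite /lebesgue3 /pushforward.
pose f (i : 'I_3) (x : measurableTypeR R) : measurableTypeR R := (-1) ^+ s * x + v i 0.
have mf i : measurable_fun setT (f i) by exact: measurable_affine1.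
have hf i (B : set (measurableTypeR R)) : measurable B -> leb (f i @^-1` B) = leb B.
  exact: lebesgue_measure_shiftN.
pose f12 (p : measurableTypeR R * measurableTypeR R) := (f 0 p.1, f 1 p.2).
have mf12 : measurable_fun setT f12.
  by apply: measurable_fun_pair; apply: measurableT_comp.
have hf12 B : measurable B -> (leb \x leb)%E (f12 @^-1` B) = (leb \x leb)%E B.
  exact: (@product_shiftN _ _ _ _ leb leb _ _ (mf 0) (mf 1) (hf 0) (hf 1)).
rewrite -[RHS](@product_shiftN _ _ (measurableTypeR R * measurableTypeR R)%type (measurableTypeR R) lebesgue2 leb _ _ mf12 (mf 2) hf12 (hf 2)); last first.
  by rewrite -[X in measurable X]setTI; exact: measurable_col3.
congr (_ _); apply/seteqP; split => -[[x y] z] /=;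
  rewrite (_ : aff3 s v (col3 (x, y, z)) = col3 (f 0 x, f 1 y, f 2 z)) //.
  by apply/matrixP => i j; rewrite !mxE (ord1 j); case: i => [[|[|[|//]]] ?] /=;
    rewrite /f; congr (_ + v _ _); exact: val_inj.
by apply/matrixP => i j; rewrite !mxE (ord1 j); case: i => [[|[|[|//]]] ?] /=;
    rewrite /f; congr (_ + v _ _); exact: val_inj.
Qed.

Lemma ge0_integral_aff3 s (v : E) (D : set E) (f : E -> \bar R) :
  measurable D -> measurable_fun (D : set E) f -> (forall y, D y -> (0 <= f y)%E) ->
  (\int[mu]_(x in aff3 s v @^-1` D) f (aff3 s v x) = \int[mu]_(x in D) f x)%E.
Proof.
move=> mD mf f0.
transitivity (\int[pushforward mu (aff3 s v)]_(y in D) f y)%E.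
  apply/esym/(@ge0_integral_pushforward _ _ _ _ _ _ (measurable_aff3 s v) mu D f) => //.
  by move=> y; rewrite inE; exact: f0.
pose g : {mfun E >-> E} :=
  HB.pack (aff3 s v) (isMeasurableFun.Build _ _ _ _ _ (measurable_aff3 s v)).
apply: (@eq_measure_integral _ _ _ D mu (pushforward mu g)) => A mA _.
exact: lebesgue3_aff.
Qed.

Lemma integral_aff3 s (v : E) (D : set E) (f : E -> \bar R) :
  measurable D -> measurable_fun (D : set E) f ->
  (\int[mu]_(x in aff3 s v @^-1` D) f (aff3 s v x) = \int[mu]_(x in D) f x)%E.
Proof.
move=> mD mf; rewrite integralE [RHS]integralE; congr (_ - _)%E.
  transitivity (\int[mu]_(x in aff3 s v @^-1` D) (f^\+ (aff3 s v x)))%E.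
    by apply: eq_integral => x _; rewrite !funeposE.
  by apply: ge0_integral_aff3 => //; exact: measurable_funepos.
transitivity (\int[mu]_(x in aff3 s v @^-1` D) (f^\- (aff3 s v x)))%E.
    by apply: eq_integral => x _; rewrite !funenegE.
  by apply: ge0_integral_aff3 => //; exact: measurable_funeneg.
Qed.

Lemma aff3_0 v x : aff3 false v x = x + v.
Proof. by rewrite /aff3 expr0 scale1r. Qed.

Lemma aff3_1 v x : aff3 true v x = v - x.
Proof. by rewrite /aff3 expr1 scaleN1r addrC. Qed.

Lemma integral_shift (v : E) (f : E -> \bar R) : measurable_fun [set: E] f ->
  (\int[mu]_x f (x + v)%R = \int[mu]_x f x)%E.
Proof.
move=> mf; have := @integral_aff3 false v setT f measurableT mf.
rewrite preimage_setT => <-; by apply: eq_integral => x _; rewrite aff3_0.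
Qed.

Lemma integral_reflect (v : E) (f : E -> \bar R) : measurable_fun [set: E] f ->
  (\int[mu]_x f (v - x)%R = \int[mu]_x f x)%E.
Proof.
move=> mf; have := @integral_aff3 true v setT f measurableT mf.
rewrite preimage_setT => <-; by apply: eq_integral => x _; rewrite aff3_1.
Qed.

Lemma lebesgue3_box (a b : 'I_3 -> R) :
  mu [set x : E | forall i, a i < x i 0 < b i] =
  (\prod_i Num.max 0 (b i - a i))%:E.
Proof.
have -> : mu [set x : E | forall i, a i < x i 0 < b i] =
  ((leb \x leb) \x leb)%E ((`]a 0, b 0[%classic `*` `]a 1, b 1[%classic) `*` `]a 2, b 2[%classic).
  rewrite /lebesgue3 /pushforward; congr (_ _).
  apply/seteqP; split => -[[x y] z] /=.
    move=> h; rewrite !in_itv/=; move: (h 0) (h 1) (h 2); rewrite !mxE/=.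
    by move=> -> -> ->.
  rewrite !in_itv/= => -[[h0 h1] h2] i; rewrite !mxE.
  case: i => [[|[|[|//]]] hi] /=.
  - by rewrite (_ : Ordinal hi = 0)//; exact: val_inj.
  - by rewrite (_ : Ordinal hi = 1)//; exact: val_inj.
  - by rewrite (_ : Ordinal hi = 2)//; exact: val_inj.
have L (i : 'I_3) : leb `]a i, b i[%classic = (Num.max 0 (b i - a i))%:E.
  rewrite lebesgue_measure_itv/= lte_fin; case: ltP => h.
    by rewrite max_r// subr_ge0 ltW.
  by rewrite max_l// subr_le0.
rewrite product_measure1E//; last exact: measurableX.
rewrite [X in (X * _)%E]product_measure1E//.
rewrite !big_ord_recr big_ord0 /= mul1r !EFinM -!L.
rewrite (_ : widen_ord _ (widen_ord _ _) = 0); last exact: val_inj.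
rewrite (_ : widen_ord _ _ = 1); last exact: val_inj.
by rewrite (_ : ord_max = 2); last exact: val_inj.
Qed.

Lemma measurable_box (a b : 'I_3 -> R) :
  measurable [set x : E | forall i, a i < x i 0 < b i].
Proof.
rewrite (_ : [set _ | _] = \bigcap_(i in [set: 'I_3]) ((fun x : E => x i 0) @^-1` `]a i, b i[%classic)).
  apply: fin_bigcap_measurable => // i _.
  by rewrite -[X in measurable X]setTI; apply: measurable_coord.
apply/seteqP; split => x /= h i; first by move=> _ /=; rewrite in_itv/=; exact: h.
by move: (h i Logic.I); rewrite /= in_itv.
Qed.

Definition cube (r : R) : set E := [set x | forall i, `|x i 0| < r].

Lemma cubeE r : cube r = [set x : E | forall i, - r < x i 0 < r].
Proof. by apply/seteqP; split => x h i; move: (h i); rewrite ltr_norml. Qed.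

Lemma measurable_cube r : measurable (cube r).
Proof. by rewrite cubeE; exact: measurable_box. Qed.

Lemma cube_fin r : (mu (cube r) < +oo)%E.
Proof. by rewrite cubeE lebesgue3_box ltry. Qed.

Lemma cubeS r s : r <= s -> cube r `<=` cube s.
Proof. by move=> rs x h i; exact: lt_le_trans (h i) rs. Qed.

Lemma cube_norm (x : E) r : `|x| < r -> cube r x.
Proof.
move=> xr i; apply: le_lt_trans xr.
have -> : `|x| = mx_norm x by [].
by rewrite mx_normrE; apply: (le_bigmax _ _ (i, 0)).
Qed.

Lemma norm_cube (x : E) r : 0 <= r -> (forall i, `|x i 0| <= r) -> `|x| <= r.
Proof.
move=> r0 h; have -> : `|x| = mx_norm x by [].
rewrite mx_normrE; apply/bigmax_leP; split => //= -[i j] _ /=.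
by rewrite (ord1 j).
Qed.

Lemma bigcup_cube : \bigcup_n cube n%:R = [set: E].
Proof.
apply/seteqP; split => // x _; exists (Num.truncn `|x|).+1 => //.
exact/cube_norm/truncnS_gt.
Qed.

Lemma lebesgue3_sigma_finite : sigma_finite setT mu.
Proof.
exists (fun n => cube n%:R); first by rewrite bigcup_cube.
by move=> n; split; [exact: measurable_cube|exact: cube_fin].
Qed.

HB.instance Definition _ := Measure_isSigmaFinite.Build _ _ _ mu
  lebesgue3_sigma_finite.

(** The sigma-algebra is generated by the coordinates, so an open set has to be exhibited as a
    countable union of boxes, here cubes with rational centre and radius. *)
Lemma measurable_open (U : set E) : open U -> measurable U.
Proof.
move=> oU.
pose B (q : {ffun 'I_3 -> rat} * rat) :=
  [set x : E | forall i, (ratr (q.1 i) - ratr q.2 : R) < x i 0 < ratr (q.1 i) + ratr q.2].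
rewrite (_ : U = \bigcup_q (if `[< B q `<=` U >] then B q else set0)).
  apply: countable_bigcupT_measurable => // q.
  by case: ifP => _ //; exact: measurable_box.
apply/seteqP; split => [x Ux|x [q _]]; last by case: asboolP => // h; exact: h.
have /nbhs_ballP[/= e e0 he] : nbhs x U by exact: open_nbhs_nbhs.
(* A cube of radius [d] whose centre is within [d] of [x] reaches at most 2d from [x], hence the
   bound e / 2. *)
have [d [d0 de]] : exists d : rat, (0 : R) < ratr d /\ (ratr d : R) < e / 2.
  have := @rat_in_itvoo R 0 (e / 2); rewrite divr_gt0// => /(_ isT) [d].
  by rewrite in_itv/= => /andP[? ?]; exists d.
have hq i : exists q : rat, `|x i 0 - ratr q| < (ratr d : R).
  have := @rat_in_itvoo R (x i 0 - ratr d) (x i 0 + ratr d).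
  case; first by rewrite ltrD2l; lra.
  move=> q; rewrite in_itv/= => /andP[? ?]; exists q; rewrite ltr_norml; lra.
pose q := [ffun i => projT1 (cid (hq i))].
have hqi i : `|x i 0 - ratr (q i)| < (ratr d : R).
  by rewrite /q ffunE; case: cid.
exists (q, d) => //; rewrite asboolT.
  by move=> i; move: (hqi i); rewrite ltr_norml /= => /andP[? ?]; lra.
move=> y hy; apply: he; rewrite -ball_normE /=.
apply: (@le_lt_trans _ _ (2 * ratr d)); last by lra.
apply: norm_cube; first by lra.
move=> i; rewrite !mxE; move: (hqi i) (hy i); rewrite /= ltr_norml ler_norml.
by move=> /andP[? ?] /andP[? ?]; lra.
Qed.

Lemma measurable_continuous (f : E -> R) : continuous f -> measurable_fun setT f.
Proof.
move=> cf; apply: (measurability _ (RGenOpens.measurableE R)) => //.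
move=> _ [_ [a [b ->] <-]]; rewrite setTI; apply: measurable_open.
by move/continuousP : cf; apply; exact: interval_open.
Qed.

End lebesgue3_theory.

(** * Test functions *)

Section Rintegral_lemmas.
Context d (T : measurableType d) (R : realType) (m : {measure set T -> \bar R}).

Lemma Rintegral_dominated (D : set T) (f_ : nat -> T -> R) (f g : T -> R) :
  measurable D -> (forall n, measurable_fun D (f_ n)) -> measurable_fun D f ->
  {ae m, forall x, D x -> f_ ^~ x @ \oo --> f x} ->
  m.-integrable D (EFin \o g) -> (forall n x, D x -> `|f_ n x| <= g x) ->
  m.-integrable D (EFin \o f) /\
  \int[m]_(x in D) f_ n x @[n --> \oo] --> \int[m]_(x in D) f x.
Proof.
move=> mD mf_ mf cf ig fg.
have [|||||intf _ cvgf] := @dominated_convergence _ _ _ m D mD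
  (fun n => EFin \o f_ n) (EFin \o f) (EFin \o g).
- by move=> n; exact/measurable_EFinP.
- exact/measurable_EFinP.
- by apply: filterS cf => x h Dx; apply: cvg_EFin; [exact: nearW|exact: h].
- exact: ig.
- by apply: aeW => x n Dx; rewrite /= lee_fin; exact: fg.
split => //; apply: fine_cvg; rewrite /Rintegral fineK.
  exact: cvgf.
exact: integrable_fin_num.
Qed.

Lemma integrable_le (D : set T) (f g : T -> R) : measurable D ->
  measurable_fun D f -> m.-integrable D (EFin \o g) ->
  (forall x, D x -> `|f x| <= g x) -> m.-integrable D (EFin \o f).
Proof.
move=> mD mf ig fg; apply: (le_integrable mD _ _ ig); first exact/measurable_EFinP.
by move=> x Dx /=; rewrite lee_fin (le_trans (fg x Dx))// ler_norm.
Qed.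

Lemma ae_eq_Rintegral (D : set T) (f g : T -> R) : measurable D ->
  measurable_fun D f -> measurable_fun D g ->
  {ae m, forall x, D x -> f x = g x} ->
  \int[m]_(x in D) f x = \int[m]_(x in D) g x.
Proof.
move=> mD mf mg fg; rewrite /Rintegral; congr fine.
apply: ae_eq_integral => //; [exact/measurable_EFinP..|].
by apply: filterS fg => x h /h /= ->.
Qed.

Lemma Rintegral_sum (I : Type) (s : seq I) (D : set T) (f : I -> T -> R) :
  measurable D -> (forall i, m.-integrable D (EFin \o f i)) ->
  \int[m]_(x in D) (\sum_(i <- s) f i x) = \sum_(i <- s) \int[m]_(x in D) f i x /\
  m.-integrable D (EFin \o (fun x => \sum_(i <- s) f i x)).
Proof.
move=> mD If; elim: s => [|i s [IH1 IH2]].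
  under eq_Rintegral do rewrite big_nil.
  rewrite Rintegral_cst// mul0r big_nil; split=> //.
  rewrite (_ : _ \o _ = cst 0%E); first exact: integrable0.
  by apply/funext => x /=; rewrite big_nil.
have E : (fun x => \sum_(j <- i :: s) f j x) = (fun x => f i x + \sum_(j <- s) f j x).
  by apply/funext => x; rewrite big_cons.
rewrite E RintegralD// IH1 big_cons; split=> //.
have := integrableD mD (If i) IH2.
by congr (m.-integrable _ _); apply/funext => x /=; rewrite EFinD.
Qed.

End Rintegral_lemmas.

Section test_functions.
Variable R : realType.
Local Notation E := 'cV[R]_3.
Local Notation mu := (@lebesgue3 R).

Lemma indic_ge0 (A : set E) x : 0 <= \1_A x :> R.
Proof. by rewrite indicE; case: (_ \in _). Qed.

Lemma indic_le1 (A : set E) x : \1_A x <= 1 :> R.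
Proof. by rewrite indicE; case: (_ \in _). Qed.

Lemma indic_mono (A B : set E) x : A `<=` B -> \1_A x <= \1_B x :> R.
Proof.
move=> AB; rewrite !indicE; case: (boolP (x \in A)) => //= xA.
by rewrite (mem_set (AB x (set_mem xA))).
Qed.

(** Boundedness and support in one inequality, in the shape that dominated convergence uses. *)
Definition cbounded (M r : R) (f : E -> R) :=
  measurable_fun setT f /\ forall x, `|f x| <= M * \1_(cube r) x.

Lemma cbounded_M_ge0 M r f : cbounded M r f -> 0 < r -> 0 <= M.
Proof.
move=> [_ h] r0; have := h 0; rewrite indicE mem_set ?mulr1; first exact: le_trans.
by move=> i; rewrite mxE normr0.
Qed.

Lemma integrable_indic_cube r : mu.-integrable setT (fun x => (\1_(cube r) x)%:E).
Proof.
apply/integrableP; split.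
  by apply/measurable_EFinP; exact: measurable_indic (measurable_cube r).
under eq_integral do rewrite gee0_abs ?lee_fin ?indic_ge0//.
rewrite integral_indic//; last exact: measurable_cube.
by rewrite setIT; exact: cube_fin.
Qed.

Lemma cbounded_integrable M r f : cbounded M r f ->
  mu.-integrable setT (EFin \o f).
Proof.
move=> [mf h]; apply: (integrable_le measurableT mf) => [|x _]; last exact: h.
apply: (@eq_integrable _ _ _ _ _ _ (fun x => M%:E * (\1_(cube r) x)%:E)%E) => //.
by apply: integrableZl => //; exact: integrable_indic_cube.
Qed.

Lemma cbounded_mul_integrable M r f g : cbounded M r f ->
  mu.-integrable (cube r) (EFin \o g) -> mu.-integrable setT (EFin \o (fun x => g x * f x)).
Proof.
move=> [mf h] ig.
have ig' : mu.-integrable setT (EFin \o (g \_ (cube r))).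
  have /(integrable_mkcond _ (measurable_cube r)) := ig.
  by rewrite restrict_EFin.
have [mg _] := integrableP _ _ _ ig'; move/measurable_EFinP in mg.
have E1 : (fun x => g x * f x) = (fun x => (g \_ (cube r)) x * f x).
  apply/funext => x; rewrite /restrict; case: ifPn => // xr.
  have := h x; rewrite indicE (negbTE xr) mulr0 normr_le0 => /eqP ->.
  by rewrite !mulr0.
have ig2 : mu.-integrable setT (EFin \o (fun x => `|M| * `|(g \_ (cube r)) x|)).
  apply: (@eq_integrable _ _ _ _ _ _ (fun x => `|M|%:E * (`|(g \_ (cube r)) x|)%:E)%E) => //.
  apply: integrableZl => //.
  by have /integrable_abse := ig'; apply: eq_integrable.
rewrite E1; apply: (integrable_le measurableT _ ig2); first exact: measurable_funM.
move=> x _; rewrite normrM mulrC ler_wpM2r//.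
apply: (le_trans (h x)); apply: (@le_trans _ _ (`|M| * \1_(cube r) x)).
  by rewrite ler_wpM2r ?indic_ge0// ler_norm.
by rewrite ler_piMr ?indic_le1.
Qed.

(** Compactness of a product of segments is transported from row to column vectors along
    transposition. *)
Lemma cube_compact_closure (A : set E) r : A `<=` cube r -> compact (closure A).
Proof.
move=> Ar.
pose K := [set v : 'rV[R]_3 | forall i, `[- r, r]%classic (v ord0 i)].
have cK : compact K.
  apply: (@rV_compact _ _ (fun=> `[- r, r]%classic)) => _.
  exact: segment_compact.
have ctr : continuous (@trmx R 1 3).
  move=> x A' [P hP PA']; exists (fun i j => P j i) => [i j|M hM].
    by have := hP j i; rewrite mxE.
  by apply: PA' => i j; rewrite mxE; exact: hM.
have cK' : compact ((@trmx R 1 3) @` K).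
  by apply: continuous_compact => //; exact: continuous_subspaceT.
apply: (subclosed_compact _ cK'); first exact: closed_closure.
have clK : closed ((@trmx R 1 3) @` K) by apply: compact_closed => //; exact: norm_hausdorff.
rewrite [X in _ `<=` X](closure_id _).1//; apply: closure_subset.
move=> x /Ar xr; exists x^T; last by rewrite trmxK.
by move=> i /=; rewrite in_itv/= mxE -ler_norml ltW.
Qed.

Lemma compact_cube (K : set E) : compact K -> exists r, K `<=` cube r.
Proof.
move=> /compact_bounded [M [_ h]]; exists (`|M| + 2) => x Kx.
apply: cube_norm; have : `|x| <= `|M| + 1.
  by apply: h => //; rewrite ltr_pwDr// ler_norm.
by move/le_lt_trans; apply; rewrite ltrD2l ltr1n.
Qed.

Lemma smooth_continuous (f : E -> R) : smooth f -> continuous f.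
Proof. by move=> sf x; apply: differentiable_continuous; exact: (sf [::]). Qed.

Lemma smooth_partial (f : E -> R) j : smooth f -> smooth (partial j f).
Proof. by move=> sf s y; have := sf (rcons s j) y; rewrite foldr_rcons. Qed.

Lemma test_cbounded phi : test_function phi -> exists M r, 0 < r /\ cbounded M r phi.
Proof.
move=> [sphi cphi]; have cf := smooth_continuous sphi.
have [r hr] := compact_cube cphi.
have : compact (phi @` closure [set y | phi y != 0]).
  by apply: continuous_compact => //; exact: continuous_subspaceT.
move=> /compact_bounded [M [_ hM]].
exists (`|M| + 1), (`|r| + 1); split; first by rewrite ltr_wpDl.
split; first exact: measurable_continuous.
move=> x; have [->|x0] := eqVneq (phi x) 0.
  by rewrite normr0 mulr_ge0 ?indic_ge0.
have clx : closure [set y | phi y != 0] x by exact: subset_closure.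
rewrite indicE mem_set ?mulr1.
  by apply: (hM (`|M| + 1)); [rewrite ltr_pwDr// ler_norm|exists x].
apply: (cubeS _ (hr _ clx)).
by apply: (le_trans (ler_norm r)); rewrite lerDl.
Qed.

Lemma cbounded_test phi M r : smooth phi -> cbounded M r phi -> test_function phi.
Proof.
move=> sphi [_ h]; split => //; apply: (@cube_compact_closure _ r) => x /= x0.
apply: contrapT => xr; have := h x.
by rewrite indicE memNset// mulr0 normr_le0 (negbTE x0).
Qed.

Lemma test_partial (phi : E -> R) j : test_function phi -> test_function (partial j phi).
Proof.
move=> [sphi cphi]; split; first exact: smooth_partial.
apply: (subclosed_compact _ cphi); first exact: closed_closure.
rewrite [X in _ `<=` X](closure_id _).1; last exact: closed_closure.
apply: closure_subset => y /= y0; apply: contrapT => ny.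
move/eqP : y0; apply; rewrite /partial.
rewrite (@near_eq_derive _ _ _ _ (cst 0)) ?derive_cst//.
have : nbhs y (~` closure [set y | phi y != 0]).
  by apply: open_nbhs_nbhs; split => //; apply: closed_openC; exact: closed_closure.
apply: filterS => z nz; apply: contrapT => /eqP z0; apply: nz.
exact: subset_closure.
Qed.

Lemma partial_is_derive (phi : E -> R) j y : smooth phi ->
  is_derive y (delta_mx j 0) phi (partial j phi y).
Proof.
move=> sphi; apply: DeriveDef => //.
by apply: diff_derivable; exact: (sphi [::]).
Qed.

Lemma line_is_derive (phi : E -> R) j y (t : R) : smooth phi ->
  is_derive (t : R^o) (1 : R^o) (fun s : R^o => phi (y + s *: delta_mx j 0) : R^o)
    (partial j phi (y + t *: delta_mx j 0)).
Proof.
move=> sphi; have [d1 d2] := partial_is_derive j (y + t *: delta_mx j 0) sphi.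
have E1 : (fun h : R => h^-1 *: (((fun s : R^o => phi (y + s *: delta_mx j 0) : R^o) \o shift t)
    (h *: 1) - phi (y + t *: delta_mx j 0))) =
  (fun h : R => h^-1 *: ((phi \o shift (y + t *: delta_mx j 0)) (h *: delta_mx j 0) -
    phi (y + t *: delta_mx j 0))).
  apply/funext => h /=; congr (_ *: (phi _ - _)).
  by rewrite [h *: 1]mulr1 scalerDl addrCA.
apply: DeriveDef; first by rewrite /derivable E1.
by rewrite /derive E1.
Qed.

(** The mean value theorem, applied to the bounded derivative along a line. The bound, uniform in
    [t] and compactly supported in [y], is the dominating function for passing from difference
    quotients to derivatives under an integral. *)
Lemma test_diff_quot (phi : E -> R) j : test_function phi -> exists M r, [/\ 0 < r, 0 <= M &
  forall y t, `|t| <= 1 ->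
   `|phi (y + t *: delta_mx j 0) - phi y| <= `|t| * (M * \1_(cube r) y)].
Proof.
move=> tphi; have [M0 [r0 [r0p c0]]] := test_cbounded tphi.
have [M1 [r1 [r1p c1]]] := test_cbounded (test_partial j tphi).
have M10 := cbounded_M_ge0 c1 r1p.
(* The margin 1 absorbs the shift by at most 1: off this cube, [phi] vanishes at [y] and at every
   shifted point. *)
exists M1, (r0 + r1 + 1); split => //; first by rewrite ltr_wpDr// addr_gt0.
move=> y t t1; set e := delta_mx j 0.
have e1 i : `|e i 0 : R| <= 1.
  by rewrite mxE eqxx andbT; case: eqP; rewrite ?normr1 ?normr0.
have [yr|yr] := pselect (cube (r0 + r1 + 1) y); last first.
  have out s : `|s| <= 1 -> phi (y + s *: e) = 0.
    move=> s1; have [_ /(_ (y + s *: e))] := c0.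
    rewrite indicE memNset ?mulr0 ?normr_le0; first by move/eqP.
    move=> h; apply: yr => i; have := h i; rewrite !mxE => hi.
    have si : `|s * e i 0| <= 1 by rewrite normrM mulr_ile1.
    have : `|y i 0| <= `|y i 0 + s * e i 0| + `|s * e i 0|.
      by rewrite -{1}(addrK (s * e i 0) (y i 0)) (le_trans (ler_normB _ _)).
    by move: hi; rewrite /e !mxE; move: si; rewrite /e !mxE; lra.
  rewrite indicE memNset// !mulr0 out//.
  by have := out 0; rewrite normr0 scale0r addr0 => -> //; rewrite subrr normr0.
rewrite indicE mem_set// mulr1.
have cont a b : {within `[a, b]%classic, continuous (fun s : R^o => phi (y + s *: e) : R^o)}.
  apply: continuous_subspaceT => s; apply: differentiable_continuous.
  by apply/derivable1_diffP; have [] := line_is_derive j y s tphi.1.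
have B z : `|partial j phi z| <= M1.
  by apply: (le_trans (c1.2 z)); rewrite ler_piMr ?indic_le1.
have MV a b : a <= b -> `|phi (y + b *: e) - phi (y + a *: e)| <= (b - a) * M1.
  move=> ab.
  have [c _ ->] := @MVT_segment R (fun s => phi (y + s *: e)) (fun s => partial j phi (y + s *: e)) a b ab
   (fun x _ => line_is_derive j y x tphi.1) (cont a b).
  by rewrite normrM mulrC (ger0_norm (_ : 0 <= b - a)) ?subr_ge0// ler_wpM2l ?subr_ge0.
have [t0|/ltW t0] := leP 0 t.
  by have := MV 0 t t0; rewrite scale0r addr0 subr0 (ger0_norm t0).
by have := MV t 0 t0; rewrite scale0r addr0 sub0r distrC (ler0_norm t0).
Qed.

Lemma test_diff_quot_cvg (phi : E -> R) j y : smooth phi ->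
  (n.+1%:R : R) * (phi (y + n.+1%:R^-1 *: delta_mx j 0) - phi y) @[n --> \oo]
    --> partial j phi y.
Proof.
move=> sphi; have [d1 d2] := partial_is_derive j y sphi.
have H : (fun h : R => h^-1 *: ((phi \o shift y) (h *: delta_mx j 0) - phi y)) @ 0^'
   --> partial j phi y by [].
have n0 : (fun n => n.+1%:R^-1 : R) @ \oo --> (0 : R)^'.
  have := @cvg_harmonic R => /= h A /= hA.
  have := h _ hA; rewrite /nbhs /= /within/= => hh.
  by apply: filterS hh => n /=; apply; rewrite invr_neq0.
have := cvg_comp _ _ n0 H.
apply: cvg_trans; apply: near_eq_cvg; near=> n => /=.
by rewrite invrK /GRing.scale/= (addrC _ y).
Unshelve. all: by end_near. Qed.


Lemma Rintegral_shift (v : E) (f : E -> R) : measurable_fun [set: E] f ->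
  \int[mu]_x f (x + v) = \int[mu]_x f x.
Proof.
move=> mf; rewrite /Rintegral (@integral_shift R v (EFin \o f))//.
exact/measurable_EFinP.
Qed.

Lemma Rintegral_reflect (v : E) (f : E -> R) : measurable_fun [set: E] f ->
  \int[mu]_x f (v - x) = \int[mu]_x f x.
Proof.
move=> mf; rewrite /Rintegral (@integral_reflect R v (EFin \o f))//.
exact/measurable_EFinP.
Qed.

Lemma measurable_closed (A : set E) : closed A -> measurable A.
Proof.
move=> cA; rewrite -[A]setCK; apply: measurableC; apply: measurable_open.
exact: closed_openC.
Qed.

Lemma measurable_shiftv (v : E) : measurable_fun [set: E] (fun x => x + v).
Proof. exact: measurable_addv. Qed.

Lemma L2loc_cube (f : E -> R) r : L2loc f ->
  mu.-integrable (cube r) (EFin \o (fun x => f x ^+ 2)).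
Proof.
move=> [mf h]; have mf2 : measurable_fun setT (fun x => f x ^+ 2).
  exact: measurable_funX.
have mclc : measurable (closure (cube r)) by apply: measurable_closed; exact: closed_closure.
apply: (integrableS mclc) => //; first exact: measurable_cube.
  exact: subset_closure.
apply/integrableP; split; first by apply/measurable_EFinP; exact: measurable_funTS.
have := h _ (@cube_compact_closure (cube r) r (fun x h => h)).
apply: le_lt_trans; rewrite le_eqVlt; apply/orP; left; apply/eqP.
by apply: eq_integral => x _; rewrite gee0_abs ?lee_fin ?sqr_ge0.
Qed.

Lemma integrable_cst_cube (a r : R) : mu.-integrable (cube r) (EFin \o (cst a : E -> R)).
Proof.
apply: measurable_bounded_integrable => //; [exact: measurable_cube|exact: cube_fin|].
exact: bounded_cst.
Qed.

Lemma L2loc_mul_integrable (f g : E -> R) r : L2loc f -> L2loc g ->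
  mu.-integrable (cube r) (EFin \o (fun x => f x * g x)).
Proof.
move=> lf lg; have mc := @measurable_cube R r.
have ifg := integrableD mc (L2loc_cube r lf) (L2loc_cube r lg).
apply: (@integrable_le _ _ _ _ _ _ (fun x => f x ^+ 2 + g x ^+ 2)) mc _ _ _.
- by apply: measurable_funTS; apply: measurable_funM; [case: lf|case: lg].
- by apply: eq_integrable ifg => //; exact: measurable_cube.
- by move=> x _; rewrite ler_norml; apply/andP; split; nra.
Qed.

Lemma L2loc_integrable (f : E -> R) r : L2loc f -> mu.-integrable (cube r) (EFin \o f).
Proof.
move=> lf; have mc := @measurable_cube R r.
have ifg := integrableD mc (integrable_cst_cube 1 r) (L2loc_cube r lf).
apply: (@integrable_le _ _ _ _ _ _ (fun x => 1 + f x ^+ 2)) mc _ _ _.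
- by apply: measurable_funTS; case: lf.
- by apply: eq_integrable ifg => //; exact: measurable_cube.
- by move=> x _; rewrite ler_norml; apply/andP; split; nra.
Qed.

Definition loc_bounded (f : E -> R) := forall r, exists M, forall x, cube r x -> `|f x| <= M.

Lemma loc_bounded_integrable (f : E -> R) r : measurable_fun setT f -> loc_bounded f ->
  mu.-integrable (cube r) (EFin \o f).
Proof.
move=> mf /(_ r) [M hM]; apply: (integrable_le _ _ (integrable_cst_cube M r)) => //.
- exact: measurable_cube.
- exact: measurable_funTS.
Qed.

Lemma loc_bounded_L2loc (f : E -> R) : measurable_fun setT f -> loc_bounded f -> L2loc f.
Proof.
move=> mf bf; split => // K cK; have [r Kr] := compact_cube cK.
have [M hM] := bf r.
have mK : measurable K 
  by apply: measurable_closed; apply: compact_closed => //; exact: norm_hausdorff.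
have mf2 : measurable_fun setT (fun x => f x ^+ 2) by exact: measurable_funX.
have : (\int[mu]_(y in cube r) (M ^+ 2)%:E < +oo)%E.
  rewrite integral_cst; last exact: measurable_cube.
  by rewrite lte_mul_pinfty ?lee_fin ?sqr_ge0//; exact: cube_fin.
apply: le_lt_trans; apply: (@le_trans _ _ (\int[mu]_(y in cube r) (f y ^+ 2)%:E)%E).
  apply: ge0_subset_integral => //; first exact: measurable_cube.
    by apply/measurable_EFinP; exact: measurable_funTS.
  by move=> x _; rewrite lee_fin sqr_ge0.
apply: ge0_le_integral => //.
- exact: measurable_cube.
- by move=> x _; rewrite lee_fin sqr_ge0.
- by apply/measurable_EFinP; exact: measurable_funTS.
- by move=> x xr; rewrite lee_fin -real_normK ?num_real// lerXn2r ?nnegrE ?hM//; exact: le_trans (hM x xr).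
Qed.

(* Backward difference quotients of f, since the forward ones of the test function
   turn into them by translation. *)
Lemma classical_weak_partial (f w : E -> R) j :
  measurable_fun setT f -> measurable_fun setT w ->
  loc_bounded f ->
  (forall r, exists M, forall x n, cube r x ->
     `|n.+1%:R * (f (x - n.+1%:R^-1 *: delta_mx j 0) - f x)| <= M) ->
  (forall x, n.+1%:R * (f (x - n.+1%:R^-1 *: delta_mx j 0) - f x) @[n --> \oo] --> - w x) ->
  weak_partial j f w.
Proof.
move=> mf mw bf bq cq phi tphi.
pose e : E := delta_mx j 0; pose t n : R := n.+1%:R^-1.
have t1 n : `|t n| <= 1.
  by rewrite /t ger0_norm ?invr_ge0// invf_le1 ?ler1n.
have [M0 [r0 [r0p c0]]] := test_cbounded tphi.
have [M1 [r1 [r1p c1]]] := test_cbounded (test_partial j tphi).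
have M00 := cbounded_M_ge0 c0 r0p.
have [M [r [rp Mp hM]]] := test_diff_quot j tphi.
have [Mf hMf] := bf r; have [Mq hMq] := bq r0.
have mphi : measurable_fun setT phi by case: c0.
have mphis v : measurable_fun setT (fun x : E => phi (x + v)).
  by apply: (measurableT_comp mphi); exact: measurable_shiftv.
have mfs v : measurable_fun setT (fun x : E => f (x + v)).
  by apply: (measurableT_comp mf); exact: measurable_shiftv.
have I1 : \int[mu]_x (f x * (n.+1%:R * (phi (x + t n *: e) - phi x))) @[n --> \oo]
    --> \int[mu]_x (f x * partial j phi x).
  apply: (@Rintegral_dominated _ _ _ _ _ _ _ (fun x => Mf * M * \1_(cube r) x) measurableT _ _ _ _ _).2.
  - by move=> n; apply: measurable_funM => //; apply: measurable_funM => //; exact: measurable_funB.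
  - by apply: measurable_funM => //; case: c1.
  - apply: aeW => x _; apply: cvgM; first exact: cvg_cst.
    by apply: test_diff_quot_cvg; case: tphi.
  - have := integrableZl measurableT (Mf * M) (integrable_indic_cube r).
    by apply: eq_integrable.
  - move=> n x _; rewrite normrM normrM (ger0_norm (ler0n _ _)).
    have h2 : n.+1%:R * `|phi (x + t n *: e) - phi x| <= M * \1_(cube r) x.
      rewrite mulrC -ler_pdivlMr// mulrC -[n.+1%:R^-1]ger0_norm ?invr_ge0//.
      exact: hM.
    have [xr|xr] := pselect (cube r x).
      move: h2; rewrite indicE mem_set// !mulr1 => h2.
      by apply: ler_pM => //; exact: hMf.
    move: h2; rewrite indicE memNset// !mulr0 => h2.
    have -> : n.+1%:R * `|phi (x + t n *: e) - phi x| = 0.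
      by apply/eqP; rewrite eq_le h2 mulr_ge0.
    by rewrite mulr0.
have [iw I2] : mu.-integrable setT (EFin \o (fun x => - w x * phi x)) /\
  \int[mu]_x (n.+1%:R * (f (x - t n *: e) - f x) * phi x) @[n --> \oo]
    --> \int[mu]_x (- w x * phi x).
  apply: (@Rintegral_dominated _ _ _ _ _ _ _ (fun x => Mq * M0 * \1_(cube r0) x) measurableT _ _ _ _ _).
  - move=> n; apply: measurable_funM => //; apply: measurable_funM => //.
    by apply: measurable_funB.
  - by apply: measurable_funM => //; exact: measurableT_comp.
  - by apply: aeW => x _; apply: cvgM; [exact: cq|exact: cvg_cst].
  - have := integrableZl measurableT (Mq * M0) (integrable_indic_cube r0).
    by apply: eq_integrable.
  - move=> n x _; rewrite normrM; have h2 := c0.2 x.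
    have [xr|xr] := pselect (cube r0 x).
      move: h2; rewrite indicE mem_set// !mulr1 => h2.
      by apply: ler_pM => //; exact: hMq.
    move: h2; rewrite indicE memNset// !mulr0 => h2.
    have -> : `|phi x| = 0 by apply/eqP; rewrite eq_le h2 normr_ge0.
    by rewrite mulr0.
have EI n : \int[mu]_x (f x * (n.+1%:R * (phi (x + t n *: e) - phi x))) =
   \int[mu]_x (n.+1%:R * (f (x - t n *: e) - f x) * phi x).
  have i0 : mu.-integrable setT (EFin \o (fun x => f x * phi x)).
    by apply: cbounded_mul_integrable c0 _; exact: loc_bounded_integrable.
  have i2 : mu.-integrable setT (EFin \o (fun x => f (x - t n *: e) * phi x)).
    apply: cbounded_mul_integrable c0 _; apply: loc_bounded_integrable => //.
    move=> s; have [Mx hx] := bf (s + 1); exists Mx => x xs; apply: hx => i.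
    rewrite !mxE; apply: (le_lt_trans (ler_normB _ _)); rewrite ltr_leD//.
    by rewrite normrM mulr_ile1//; case: (_ == _); rewrite ?normr1 ?normr0.
  have i1 : mu.-integrable setT (EFin \o (fun x => f x * phi (x + t n *: e))).
    apply/integrableP; split; first by apply/measurable_EFinP; exact: measurable_funM.
    rewrite -(@integral_shift R (- (t n *: e))); last first.
      by apply: measurableT_comp => //; apply/measurable_EFinP; exact: measurable_funM.
    under eq_integral do rewrite /= subrK.
    by have /integrableP[] := i2.
  transitivity (n.+1%:R * (\int[mu]_x (f x * phi (x + t n *: e)) - \int[mu]_x (f x * phi x))).
    rewrite -RintegralB// -RintegralZl//; last first.
      by have := integrableB measurableT i1 i0; apply: eq_integrable.
    by apply: eq_Rintegral => x _; ring.
  rewrite -(@Rintegral_shift (- (t n *: e)) (fun x => f x * phi (x + t n *: e))); last first.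
    exact: measurable_funM.
  under eq_Rintegral do rewrite subrK.
  rewrite -RintegralB// -RintegralZl//; last first.
    by have := integrableB measurableT i2 i0; apply: eq_integrable.
  by apply: eq_Rintegral => x _; ring.
rewrite (_ : - _ = \int[mu]_x (- w x * phi x)).
  apply: (cvg_unique _ I1); first exact: Rhausdorff.
  by apply: cvg_trans I2; apply: near_eq_cvg; apply: nearW => n /=; exact/esym/EI.
rewrite -mulN1r -RintegralZl//; first by apply: eq_Rintegral => x _; ring.
have := integrableZl measurableT (-1) iw.
by apply: eq_integrable => // x _; rewrite /= -EFinM; congr EFin; ring.
Qed.

End test_functions.

(** * Test functions of product form *)

Section product_functions.
Variable R : realType.
Local Notation E := 'cV[R]_3.
Local Notation mu := (@lebesgue3 R).
Implicit Types f : 'I_3 -> R -> R.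

(** Kept as a family of factors, because differentiation, translation and reflection all act factor
    by factor ([prodf_d], [aff_factors]) and so stay in the class. *)
Definition prodf f (x : E) : R := \prod_i f i (x i 0).

Definition prodf_d j f : 'I_3 -> R -> R := fun i => if i == j then derive1 (f i) else f i.

Definition smooth_factors f := forall i, smooth1 (f i).

Lemma smooth_factors_d j f : smooth_factors f -> smooth_factors (prodf_d j f).
Proof. by move=> sf i; rewrite /prodf_d; case: eqP => // _; exact: smooth1_derive1. Qed.

Lemma prodfE f x : prodf f x = f 0 (x 0 0) * f 1 (x 1 0) * f 2 (x 2 0).
Proof.
rewrite /prodf !big_ord_recr big_ord0 /= mul1r.
rewrite (_ : widen_ord _ (widen_ord _ _) = 0); last exact: val_inj.
rewrite (_ : widen_ord _ _ = 1); last exact: val_inj.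
by rewrite (_ : ord_max = 2); last exact: val_inj.
Qed.

Lemma factor_differentiable (g : R -> R) i (x : E) : smooth1 g ->
  differentiable (fun y : E => g (y i 0)) x.
Proof.
move=> sg; apply: (@differentiable_comp _ _ _ _ (fun y : E => y i 0) g).
  exact: differentiable_coord.
exact/derivable1_diffP/smooth1_derivable.
Qed.

Lemma factor_is_derive (g : R -> R) i j (x : E) : smooth1 g ->
  is_derive x (delta_mx j 0) (fun y : E => g (y i 0)) ((i == j)%:R * derive1 g (x i 0)).
Proof.
move=> sg; apply: DeriveDef.
  exact/diff_derivable/factor_differentiable.
rewrite [LHS](_ : _ = 'D_((i == j)%:R : R^o) (g : R^o -> R^o) (x i 0)).
  case: (i == j); first by rewrite mul1r derive1E.
  by rewrite mul0r derive0.
rewrite /derive; set F := (X in lim (X @ _)); set G := (X in _ = lim (X @ _)).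
suff -> : F = G by [].
by apply/funext => h; rewrite /F /G /= !mxE eqxx andbT.
Qed.

Lemma prodf_differentiable f x : smooth_factors f -> differentiable (prodf f) x.
Proof.
move=> sf; rewrite (_ : prodf f = (fun y => f 0 (y 0 0) * f 1 (y 1 0) * f 2 (y 2 0))).
  have d i := @factor_differentiable (f i) i x (sf i).
  exact: (differentiableM (differentiableM (d 0) (d 1)) (d 2)).
by apply/funext => y; rewrite prodfE.
Qed.

Lemma partial_prodf j f : smooth_factors f -> partial j (prodf f) = prodf (prodf_d j f).
Proof.
move=> sf; apply/funext => x; rewrite /partial.
rewrite (_ : prodf f = (fun y => f 0 (y 0 0) * f 1 (y 1 0) * f 2 (y 2 0))); last first.
  by apply/funext => y; rewrite prodfE.
have d i := @factor_is_derive (f i) i j x (sf i).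
have [_ ->] := is_deriveM (is_deriveM (d 0) (d 1)) (d 2).
rewrite prodfE /prodf_d /GRing.scale /=.
rewrite [X in X * (_ * _) + _](_ : _ = f 0 (x 0 0) * f 1 (x 1 0))//.
by case: j {d} => [[|[|[|//]]] hj] /=; rewrite ?mul1r ?mul0r ?mulr0 ?addr0 ?add0r; ring.
Qed.

Lemma prodf_smooth f : smooth_factors f -> smooth (prodf f).
Proof.
move=> sf s y.
suff [g sg ->] : exists2 g, smooth_factors g & foldr (@partial R) (prodf f) s = prodf g.
  exact: prodf_differentiable.
elim: s => [|j s [g sg IH]]; first by exists f.
exists (prodf_d j g); first exact: smooth_factors_d.
by rewrite /= IH partial_prodf.
Qed.

(** For products, commutation of second derivatives can be read off the factors; this is the only
    instance that Korn's inequality requires. *)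
Lemma partial_prodfC i j f : smooth_factors f ->
  partial i (partial j (prodf f)) = partial j (partial i (prodf f)).
Proof.
move=> sf; rewrite !partial_prodf//; try exact: smooth_factors_d.
apply/funext => x; rewrite /prodf; apply: eq_bigr => k _; congr (_ _).
by rewrite /prodf_d; case: (k == i); case: (k == j).
Qed.

Definition factors_supp r f := forall i x, r <= `|x| -> f i x = 0.

Definition test_factors f := smooth_factors f /\ exists r, factors_supp r f.

Lemma smooth1_bounded (g : R -> R) r : smooth1 g -> (forall x, r <= `|x| -> g x = 0) ->
  exists M, forall x, `|g x| <= M.
Proof.
move=> sg g0.
have cg := smooth1_continuous sg.
have : compact (g @` `[- r, r]%classic).
  by apply: continuous_compact; [exact: continuous_subspaceT|exact: segment_compact].
move=> /compact_bounded [M [_ hM]]; exists (`|M| + 1) => x.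
have [xr|xr] := leP r `|x|; first by rewrite g0// normr0 addr_ge0.
apply: (hM (`|M| + 1)); first by rewrite ltr_pwDr// ler_norm.
by exists x => //=; rewrite in_itv/= -ler_norml ltW.
Qed.

Lemma test_factors_test f : test_factors f -> test_function (prodf f).
Proof.
move=> [sf [r sr]].
have [M hM] : exists M, forall i x, `|f i x| <= M.
  have h i := smooth1_bounded (sf i) (sr i).
  exists (\big[Order.max/0]_i projT1 (cid (h i))) => i x.
  apply: (le_trans (projT2 (cid (h i)) x)).
  exact: (le_bigmax _ (fun i => projT1 (cid (h i))) i).
have cf := smooth_continuous (prodf_smooth sf).
apply: (@cbounded_test _ _ (M ^+ 3) r); first exact: prodf_smooth.
split; first exact: measurable_continuous.
move=> x; have [xr|xr] := pselect (cube r x).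
  rewrite indicE mem_set// mulr1 prodfE !normrM !exprS expr0 mulr1 mulrA.
  by rewrite ler_pM// ?mulr_ge0// ler_pM.
rewrite indicE memNset// mulr0 normr_le0; apply/eqP.
have [i hi] : exists i, r <= `|x i 0|.
  by apply: contrapT => /forallNP h; apply: xr => i; rewrite ltNge; apply/negP/h.
by rewrite /prodf (bigD1 i)//= sr// mul0r.
Qed.

Lemma test_factors_d j f : test_factors f -> test_factors (prodf_d j f).
Proof.
move=> [sf [r sr]]; split; first exact: smooth_factors_d.
(* The margin makes [x] an interior point of the region where the factor vanishes, so that its
   derivative vanishes at [x] too. *)
exists (r + 1) => i x xr; rewrite /prodf_d; case: eqP => // _; last first.
  by apply: sr; apply: le_trans xr; rewrite lerDl.
apply: (@derive1_eq0 _ _ 0 _ [set y | r < `|y|]).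
- rewrite (_ : [set _ | _] = (@Num.norm _ R^o) @^-1` [set y | r < y]).
    apply: open_comp; last exact: open_gt.
    by move=> y _; exact: norm_continuous.
  by [].
- by rewrite /=; apply: lt_le_trans xr; rewrite ltrDl.
- by move=> y /= yr; apply: sr; exact: ltW.
Qed.

Definition aff_factors (s : bool) (v : E) f : 'I_3 -> R -> R :=
  fun i x => f i ((-1) ^+ s * x + v i 0).

Lemma test_factors_aff s v f : test_factors f -> test_factors (aff_factors s v f).
Proof.
move=> [sf [r sr]]; split; first by move=> i; exact: smooth1_affine.
exists (r + `|v|) => i x xr; apply: sr.
have vi : `|v i 0| <= `|v|.
  have -> : `|v| = mx_norm v by [].
  by rewrite mx_normrE; apply: (le_bigmax _ (fun ij => `|v ij.1 ij.2|) (i, 0)).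
have : `|(-1) ^+ s * x| <= `|(-1) ^+ s * x + v i 0| + `|v i 0|.
  by rewrite -{1}(addrK (v i 0) ((-1) ^+ s * x)) ler_normB.
rewrite normrMsign => h; lra.
Qed.

Lemma prodf_aff s v f x : prodf (aff_factors s v f) x = prodf f (aff3 s v x).
Proof. by rewrite /prodf; apply: eq_bigr => i _; rewrite /aff_factors /aff3 !mxE. Qed.

Lemma partial_prodf_aff s v f j x : smooth_factors f ->
  partial j (prodf (aff_factors s v f)) x = (-1) ^+ s * partial j (prodf f) (aff3 s v x).
Proof.
move=> sf; rewrite !partial_prodf//; last by move=> i; exact: smooth1_affine.
rewrite /prodf (bigD1 j)//= [in RHS](bigD1 j)//= mulrA; congr (_ * _).
  by rewrite /prodf_d eqxx /aff_factors derive1_affine// /aff3 !mxE.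
by apply: eq_bigr => i /negbTE ij; rewrite /prodf_d ij /aff_factors /aff3 !mxE.
Qed.

End product_functions.

(** * The fundamental lemma and mollifiers *)

Lemma integral_prodM d1 d2 (T1 : measurableType d1) (T2 : measurableType d2)
    (R : realType) (m1 : {sigma_finite_measure set T1 -> \bar R})
    (m2 : {sigma_finite_measure set T2 -> \bar R}) (f : T1 -> R) (g : T2 -> R) :
  measurable_fun setT f -> measurable_fun setT g ->
  (forall x, 0 <= f x) -> (forall x, 0 <= g x) ->
  (\int[m1 \x m2]_p ((f p.1)%:E * (g p.2)%:E) =
   (\int[m1]_x (f x)%:E) * (\int[m2]_x (g x)%:E))%E.
Proof.
move=> mf mg f0 g0.
have mF : measurable_fun setT (EFin \o f) by exact/measurable_EFinP.
have mG : measurable_fun setT (EFin \o g) by exact/measurable_EFinP.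
rewrite (@fubini_tonelli1 _ _ _ _ _ m1 m2 (fun p => (f p.1)%:E * (g p.2)%:E)%E).
- rewrite /fubini_F /=.
  transitivity (\int[m1]_x ((f x)%:E * \int[m2]_y (g y)%:E))%E.
    apply: eq_integral => x _; rewrite ge0_integralZl//; last by rewrite lee_fin.
    by move=> y _; rewrite lee_fin.
  rewrite ge0_integralZr//; first by move=> x _; rewrite lee_fin.
  by apply: integral_ge0 => y _; rewrite lee_fin.
- apply: emeasurable_funM; first exact: (measurableT_comp mF measurable_fst).
  exact: (measurableT_comp mG measurable_snd).
- by move=> p; rewrite -EFinM lee_fin mulr_ge0.
Qed.

Section fundamental_lemma.
Variable R : realType.
Local Notation E := 'cV[R]_3.
Local Notation mu := (@lebesgue3 R).
Local Notation leb := (@lebesgue_measure R).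

Definition box (a b : 'I_3 -> R) : set E := [set x | forall i, a i < x i 0 < b i].

(** An intersection-stable generator of the sigma-algebra, for the Dynkin induction in the
    fundamental lemma. *)
Definition boxes : set (set E) := [set box ab.1 ab.2 | ab in [set: ('I_3 -> R) * ('I_3 -> R)]].

Lemma boxesI : setI_closed boxes.
Proof.
move=> _ _ [[a b] _ <-] [[c d] _ <-] /=.
exists ((fun i => Num.max (a i) (c i)), (fun i => Num.min (b i) (d i))) => //=.
apply/seteqP; split => x /=.
  by move=> h; split=> i; have := h i; rewrite gt_max lt_min => /andP[/andP[? ?] /andP[? ?]]; apply/andP.
by move=> [h1 h2] i; rewrite gt_max lt_min; move: (h1 i) (h2 i) => /andP[-> ->] /andP[-> ->].
Qed.

Lemma measurable_boxes : @measurable _ E = <<s boxes >>.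
Proof.
apply/seteqP; split; last first.
  apply: smallest_sub; first exact: sigma_algebra_measurable.
  by move=> _ [[a b] _ <-]; exact: measurable_box.
rewrite {1}/measurable /=; apply: smallest_sub; first exact: smallest_sigma_algebra.
rewrite -bigcup_mkord_ord; apply: bigcup_sub => k _.
move=> _ [B mB <-]; rewrite setTI; set i : 'I_3 := inord k.
pose T := g_sigma_algebraType boxes.
suff mc : measurable_fun [set: T] ((fun x : E => x i 0) : T -> R).
  by have := mc measurableT B mB; rewrite setTI.
apply: (measurability _ (RGenOpens.measurableE R)) => //.
move=> _ [_ [a [b ->] <-]]; rewrite setTI.
pose A n := fun k : 'I_3 => if k == i then a else - n%:R : R.
pose B' n := fun k : 'I_3 => if k == i then b else n%:R : R.
rewrite (_ : _ @^-1` _ = \bigcup_n box (A n) (B' n)); last first.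
  apply/seteqP; split => [x /= /[!in_itv]/= /andP[ax xb]|x [n _ /= h]].
    exists (Num.truncn `|x|).+1 => // l; rewrite /A /B'; case: eqP => [->|_]; first by rewrite ax xb.
    by rewrite -ltr_norml; have := @cube_norm R x _ (truncnS_gt `|x|); exact.
  by have := h i; rewrite /A /B' eqxx in_itv.
apply: bigcupT_measurable => n; apply: sub_sigma_algebra.
by exists (A n, B' n).
Qed.

(** Two ramps of width 1/(n+1), both placed inside the interval, so that the product stays below the
    indicator of the open box and tends to it pointwise. *)
Definition box_factors n (a b : 'I_3 -> R) : 'I_3 -> R -> R :=
  fun i x => step (n.+1%:R * x + - (n.+1%:R * a i)) *
             step (- n.+1%:R * x + n.+1%:R * b i).

Lemma box_factors_ge0 n a b i x : 0 <= box_factors n a b i x.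
Proof. by rewrite mulr_ge0// step_ge0. Qed.

Lemma box_factors_le1 n a b i x : box_factors n a b i x <= 1.
Proof. by rewrite mulr_ile1 ?step_ge0 ?step_le1. Qed.

Lemma box_factors_out n a b i x : ~~ (a i < x < b i) -> box_factors n a b i x = 0.
Proof.
rewrite negb_and -!leNgt => /orP[xa|bx]; rewrite /box_factors.
  by rewrite step_le0 ?mul0r// -mulrBr mulr_ge0_le0// subr_le0.
rewrite [X in _ * X]step_le0 ?mulr0//.
by rewrite mulNr addrC -mulrBr mulr_ge0_le0// subr_le0.
Qed.

Lemma box_factors_test n a b : test_factors (box_factors n a b).
Proof.
split.
  by move=> i; apply: smooth1M; apply: smooth1_affine; exact: smooth1_step.
exists (\sum_i (`|a i| + `|b i|)) => i x xr; apply: box_factors_out.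
have : `|a i| + `|b i| <= `|x|.
  by apply: le_trans xr; rewrite (bigD1 i)//= lerDl sumr_ge0// => k _; rewrite addr_ge0.
move=> h; apply/negP => /andP[ax xb]; move: h; apply/negP; rewrite -ltNge.
have [a1 a2] : a i <= `|a i| /\ - a i <= `|a i| by rewrite ler_norm -normrN ler_norm.
have [b1 b2] : b i <= `|b i| /\ - b i <= `|b i| by rewrite ler_norm -normrN ler_norm.
have := normr_ge0 (a i); have := normr_ge0 (b i).
by rewrite ltr_norml; move=> ? ?; apply/andP; split; lra.
Qed.

Lemma box_factors_cvg a b x :
  prodf (box_factors n a b) x @[n --> \oo] --> (\1_(box a b) x : R).
Proof.
have [xb|xb] := pselect (box a b x); last first.
  rewrite indicE memNset//.
  have [i hi] : exists i, ~~ (a i < x i 0 < b i).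
    by apply: contrapT => /forallNP h; apply: xb => i; have /negP := h i; rewrite negbK.
  rewrite (_ : (fun n => _) = cst 0); first exact: cvg_cst.
  by apply/funext => n; rewrite /prodf (bigD1 i)//= box_factors_out// mul0r.
rewrite indicE mem_set//; apply: cvg_near_cst.
have hd i : exists N, forall n, (N <= n)%N -> box_factors n a b i (x i 0) = 1.
  have /andP[ax xb'] := xb i.
  (* From this index on, both ramps are shorter than the distance from the coordinate of [x] to the
     nearer end of the interval. *)
  exists (Num.truncn (x i ord0 - a i)^-1 + Num.truncn (b i - x i ord0)^-1)%N => n hn.
  have H (u : R) : 0 < u -> (Num.truncn u^-1 <= n)%N -> 1 <= n.+1%:R * u.
    move=> u0 un; rewrite -ler_pdivrMr// mul1r ltW//.
    by apply: (lt_le_trans (truncnS_gt _)); rewrite ler_nat.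
  rewrite /box_factors !step_ge1 ?mul1r//.
    rewrite mulNr addrC -mulrBr H ?subr_gt0//.
    by apply: leq_trans hn; rewrite leq_addl.
  rewrite -mulrBr H ?subr_gt0//.
  by apply: leq_trans hn; rewrite leq_addr.
exists (\sum_i projT1 (cid (hd i)))%N => // n /= hn.
rewrite /prodf big1// => i _; apply: (projT2 (cid (hd i))).
by apply: leq_trans hn; rewrite (bigD1 i)//= leq_addr.
Qed.

Lemma box_factors_le a b n x : `|prodf (box_factors n a b) x| <= \1_(box a b) x.
Proof.
have [xb|xb] := pselect (box a b x).
  rewrite indicE mem_set// ger0_norm ?prodr_ge0// => [|i _]; last exact: box_factors_ge0.
  by apply: prodr_ile1 => i _; rewrite box_factors_ge0 box_factors_le1.
rewrite indicE memNset//.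
have [i hi] : exists i, ~~ (a i < x i 0 < b i).
  by apply: contrapT => /forallNP h; apply: xb => i; have /negP := h i; rewrite negbK.
by rewrite /prodf (bigD1 i)//= box_factors_out// mul0r normr0.
Qed.

Lemma box_cube a b : exists r, box a b `<=` cube r.
Proof.
exists (\sum_i (`|a i| + `|b i|)) => x h i.
have : `|a i| + `|b i| <= \sum_i (`|a i| + `|b i|).
  by rewrite [leRHS](bigD1 i)//= lerDl sumr_ge0// => k _; rewrite addr_ge0.
move=> {}; apply: lt_le_trans; have /andP[ax xb] := h i.
have [a1 a2] : a i <= `|a i| /\ - a i <= `|a i| by rewrite ler_norm -normrN ler_norm.
have [b1 b2] : b i <= `|b i| /\ - b i <= `|b i| by rewrite ler_norm -normrN ler_norm.
have := normr_ge0 (a i); have := normr_ge0 (b i).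
by rewrite ltr_norml; move=> ? ?; apply/andP; split; lra.
Qed.

Lemma integral_box0 (f : E -> R) a b : measurable_fun setT f ->
  (forall r, mu.-integrable (cube r) (EFin \o f)) ->
  (forall g, test_factors g -> \int[mu]_x (f x * prodf g x) = 0) ->
  (\int[mu]_(x in box a b) (f x)%:E = 0)%E.
Proof.
move=> mf lf f0; have mb : measurable (box a b) by exact: measurable_box.
have [r br] := box_cube a b.
have ib : mu.-integrable (box a b) (EFin \o f).
  by apply: integrableS (lf r) => //; exact: measurable_cube.
have ib1 : mu.-integrable setT (EFin \o (f \_ (box a b))).
  by have /(integrable_mkcond _ mb) := ib; rewrite restrict_EFin.
have ibn : mu.-integrable setT (EFin \o (fun x => `|(f \_ (box a b)) x|)).
  by have /integrable_abse := ib1; apply: eq_integrable.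
have mt n : measurable_fun setT (prodf (box_factors n a b)).
  apply: measurable_continuous; apply: smooth_continuous; apply: prodf_smooth.
  by case: (box_factors_test n a b).
have cvx x : (f x * prodf (box_factors n a b) x) @[n --> \oo] --> (f \_ (box a b)) x.
  have -> : (f \_ (box a b)) x = f x * \1_(box a b) x.
    by rewrite /restrict indicE; case: (_ \in _); rewrite ?mulr1 ?mulr0.
  by apply: cvgM; [exact: cvg_cst|exact: box_factors_cvg].
have bd n x : `|f x * prodf (box_factors n a b) x| <= `|(f \_ (box a b)) x|.
  have -> : (f \_ (box a b)) x = f x * \1_(box a b) x.
    by rewrite /restrict indicE; case: (_ \in _); rewrite ?mulr1 ?mulr0.
  rewrite !normrM ler_wpM2l// (ger0_norm (indic_ge0 _ _)).
  exact: box_factors_le.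
have mfb : measurable_fun setT (f \_ (box a b)).
  by apply/measurable_EFinP; exact: (measurable_int _ ib1).
have [ifb cv] := Rintegral_dominated measurableT
  (fun n => measurable_funM mf (mt n)) mfb (aeW _ (fun x _ => cvx x)) ibn (fun n x _ => bd n x).
suff : \int[mu]_(x in box a b) f x = 0.
  rewrite /Rintegral => h; rewrite -[LHS]fineK ?h//.
  exact: integrable_fin_num.
rewrite Rintegral_mkcond; apply: (cvg_unique _ cv); first exact: Rhausdorff.
rewrite (_ : (fun n => _) = cst 0); first exact: cvg_cst.
by apply/funext => n; rewrite f0//; exact: box_factors_test.
Qed.

(** Smooth cutoffs of boxes give zero integral over every box. Restricted to a cube, [f] is
    integrable, so the measurable sets over which its integral vanishes form a Dynkin system
    containing the boxes, hence are all of them. *)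
Lemma fundamental_lemma (f : E -> R) : measurable_fun setT f ->
  (forall r, mu.-integrable (cube r) (EFin \o f)) ->
  (forall g, test_factors g -> \int[mu]_x (f x * prodf g x) = 0) ->
  {ae mu, forall x, f x = 0}.
Proof.
move=> mf lf f0.
suff H n : {ae mu, forall x, cube n%:R x -> f x = 0}.
  have : {ae mu, forall x, forall n, cube n%:R x -> f x = 0} by apply/ae_foralln.
  apply: filterS => x h.
  by have : [set: E] x by []; rewrite -bigcup_cube => -[n _]; exact: h.
pose h := f \_ (cube n%:R).
have mc := @measurable_cube R n%:R.
have ih : mu.-integrable setT (EFin \o h).
  by have /(integrable_mkcond _ mc) := lf n%:R; rewrite restrict_EFin.
have mh : measurable_fun setT (EFin \o h) by exact: (measurable_int _ ih).
have cubeE' : cube n%:R = box (fun=> - n%:R) (fun=> n%:R) by rewrite cubeE.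
have hE A : measurable A -> (\int[mu]_(x in A) (h x)%:E = \int[mu]_(x in A `&` cube n%:R) (f x)%:E)%E.
  by move=> mA; rewrite integral_mkcondr; apply: eq_integral => x _; rewrite restrict_EFin.
have hT : (\int[mu]_x (h x)%:E = 0)%E.
  by rewrite hE// setTI cubeE'; exact: integral_box0.
have P S : measurable S -> (\int[mu]_(x in S) (h x)%:E = 0)%E.
  rewrite measurable_boxes.
  apply: (@dynkin_induction _ E boxes (fun S => \int[mu]_(x in S) (h x)%:E = 0)%E measurable_boxes boxesI).
  - exact: hT.
  - move=> _ [[a b] _ <-]; rewrite hE; last exact: measurable_box.
    have : boxes (box a b `&` cube n%:R).
      apply: boxesI; first by exists (a, b).
      by rewrite cubeE'; exists ((fun=> - n%:R), (fun=> n%:R)).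
    by move=> [[c d] _ <-]; exact: integral_box0.
  - move=> S' mS S0; have := hT; rewrite -(setvU S') integral_setU//.
    + by rewrite S0 adde0.
    + exact: measurableC.
    + by rewrite setvU.
    + by rewrite disj_set2E setICl.
  - move=> F mF tF F0; rewrite integral_bigcup//; last first.
      by apply: (integrableS measurableT) ih => //; exact: bigcupT_measurable.
    by rewrite eseries0// => k _ _; exact: F0.
have : ae_eq mu setT (EFin \o h) (cst 0%E).
  apply: integral_ae_eq => // A _ mA; rewrite P// integral0//.
apply: filterS => x /(_ Logic.I) /= [hx] xc.
by move: hx; rewrite /h /restrict mem_set.
Qed.

Lemma integral_prodf (g : 'I_3 -> R -> R) : (forall i, measurable_fun setT (g i)) ->
  (forall i x, 0 <= g i x) ->
  (\int[mu]_x (prodf g x)%:E = (\int[leb]_x (g 0 x)%:E) * (\int[leb]_x (g 1 x)%:E) *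
    (\int[leb]_x (g 2 x)%:E))%E.
Proof.
move=> mg g0.
have mp : measurable_fun setT (EFin \o prodf g).
  apply/measurable_EFinP; apply: measurable_prod => i _.
  by apply: (measurableT_comp (mg i)); exact: measurable_coord.
have p0 x : 0 <= prodf g x by apply: prodr_ge0.
rewrite /lebesgue3 (@ge0_integral_pushforward _ _ _ _ _ _ (@measurable_col3 R))//; last first.
  by move=> x _; rewrite lee_fin.
rewrite preimage_setT.
have E1 p : (EFin \o prodf g \o @col3 R) p = ((g 0 p.1.1 * g 1 p.1.2)%:E * (g 2 p.2)%:E)%E.
  by rewrite /= prodfE !mxE /=.
under eq_integral do rewrite E1.
transitivity ((\int[@lebesgue2 R]_p (g 0 p.1 * g 1 p.2)%:E) * (\int[leb]_x (g 2 x)%:E))%E.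
  apply: (@integral_prodM _ _ _ _ _ (@lebesgue2 R) leb (fun p => g 0 p.1 * g 1 p.2) (g 2)) => //.
  - apply: measurable_funM.
      exact: (measurableT_comp (mg 0) measurable_fst).
    exact: (measurableT_comp (mg 1) measurable_snd).
  - exact: (mg 2).
  - by move=> p; exact: mulr_ge0.
congr (_ * _)%E.
transitivity (\int[@lebesgue2 R]_p ((g 0 p.1)%:E * (g 1 p.2)%:E))%E.
  by apply: eq_integral => p _; rewrite EFinM.
apply: (@integral_prodM _ _ _ _ _ leb leb (g 0) (g 1)) => //; exact: mg.
Qed.

End fundamental_lemma.

(** * Mollifiers, and the functions whose derivative is a difference of two mollifiers *)

Section mollifier.
Variable R : realType.
Local Notation E := 'cV[R]_3.
Local Notation mu := (@lebesgue3 R).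
Local Notation leb := (@lebesgue_measure R).

Definition stepn n (x : R) : R := step (n.+1%:R * x + 0).

Lemma smooth1_stepn n : smooth1 (stepn n).
Proof. by apply: smooth1_affine; exact: smooth1_step. Qed.

(** Defining the bump as the derivative of a step gives it mass 1 by the fundamental theorem of
    calculus, and gives differences of translated bumps an explicit primitive, used in
    [tent_factors]. *)
Definition bumpn n : R -> R := derive1 (stepn n).

Lemma bumpnE n x : bumpn n x = n.+1%:R * derive1 (@step R) (n.+1%:R * x).
Proof. by rewrite /bumpn /stepn derive1_affine ?addr0//; exact: smooth1_step. Qed.

Lemma bumpn_ge0 n x : 0 <= bumpn n x.
Proof. by rewrite bumpnE mulr_ge0// derive1_step_ge0. Qed.

Lemma bumpn_out n x : x < 0 \/ n.+1%:R^-1 < x -> bumpn n x = 0.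
Proof.
move=> h; rewrite bumpnE derive1_step_out ?mulr0//; case: h => h.
  by left; rewrite pmulr_rlt0.
by right; rewrite -ltr_pdivrMl// mulr1.
Qed.

Lemma smooth1_bumpn n : smooth1 (bumpn n).
Proof. exact/smooth1_derive1/smooth1_stepn. Qed.

Lemma stepn_le0 n x : x <= 0 -> stepn n x = 0.
Proof. by move=> x0; rewrite /stepn addr0 step_le0// mulr_ge0_le0. Qed.

Lemma stepn_ge1 n x : 1 <= x -> stepn n x = 1.
Proof.
move=> x1; rewrite /stepn addr0 step_ge1//.
by apply: (le_trans x1); rewrite ler_peMl ?ler1n// (le_trans _ x1).
Qed.

Lemma stepn_homo n : {homo stepn n : x y / x <= y}.
Proof. by move=> x y xy; rewrite /stepn !addr0; apply: step_homo; rewrite ler_wpM2l. Qed.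

Lemma integral_bumpn n : (\int[leb]_x (bumpn n x)%:E = 1)%E.
Proof.
have cb : continuous (bumpn n) by apply: smooth1_continuous; exact: smooth1_bumpn.
have E1 : bumpn n = bumpn n \_ `[0, 1].
  apply/funext => x; rewrite /restrict; case: ifPn => // /negP.
  rewrite inE /= in_itv /= => /negP; rewrite negb_and -!ltNge => /orP h.
  rewrite bumpn_out//; case: h => h; [by left|right].
  by apply: le_lt_trans h; rewrite invf_le1// ler1n.
transitivity (\int[leb]_(x in `[0%R, 1%R]) (bumpn n x)%:E)%E.
  rewrite [RHS]integral_mkcond; apply: eq_integral => x _.
  by rewrite {1}E1 !patchE; case: ifP.
transitivity ((stepn n 1)%:E - (stepn n 0)%:E)%E; last first.
  by rewrite stepn_ge1// stepn_le0// sube0.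
have cs : continuous (stepn n) by apply: smooth1_continuous; exact: smooth1_stepn.
apply: continuous_FTC2 => //; first exact: continuous_subspaceT.
split.
- by move=> x _; apply: smooth1_derivable; exact: smooth1_stepn.
- by apply: cvg_at_right_filter; exact: cs.
- by apply: cvg_at_left_filter; exact: cs.
Qed.

Definition moll_factors n : 'I_3 -> R -> R := fun=> bumpn n.

Lemma moll_test n : test_factors (moll_factors n).
Proof.
split; first by move=> i; exact: smooth1_bumpn.
exists 2 => i x x2; apply: bumpn_out.
have n1 : (n.+1%:R : R)^-1 <= 1 by rewrite invf_le1// ler1n.
by have [x0|x0] := ltP x 0; [left|right; apply: (le_lt_trans n1); move: x2; rewrite ger0_norm//; lra].
Qed.

Lemma integral_moll n : (\int[mu]_x (prodf (moll_factors n) x)%:E = 1)%E.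
Proof.
rewrite integral_prodf.
- by rewrite /moll_factors integral_bumpn !mule1.
- by move=> i; apply: continuous_measurable_fun; apply: smooth1_continuous; exact: smooth1_bumpn.
- by move=> i x; exact: bumpn_ge0.
Qed.

Lemma moll_ge0 n x : 0 <= prodf (moll_factors n) x.
Proof. by apply: prodr_ge0 => i _; exact: bumpn_ge0. Qed.

Lemma moll_out n x : prodf (moll_factors n) x != 0 -> forall i, `|x i 0| <= n.+1%:R^-1.
Proof.
move=> h i; apply: contrapT => /negP; rewrite -ltNge => xi.
move/eqP : h; apply; rewrite /prodf (bigD1 i)//= /moll_factors bumpn_out ?mul0r//.
have [x0|x0] := ltP (x i 0) 0; [by left|right].
by move: xi; rewrite ger0_norm.
Qed.

(** In direction [j], a primitive of the bump minus the bump translated by [t]; in the other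
    directions, the bump itself. Its derivative along [j] is the mollifier minus its translate,
    which turns a finite translation into a weak derivative. *)
Definition tent_factors n j (t : R) : 'I_3 -> R -> R :=
  fun i => if i == j then (fun x => stepn n x - stepn n (x - t)) else bumpn n.

Lemma tent_ge0 n j t i x : 0 <= t -> 0 <= tent_factors n j t i x.
Proof.
move=> t0; rewrite /tent_factors; case: eqP => _; last exact: bumpn_ge0.
by rewrite subr_ge0 stepn_homo// lerBlDr lerDl.
Qed.

Lemma smooth_tent n j t : smooth_factors (tent_factors n j t).
Proof.
move=> i; rewrite /tent_factors; case: eqP => _; last exact: smooth1_bumpn.
apply: (smooth1D (@smooth1_stepn n)).
have := smooth1Z (-1) (smooth1_affine 1 (- t) (@smooth1_stepn n)).
by congr smooth1; apply/funext => x; rewrite mulN1r mul1r.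
Qed.

Lemma tent_test n j t : 0 <= t -> test_factors (tent_factors n j t).
Proof.
move=> t0; split; first exact: smooth_tent.
exists (t + 2) => i x xt; rewrite /tent_factors; case: eqP => _.
  have [x0|x0] := leP x 0; first by rewrite !stepn_le0 ?subrr//; lra.
  by move: xt; rewrite gtr0_norm// => xt; rewrite !stepn_ge1 ?subrr//; lra.
apply: bumpn_out.
have n1 : (n.+1%:R : R)^-1 <= 1 by rewrite invf_le1// ler1n.
by have [x0|x0] := ltP x 0; [left|right; apply: (le_lt_trans n1); move: xt; rewrite ger0_norm//; lra].
Qed.

Lemma partial_tent n j t z : 0 <= t ->
  partial j (prodf (tent_factors n j t)) z =
  prodf (moll_factors n) z - prodf (moll_factors n) (z - t *: delta_mx j 0).
Proof.
move=> t0; rewrite partial_prodf; last exact: smooth_tent.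
rewrite /prodf (bigD1 j)//= [in X in _ = X - _](bigD1 j)//= [in X in _ = _ - X](bigD1 j)//= /prodf_d eqxx /tent_factors eqxx.
have -> : derive1 (fun x => stepn n x - stepn n (x - t)) (z j 0) =
   bumpn n (z j 0) - bumpn n (z j 0 - t).
  have d1 := smooth1_is_derive (z j 0) (@smooth1_stepn n).
  have d2 := smooth1_is_derive (z j 0) (smooth1_affine 1 (- t) (@smooth1_stepn n)).
  have E2 : (fun x => stepn n (1 * x + - t)) = (fun x => stepn n (x - t)).
    by apply/funext => x; rewrite mul1r.
  rewrite derive1_affine ?E2 ?mul1r in d2; last exact: smooth1_stepn.
  by rewrite derive1E; have [_ ->] := is_deriveB d1 d2.
pose P := \prod_(i < 3 | i != j) bumpn n (z i 0).
rewrite [X in _ * X = _](_ : _ = P); last by apply: eq_bigr => i /negbTE ->.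
rewrite [X in _ = _ * X - _](_ : _ = P)//.
rewrite [X in _ = _ - _ * X](_ : _ = P).
  by rewrite mulrBl /moll_factors !mxE !eqxx /= mulr1.
by apply: eq_bigr => i /negbTE ij; rewrite /moll_factors !mxE ij /= mulr0 subr0.
Qed.

(** The factor in direction [j] has values in [0, 1] and is supported in [0, t + 1]; the other two
    factors have mass 1. *)
Lemma integral_tent n j t : 0 <= t ->
  (\int[mu]_x (prodf (tent_factors n j t) x)%:E <= (t + 1)%:E)%E.
Proof.
move=> t0.
have mt i : measurable_fun setT (tent_factors n j t i).
  by apply: continuous_measurable_fun; apply: smooth1_continuous; exact: smooth_tent.
have h : (\int[leb]_x (tent_factors n j t j x)%:E <= (t + 1)%:E)%E.
  have E1 : tent_factors n j t j = tent_factors n j t j \_ `[0, t + 1].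
    apply/funext => x; rewrite /restrict; case: ifPn => // /negP.
    rewrite inE /= in_itv /= => /negP; rewrite negb_and -!ltNge /tent_factors eqxx => /orP[x0|x0].
      by rewrite !stepn_le0 ?subrr//; lra.
    by rewrite !stepn_ge1 ?subrr//; lra.
  have -> : (\int[leb]_x (tent_factors n j t j x)%:E =
      \int[leb]_(x in `[0%R, (t + 1)%R]) (tent_factors n j t j x)%:E)%E.
    rewrite [RHS]integral_mkcond; apply: eq_integral => x _.
    by rewrite {1}E1 !patchE; case: ifP.
  apply: (@le_trans _ _ (\int[leb]_(x in `[0%R, (t + 1)%R]) (cst 1%E) x)%E).
    apply: ge0_le_integral => //.
    - by move=> x _; rewrite lee_fin tent_ge0.
    - by apply/measurable_EFinP; apply: (@measurable_funTS _ _ (measurableTypeR R)); exact: mt.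
    - move=> x _; rewrite lee_fin /tent_factors eqxx lerBlDr.
      by apply: (le_trans (step_le1 _)); rewrite lerDl step_ge0.
  have L : leb `[0, t + 1]%classic = (t + 1)%:E.
    by rewrite lebesgue_measure_itv/= lte_fin ltr_wpDl// sube0.
  rewrite integral_cst// mul1e; apply: (@le_trans _ _ (leb `[0, t + 1]%classic)) => //.
  by rewrite L.
rewrite integral_prodf//; last by move=> i x; exact: tent_ge0.
have o i : i != j -> (\int[leb]_x (tent_factors n j t i x)%:E = 1)%E.
  by move=> /negbTE ij; rewrite /tent_factors ij integral_bumpn.
pose a i := (\int[leb]_x (tent_factors n j t i x)%:E)%E.
have {o}oa i : i != j -> a i = 1%E by exact: o.
have {h}ha : (a j <= (t + 1)%:E)%E by exact: h.
change (a 0%R * a 1%R * a 2%R <= (t + 1)%:E)%E.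
case: (eqVneq 0 j) ha oa => [<-|n0] ha oa; first by rewrite (oa 1)// (oa 2)// !mule1.
rewrite (oa 0)// mul1e.
case: (eqVneq 1 j) ha oa => [<-|n1] ha oa; first by rewrite (oa 2)// mule1.
rewrite (oa 1)// mul1e.
case: (eqVneq 2 j) ha oa => [<-|n2] ha oa //.
by rewrite (oa 2)// lee_fin lerDr.
Qed.

End mollifier.

(** * Orthogonal projection *)

Section projection.
Variables (R : realType) (V : lmodType R) (H : set V) (B : V -> V -> R).
Hypothesis Hlin : forall (a : R) u v, H u -> H v -> H (a *: u + v).
Hypothesis Blin : forall (a : R) u v w, H u -> H v -> H w ->
  B (a *: u + v) w = a * B u w + B v w.
Hypothesis Bsym : forall u v, H u -> H v -> B u v = B v u.
Hypothesis Bpos : forall u, H u -> 0 <= B u u.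

Let HB a u v w : H u -> H v -> H w -> B w (a *: u + v) = a * B w u + B w v.
Proof. by move=> hu hv hw; rewrite Bsym ?Blin//; [rewrite (Bsym hu)// (Bsym hv)|exact: Hlin]. Qed.

Lemma form_expand (t : R) u v : H u -> H v ->
  B (t *: u + v) (t *: u + v) = t ^+ 2 * B u u + 2 * t * B u v + B v v.
Proof.
move=> hu hv; rewrite Blin//; last exact: Hlin.
rewrite !HB// (Bsym hv hu); ring.
Qed.

Lemma form_ineq (t : R) u v : H u -> H v -> 2 * t * B u v <= t ^+ 2 * B u u + B v v.
Proof.
move=> hu hv; have := Bpos (Hlin (- t) hu hv).
by rewrite form_expand// sqrrN; lra.
Qed.

Lemma Cauchy_Schwarz_form u v : H u -> H v -> (B u v) ^+ 2 <= B u u * B v v.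
Proof.
move=> hu hv; have [u0|u0] := eqVneq (B u u) 0.
  have h t : 2 * t * B u v <= B v v by have := form_ineq t hu hv; rewrite u0 mulr0 add0r.
  have [->|b0] := eqVneq (B u v) 0; first by rewrite u0 mul0r expr0n.
  (* The form is only semidefinite, so [B u u = 0] does not make [u] vanish; this value of t would
     give [B v v + 1 <= B v v] if [B u v] were nonzero. *)
  have := h ((B v v + 1) / (2 * B u v)).
  rewrite (_ : 2 * _ * _ = B v v + 1); last by field.
  by rewrite leNgt ltrDl ltr01.
have u1 : 0 < B u u by rewrite lt_neqAle eq_sym u0 Bpos.
have := form_ineq (B u v / B u u) hu hv.
rewrite (_ : 2 * _ * _ = 2 * (B u v ^+ 2 / B u u)); last by field.
rewrite (_ : _ ^+ 2 * _ = B u v ^+ 2 / B u u); last by field.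
by move=> h; rewrite -ler_pdivrMl// mulrC; lra.
Qed.

Variables (F : set V).
Hypothesis F0 : F 0.
Hypothesis FH : F `<=` H.
Hypothesis Flin : forall (a : R) u v, F u -> F v -> F (a *: u + v).
Hypothesis Fcomplete : forall u : nat -> V, (forall n, F (u n)) ->
  (forall e, 0 < e -> exists N, forall m n, (N <= m)%N -> (N <= n)%N ->
     B (u m - u n) (u m - u n) <= e) ->
  exists2 l, F l & forall e, 0 < e -> exists N, forall n, (N <= n)%N ->
     B (u n - l) (u n - l) <= e.

Let B0 w : H w -> B 0 w = 0.
Proof.
move=> Hw; have H0 := FH F0.
by have := Blin 1 H0 H0 Hw; rewrite scale1r addr0 mul1r => /eqP; rewrite -subr_eq subrr => /eqP.
Qed.

Let BZ (a : R) u w : H u -> H w -> B (a *: u) w = a * B u w.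
Proof.
by move=> Hu Hw; have H0 := FH F0; rewrite -[a *: u]addr0 Blin// B0// addr0.
Qed.

(** A minimizing sequence in [F] is Cauchy by the parallelogram identity. [B] is a semidefinite form
    on the subset [H] only, because the vectors are functions rather than classes, and completeness
    is asked of [F] alone, for the seminorm of [B]. *)
Theorem projection x : H x -> exists2 p, F p & forall f, F f -> B (x - p) f = 0.
Proof.
move=> Hx; pose q v := B v v.
have HB' u v : H u -> H v -> H (u - v).
  by move=> hu hv; rewrite addrC -scaleN1r; exact: Hlin.
pose D := [set q (x - f) | f in F].
have hD : has_inf D.
  split; first by exists (q (x - 0)), 0.
  by exists 0 => _ [f Ff <-]; apply/Bpos/HB' => //; exact: FH.
have lbD f : F f -> inf D <= q (x - f) by move=> Ff; apply: ge_inf; [case: hD|exists f].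
have hu n : exists f, F f /\ q (x - f) < inf D + n.+1%:R^-1.
  have n0 : 0 < n.+1%:R^-1 :> R by rewrite invr_gt0.
  by have [_ [f Ff <-] h] := inf_adherent n0 hD; exists f.
pose u n := projT1 (cid (hu n)).
have Fu n : F (u n) by rewrite /u; case: (cid (hu n)) => f [].
have Hu n : H (u n) by exact: FH.
have qu n : q (x - u n) <= inf D + n.+1%:R^-1.
  by rewrite /u; case: (cid (hu n)) => f [_ h] /=; exact: ltW.
(* Parallelogram identity for a = x - u m and b = x - u n: the midpoint of u m and u n lies in [F],
   so its distance to x is also bounded below by the infimum. *)
have para m n : q (u m - u n) <= 2 * (m.+1%:R^-1 + n.+1%:R^-1).
  pose a := x - u m; pose b := x - u n.
  have Ha : H a by exact: HB'.
  have Hb : H b by exact: HB'.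
  have e1 : u m - u n = (-1) *: a + b.
    by rewrite /a /b scaleN1r opprB addrA subrK.
  have e2 : x - ((1 / 2) *: u m + (1 / 2) *: u n) = (1 / 2) *: a + (1 / 2) *: b.
    rewrite /a /b !scalerBr addrACA -scalerDl -opprD.
    by rewrite (_ : 1 / 2 + 1 / 2 = 1) ?scale1r//; field.
  have FZ (c : R) f : F f -> F (c *: f) by move=> Ff; rewrite -[c *: f]addr0; exact: Flin.
  have := lbD _ (Flin (1 / 2) (Fu m) (FZ (1 / 2) _ (Fu n))).
  have HZ (c : R) f : H f -> H (c *: f).
    by move=> Hf; rewrite -[c *: f]addr0; apply: Hlin => //; exact: FH.
  rewrite e2 /q form_expand//; last exact: HZ.
  rewrite e1 form_expand// !BZ//; last exact: HZ.
  rewrite (Bsym Ha (HZ _ _ Hb)) BZ// (Bsym Hb (HZ _ _ Hb)) BZ// (Bsym Hb Ha).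
  move: (qu m) (qu n); rewrite /q -/a -/b.
  move: (m.+1%:R^-1) (n.+1%:R^-1) => c d.
  lra.
have [|p Fp hp] := Fcomplete Fu.
  move=> e e0; exists (Num.truncn (4 / e)) => m n hm hn.
  apply: (le_trans (para m n)).
  have h k : (Num.truncn (4 / e) <= k)%N -> k.+1%:R^-1 <= e / 4.
    move=> hk; rewrite -[e / 4]invrK invf_div lef_pV2 ?posrE ?divr_gt0//.
    by apply: ltW; apply: (lt_le_trans (truncnS_gt _)); rewrite ler_nat ltnS.
  by move: (h _ hm) (h _ hn); move: (m.+1%:R^-1) (n.+1%:R^-1) => c d; lra.
exists p => // f Ff.
have Hf := FH Ff; have Hp := FH Fp.
(* Split x - p as (x - u n) + (u n - p). Moving u n by t f cannot lower the distance below the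
   infimum, which bounds the first part up to e; [form_ineq] and the convergence of u n to p bound
   the second. *)
have key (t : R) : t * B (x - p) f <= t ^+ 2 * q f.
  apply/ler_addgt0Pr => e e0.
  have [N hN] := hp _ e0.
  pose n := maxn N (Num.truncn e^-1).
  have h1 : q (u n - p) <= e by apply: hN; rewrite leq_maxl.
  have h2 : n.+1%:R^-1 <= e.
    rewrite -[e]invrK lef_pV2 ?posrE ?invr_gt0//.
    by apply: ltW; apply: (lt_le_trans (truncnS_gt _)); rewrite ler_nat ltnS leq_maxr.
  have Hxu : H (x - u n) by exact: HB'.
  have Hup : H (u n - p) by exact: HB'.
  have h3 : inf D <= q ((- t) *: f + (x - u n)).
    have -> : (- t) *: f + (x - u n) = x - (t *: f + u n).
      by rewrite opprD scaleNr addrCA.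
    by apply: lbD; exact: Flin.
  rewrite /q form_expand// sqrrN in h3.
  have h4 := form_ineq t Hf Hup.
  have h5 : q (x - u n) <= inf D + e by apply: (le_trans (qu n)); rewrite lerD2l.
  have -> : B (x - p) f = B f (x - u n) + B f (u n - p).
    rewrite -[x - p](subrKA (u n)) -[X in X + _]scale1r Blin// mul1r.
    by rewrite (Bsym Hf Hxu) (Bsym Hf Hup).
  move: h1 h5 h3 h4; rewrite /q; lra.
set bb := B (x - p) f in key *.
have c0 : 0 <= q f by exact: Bpos.
(* The optimal t would be of order bb / q f; adding 1 admits [q f = 0], and the inequality still
   forces bb^2 <= 0. *)
have := key (bb / (q f + 1)).
have c1 : 0 < q f + 1 by rewrite ltr_wpDl.
have c1' : q f + 1 != 0 by rewrite gt_eqF.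
rewrite (_ : bb / (q f + 1) * bb = bb ^+ 2 * (q f + 1) / (q f + 1) ^+ 2); last by field.
rewrite (_ : (bb / (q f + 1)) ^+ 2 * q f = bb ^+ 2 * q f / (q f + 1) ^+ 2); last by field.
rewrite ler_pM2r ?invr_gt0 ?exprn_gt0// mulrDr mulr1 => h.
by apply/eqP; rewrite -sqrf_eq0 eq_le sqr_ge0 andbT; lra.
Qed.

End projection.

(** * Tiling by translates of the cell *)

Section tiling.
Variable R : realType.
Local Notation E := 'cV[R]_3.
Local Notation mu := (@lebesgue3 R).
Variable b : 3.-tuple E.
Hypothesis hb : free b.

Definition crd (i : 'I_3) (y : E) : R := coord b i y.

Lemma basis_b : basis_of fullv b.
Proof.
rewrite basisEfree hb subvf /= size_tuple dimvf.
by rewrite /dim /= muln1.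
Qed.

Lemma crdK y : y = \sum_i crd i y *: tnth b i.
Proof.
have /coord_span : y \in <<b>>%VS by rewrite (span_basis basis_b) memvf.
by move=> {1}->; apply: eq_bigr => i _; rewrite (tnth_nth 0).
Qed.

Lemma crd_sum (s : 'I_3 -> R) i : crd i (\sum_k s k *: tnth b k) = s i.
Proof.
rewrite /crd; under eq_bigr do rewrite (tnth_nth 0).
exact: (coord_sum_free s i hb).
Qed.

Lemma crdD i x y : crd i (x + y) = crd i x + crd i y.
Proof. by rewrite /crd linearD. Qed.

Lemma crdN i x : crd i (- x) = - crd i x.
Proof. by rewrite /crd linearN. Qed.

Lemma crd_matrix i y : crd i y = \sum_k crd i (delta_mx k 0) * y k 0.
Proof.
rewrite {1}[y]matrix_sum_delta /crd linear_sum; apply: eq_bigr => k _.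
by rewrite big_ord1 linearZ /= mulrC.
Qed.

Lemma measurable_crd i : measurable_fun [set: E] (crd i).
Proof.
rewrite (_ : crd i = fun y => \sum_k crd i (delta_mx k 0) * y k 0).
  apply: measurable_sum => k; apply: measurable_funM => //; exact: measurable_coord.
by apply/funext => y; exact: crd_matrix.
Qed.

Definition lvec (m : 'I_3 -> int) : E := \sum_i tnth b i *~ m i.

Lemma lvec_lattice m : lattice b (lvec m).
Proof. by exists m. Qed.

Lemma crd_lvec m i : crd i (lvec m) = (m i)%:~R.
Proof.
rewrite /lvec (eq_bigr (fun i => (m i)%:~R *: tnth b i)) ?crd_sum// => k _.
by rewrite scaler_int.
Qed.

(** Half-open, so that its lattice translates partition space; it differs from the closed cell by
    null faces. *)
Definition hcell : set E := [set y | forall i, 0 <= crd i y < 1].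

Lemma cellE : cell b = [set y | forall i, 0 <= crd i y <= 1].
Proof.
apply/seteqP; split => y /=; first by move=> [s hs ->] i; rewrite crd_sum.
by move=> h; exists (crd^~ y) => //; exact: crdK.
Qed.

Lemma measurable_crd_set (P : 'I_3 -> set R) : (forall i, measurable (P i)) ->
  measurable [set y : E | forall i, P i (crd i y)].
Proof.
move=> mP; rewrite (_ : [set _ | _] = \bigcap_(i in [set: 'I_3]) (crd i @^-1` P i)).
  apply: fin_bigcap_measurable => // i _.
  by rewrite -[X in measurable X]setTI; apply: measurable_crd.
by apply/seteqP; split => x /= h i //=; exact: h.
Qed.

Lemma measurable_hcell : measurable hcell.
Proof.
have := @measurable_crd_set (fun=> `[0, 1[%classic) (fun=> measurable_itv _).
by congr measurable; apply/seteqP; split => x h i; have := h i; rewrite /= in_itv.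
Qed.

Lemma measurable_cell : measurable (cell b).
Proof.
have := @measurable_crd_set (fun=> `[0, 1]%classic) (fun=> measurable_itv _).
by rewrite cellE; congr measurable; apply/seteqP; split => x h i; have := h i; rewrite /= in_itv.
Qed.

Lemma cell_bounded : exists r, cell b `<=` cube r.
Proof.
exists (\sum_i `|tnth b i| + 1) => y [s hs ->].
apply: cube_norm; rewrite (@le_lt_trans _ _ (\sum_i `|tnth b i|)) ?ltrDl//.
apply: (le_trans (ler_norm_sum _ _ _)); apply: ler_sum => i _.
rewrite normrZ ger0_norm; last by case/andP: (hs i).
by rewrite ler_piMl//; case/andP: (hs i).
Qed.

Lemma hcell_sub : hcell `<=` cell b.
Proof. by rewrite cellE => y h i; have /andP[-> /ltW ->] := h i. Qed.

Lemma cell_fin : (mu (cell b) < +oo)%E.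
Proof.
have [r hr] := cell_bounded.
apply: (@le_lt_trans _ _ (mu (cube r))); last exact: cube_fin.
apply: le_measure => //; rewrite inE; [exact: measurable_cell|exact: measurable_cube].
Qed.

(* The translate of the half-open cell by z plus or minus the k-th lattice vector,
   set0 when k encodes none. *)
Definition tile (s : bool) (z : E) (k : nat) : set E :=
  if @pickle_inv {ffun 'I_3 -> int} k is Some m
  then [set x | hcell (x - z - (-1) ^+ s *: lvec m)] else set0.

Lemma measurable_hcell_shift v : measurable [set x | hcell (x + v)].
Proof.
rewrite -[X in measurable X]setTI; apply: (measurable_shiftv v) => //.
exact: measurable_hcell.
Qed.

Lemma measurable_tile s z k : measurable (tile s z k).
Proof.
rewrite /tile; case: pickle_inv => // m.
rewrite (_ : [set _ | _] = [set x | hcell (x + (- z - (-1) ^+ s *: lvec m))]).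
  exact: measurable_hcell_shift.
by apply/seteqP; split => x /=; rewrite addrA.
Qed.

Lemma crd_sgn_lvec s m i : crd i ((-1) ^+ s *: lvec m) = (-1) ^+ s * (m i)%:~R.
Proof. by rewrite /crd linearZ /= -/(crd i (lvec m)) crd_lvec. Qed.

Lemma trivIset_tile s z : trivIset setT (tile s z).
Proof.
apply/trivIsetP => k l _ _ kl; apply/seteqP; split => // x [].
rewrite /tile; case ek : pickle_inv => [m|//]; case el : pickle_inv => [n|//] hm hn.
move/eqP : kl; apply.
suff mn : m = n.
  have := @pickle_invK {ffun 'I_3 -> int} k; have := @pickle_invK {ffun 'I_3 -> int} l.
  by rewrite ek el /= mn => -> ->.
apply/ffunP => i; move: (hn i) (hm i) => {hm hn}.
rewrite !crdD !crdN !crd_sgn_lvec.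
move=> /andP[h1 h2] /andP[h3 h4].
have [a1 a2] : (m i)%:~R < (n i + 1)%:~R :> R /\ (n i)%:~R < (m i + 1)%:~R :> R.
  by rewrite !intrD; case: s h1 h2 h3 h4; rewrite ?expr0 ?expr1; split; lra.
move: a1 a2; rewrite !ltr_int !ltzD1 => a1 a2.
by apply/eqP; rewrite eq_le a1 a2.
Qed.

Lemma bigcup_tile s z : \bigcup_k tile s z k = setT.
Proof.
apply/seteqP; split => // x _.
pose m : {ffun 'I_3 -> int} := [ffun i => (-1) ^+ s * Num.floor (crd i (x - z))].
exists (pickle m) => //; rewrite /tile pickleK_inv => i.
rewrite crdD crdN crd_sgn_lvec ffunE intrM rmorph_sign mulrA -signr_addb addbb mul1r.
have /andP[h1 h2] := floor_itv (crd i (x - z)).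
by rewrite subr_ge0 h1 ltrBlDl -intrD1 h2.
Qed.

Lemma ae_shift (P : set E) v : {ae mu, forall x, P x} -> {ae mu, forall x, P (x + v)}.
Proof.
move=> [N [mN N0 h]].
exists ((fun x => x + v) @^-1` N); split.
- by rewrite -[X in measurable X]setTI; exact: measurable_shiftv.
- rewrite -N0 -(lebesgue3_aff false v mN); congr (mu _).
  by apply/seteqP; split => x /=; rewrite aff3_0.
- by move=> x /= hx; apply: h.
Qed.

Local Open Scope ereal_scope.

(** Cut and paste: with D = z + hcell, cut D by the tiles hcell - m and cut hcell by the tiles D +
    m. Translation by the lattice vector m carries each piece of D onto the corresponding piece of
    hcell. The two opposite signs are the reason for the flag of [tile]. *)
Lemma hcell_shift (h : E -> \bar R) z : measurable_fun [set: E] h ->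
  (forall x, 0 <= h x) ->
  (forall a, lattice b a -> {ae mu, forall x, h (x + a)%R = h x}) ->
  \int[mu]_(y in hcell) h (y + z)%R = \int[mu]_(y in hcell) h y.
Proof.
move=> mh h0 ph.
have mhs v : measurable_fun [set: E] (fun x => h (x + v)%R).
  by apply: (measurableT_comp mh); exact: measurable_shiftv.
have mhc := measurable_hcell.
pose D := [set x | hcell (x - z)%R].
have mD : measurable D by exact: measurable_hcell_shift.
transitivity (\int[mu]_(x in D) h x).
  rewrite -(@integral_aff3 R false z D h) //; last exact: measurable_funTS.
  have -> : aff3 false z @^-1` D = hcell.
    by apply/seteqP; split => x; rewrite /D /= aff3_0 addrK.
  by apply: eq_integral => x _; rewrite aff3_0.
have split_int s (A : set E) w : measurable A ->
    \int[mu]_(x in A) h x = \sum_(k <oo) \int[mu]_(x in A `&` tile s w k) h x.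
  move=> mA; rewrite -[A in LHS]setIT -(bigcup_tile s w) setI_bigcupr.
  rewrite ge0_integral_bigcup//.
  - by move=> k; apply: measurableI => //; exact: measurable_tile.
  - exact: measurable_funTS.
  - exact/trivIset_setIl/trivIset_tile.
rewrite (split_int true _ 0%R mD) [RHS](split_int false _ z mhc).
apply: eq_eseriesr => k _; rewrite /tile; case: pickle_inv => [m|]; last by rewrite !setI0 !integral_set0.
rewrite expr0 scale1r expr1 scaleN1r.
set A := hcell `&` _; have mA : measurable A.
  apply: measurableI => //.
  rewrite (_ : [set _ | _] = [set x | hcell (x + (- z - lvec m))%R]).
    exact: measurable_hcell_shift.
  by apply/seteqP; split => x /=; rewrite addrA.
rewrite -(@integral_aff3 R false (lvec m) A h) //; last exact: measurable_funTS.
have -> : aff3 false (lvec m) @^-1` A = D `&` [set x | hcell (x - 0 - - lvec m)%R].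
  apply/seteqP; split => x; rewrite /A /D /= aff3_0 subr0 opprK.
    by rewrite (addrAC x) addrK => -[].
  by rewrite (addrAC x) addrK => -[].
under [RHS]eq_integral do rewrite aff3_0.
apply: ae_eq_integral.
- apply: measurableI => //; rewrite opprK; under eq_set do rewrite subr0.
  exact: measurable_hcell_shift.
- exact: measurable_funTS.
- exact: measurable_funTS.
- by apply: filterS (ph _ (lvec_lattice m)) => x -> .
Qed.

(** Otherwise countably many null tiles would cover a cube. *)
Lemma mu_hcell_gt0 : 0 < mu hcell.
Proof.
rewrite lt_neqAle measure_ge0 andbT eq_sym; apply/eqP => h0.
have : mu (cube 1) <= 0.
  apply: (@le_trans _ _ (mu setT)); first by apply: le_measure; rewrite ?inE//; exact: measurable_cube.
  rewrite -(bigcup_tile false 0%R) measure_bigcup//=; last 2 first.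
  - by move=> k _; exact: measurable_tile.
  - exact: trivIset_tile.
  rewrite eseries0// => k _ _; rewrite /tile; case: pickle_inv => [m|]; last exact: measure0.
  rewrite -h0 -(lebesgue3_aff false (- 0 - (-1) ^+ false *: lvec m) measurable_hcell).
  by congr (mu _); apply/seteqP; split => x; rewrite /= aff3_0 addrA.
rewrite cubeE lebesgue3_box lee_fin leNgt => /negP; apply.
by apply: prodr_gt0 => i _; rewrite lt_max; apply/orP; right; lra.
Qed.

(** The translates of the face by -g_i / (n+1) are pairwise disjoint, have equal measure and all lie
    in the cell, whose measure is finite; so that common measure is 0. *)
Lemma face_null i : mu [set y : E | cell b y /\ crd i y = 1%R] = 0.
Proof.
set F := [set y | _].
have mF : measurable F.
  apply: measurableI; first exact: measurable_cell.
  by rewrite -[X in measurable X]setTI; apply: (@measurable_crd i _ [set 1%R]).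
pose v n : E := (n.+1%:R^-1 *: tnth b i)%R.
have cv n k : crd k (v n) = (if k == i then n.+1%:R^-1 else 0)%R.
  rewrite /v /crd linearZ /=; have := @crd_sum (fun l => (l == i)%:R) k.
  rewrite (bigD1 i)//= eqxx scale1r big1 ?addr0 => [|l /negbTE ->]; last by rewrite scale0r.
  by rewrite /crd => ->; case: eqP; rewrite ?mulr1 ?mulr0.
pose S n := [set x | F (x + v n)%R].
have mS n : measurable (S n).
  by rewrite -[X in measurable X]setTI; apply: measurable_shiftv.
have SF n : mu (S n) = mu F.
  rewrite -(lebesgue3_aff false (v n) mF); congr (mu _).
  by apply/seteqP; split => x; rewrite /S /= aff3_0.
have tS : trivIset setT S.
  apply/trivIsetP => k l _ _ /eqP kl; apply/seteqP; split => // x [[_ +] [_ +]].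
  rewrite !crdD !cv eqxx => h1 h2; apply: kl.
  have : (k.+1%:R^-1 = l.+1%:R^-1 :> R)%R by apply: (addrI (crd i x)); rewrite h1 h2.
  by move=> /invr_inj /eqP; rewrite eqr_nat => /eqP [].
have SY n : S n `<=` cell b.
  move=> x; rewrite /S /F /= !cellE /= => -[hx h1] k.
  move: (hx k); rewrite crdD cv; case: eqP => [->|_]; last by rewrite addr0.
  move: h1; rewrite crdD cv eqxx => h1 _.
  have n0 : (0 <= n.+1%:R^-1 :> R)%R by rewrite invr_ge0.
  have n1 : (n.+1%:R^-1 <= 1 :> R)%R by rewrite invf_le1// ler1n.
  by move: h1 n0 n1; move: (n.+1%:R^-1)%R => c *; apply/andP; split; lra.
have bd : \sum_(n <oo) mu F <= mu (cell b).
  have <- : \sum_(n <oo) mu (S n) = \sum_(n <oo) mu F by apply: eq_eseriesr => n _; exact: SF.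
  have <- : mu (\bigcup_n S n) = \sum_(n <oo) mu (S n).
    by apply/esym/cvg_lim => //; apply: (@measure_semi_sigma_additive _ _ _ mu S) => //; exact: bigcupT_measurable.
  apply: le_measure; rewrite ?inE//.
  - exact: bigcupT_measurable.
  - exact: measurable_cell.
  - by move=> x [n _]; exact: SY.
have Ffin : mu F \is a fin_num.
  rewrite ge0_fin_numE//; apply: le_lt_trans cell_fin; apply: le_measure; rewrite ?inE//.
    exact: measurable_cell.
  by move=> x [].
apply: contrapT => /eqP F0.
have Fp : (0 < fine (mu F))%R by rewrite fine_gt0// lt0e F0 measure_ge0/= -ge0_fin_numE.
have cfin : mu (cell b) \is a fin_num by rewrite ge0_fin_numE// cell_fin.
pose n := (Num.truncn (fine (mu (cell b)) / fine (mu F))).+1.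
have : \sum_(0 <= k < n) mu F <= mu (cell b).
  by apply: le_trans bd; apply: nneseries_lim_ge.
rewrite -(fineK Ffin) -(fineK cfin) sumEFin lee_fin sumr_const_nat subn0 -mulr_natl leNgt => /negP; apply.
by rewrite -ltr_pdivrMr// truncnS_gt.
Qed.

Lemma cellD_null : mu (cell b `\` hcell) = 0.
Proof.
apply/eqP; rewrite eq_le measure_ge0 andbT.
pose F i := [set y : E | cell b y /\ crd i y = 1%R].
have mF i : measurable (F i).
  apply: measurableI; first exact: measurable_cell.
  by rewrite -[X in measurable X]setTI; apply: (@measurable_crd i _ [set 1%R]).
apply: (@le_trans _ _ (mu (F 0%R `|` F 1%R `|` F 2%R))).
  apply: le_measure; rewrite ?inE.
  - by apply: measurableD; [exact: measurable_cell|exact: measurable_hcell].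
  - by do 2 apply: measurableU => //.
  - move=> y [hy nh].
    have [i hi] : exists i, crd i y = 1%R.
      apply: contrapT => /forallNP h; apply: nh => i.
      move: (hy); rewrite cellE => /(_ i) /andP[-> h1] /=.
      by rewrite lt_neqAle h1 andbT; apply/eqP.
    have : F i y by [].
    case: i {hi} => [[|[|[|//]]] hi] h.
    + by left; left; move: h; congr (F _ y); exact: val_inj.
    + by left; right; move: h; congr (F _ y); exact: val_inj.
    + by right; move: h; congr (F _ y); exact: val_inj.
apply: (le_trans (measureU2 _ _ _)) => //; first exact: measurableU.
have F0 i : mu (F i) = 0 by exact: face_null.
have F2 : mu (F 0%R `|` F 1%R) <= 0.
  by apply: (le_trans (measureU2 mu _ _)) => //; rewrite [X in X + _]F0 [X in _ + X]F0 adde0.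
rewrite -[leRHS](adde0 0); apply: leeD => //.
by rewrite le_eqVlt; apply/orP; left; apply/eqP; exact: F0.
Qed.

Lemma integral_cell (f : E -> \bar R) : measurable_fun [set: E] f ->
  \int[mu]_(y in cell b) f y = \int[mu]_(y in hcell) f y.
Proof.
move=> mf; have mD : measurable (cell b `\` hcell).
  by apply: measurableD; [exact: measurable_cell|exact: measurable_hcell].
rewrite -(setDUK hcell_sub) integral_setU//.
- by rewrite [X in _ + X]null_set_integral ?adde0//; [exact: measurable_funTS|exact: cellD_null].
- exact: measurable_hcell.
- exact: measurable_funTS.
- by rewrite disj_set2E setDIK.
Qed.

Lemma mu_cell_gt0 : 0 < mu (cell b).
Proof.
apply: (lt_le_trans mu_hcell_gt0); apply: le_measure; rewrite ?inE.
- exact: measurable_hcell.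
- exact: measurable_cell.
- exact: hcell_sub.
Qed.

Lemma cell_vol_gt0 : (0 < cell_vol b)%R.
Proof. by rewrite fine_gt0// mu_cell_gt0 cell_fin. Qed.

Lemma ge0_integral_cell_shift (h : E -> \bar R) z : measurable_fun [set: E] h ->
  (forall x, 0 <= h x) ->
  (forall a, lattice b a -> {ae mu, forall x, h (x + a)%R = h x}) ->
  \int[mu]_(y in cell b) h (y + z)%R = \int[mu]_(y in cell b) h y.
Proof.
move=> mh h0 ph; rewrite !integral_cell//; first exact: hcell_shift.
by apply: (measurableT_comp mh); exact: measurable_shiftv.
Qed.

Lemma cell_int_shift (f : E -> R) z : measurable_fun [set: E] f -> @Defs.periodic R b R f ->
  cell_int b (fun y => f (y + z)%R) = cell_int b f.
Proof.
move=> mf pf; rewrite /cell_int /Rintegral; congr fine.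
rewrite integralE [RHS]integralE.
have mF : measurable_fun [set: E] (EFin \o f) by exact/measurable_EFinP.
rewrite -(@ge0_integral_cell_shift (EFin \o f)^\+ z)//; last 2 first.
- exact: measurable_funepos.
- by move=> a la; apply: filterS (pf a la) => x hx; rewrite !funeposE /= hx.
rewrite -(@ge0_integral_cell_shift (EFin \o f)^\- z)//; last 2 first.
- exact: measurable_funeneg.
- by move=> a la; apply: filterS (pf a la) => x hx; rewrite !funenegE /= hx.
by congr (_ - _); apply: eq_integral => x _; rewrite ?funeposE ?funenegE.
Qed.

(* K bounds the number of tiles needed to cover the cube. *)
Lemma cube_cell_bound r : exists K : nat, forall h : E -> \bar R,
  measurable_fun [set: E] h -> (forall x, 0 <= h x) ->
  (forall a, lattice b a -> {ae mu, forall x, h (x + a)%R = h x}) ->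
  \int[mu]_(y in cube r) h y <= K%:R%:E * \int[mu]_(y in cell b) h y.
Proof.
(* A bound for every lattice coordinate on the cube, so that only lattice indices in [-L, L) are
   met. *)
pose L := (Num.truncn (\sum_i \sum_k `|crd i (delta_mx k 0)| * `|r|)).+1.
have hL i y : cube r y -> (`|crd i y| < L%:R)%R.
  move=> yr; apply: le_lt_trans (truncnS_gt _).
  apply: (@le_trans _ _ (\sum_k `|crd i (delta_mx k 0)| * `|r|)%R); last first.
    rewrite [leRHS](bigD1 i)//= lerDl; apply: sumr_ge0 => l _; apply: sumr_ge0 => k _.
    by rewrite mulr_ge0.
  rewrite crd_matrix; apply: (le_trans (ler_norm_sum _ _ _)); apply: ler_sum => k _.
  by rewrite normrM ler_wpM2l// (le_trans (ltW (yr k)))// ler_norm.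
pose idx (f : {ffun 'I_3 -> 'I_(2 * L)}) : {ffun 'I_3 -> int} :=
  [ffun i => ((f i : nat)%:Z - L%:Z)%R].
(* Tiles are numbered by [pickle]; K exceeds every code met by the cube, and the remaining codes
   below K merely enlarge the bound. *)
pose K := (\max_f (pickle (idx f)).+1)%N.
exists K => h mh h0 ph.
have cov : cube r `<=` \big[setU/set0]_(k < K) tile false 0%R k.
  move=> y yr.
  have hf i : ((Num.floor (crd i y) + L%:Z)%R < (2 * L)%N%:Z)%R /\ (0 <= Num.floor (crd i y) + L%:Z)%R.
    have := hL i y yr; rewrite ltr_norml => /andP[h1 h2].
    have /andP[f1 f2] := floor_itv (crd i y).
    split.
      have : ((Num.floor (crd i y))%:~R < (L%:Z)%:~R :> R)%R by apply: (le_lt_trans f1).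
      by rewrite ltr_int mul2n -addnn PoszD ltrD2r.
    have : (- (L%:Z)%:~R < (Num.floor (crd i y) + 1)%:~R :> R)%R by apply: (lt_trans _ f2).
    by rewrite -mulrNz ltr_int ltzD1 -subr_ge0 opprK.
  have hn i : (`|(Num.floor (crd i y) + L%:Z)%R|%N < 2 * L)%N.
    by have [h1 h2] := hf i; rewrite -ltz_nat gez0_abs.
  pose f : {ffun 'I_3 -> 'I_(2 * L)} := [ffun i => Ordinal (hn i)].
  rewrite -bigcup_mkord; exists (pickle (idx f)).
    by rewrite /= /K; apply: (@leq_bigmax _ (fun f => (pickle (idx f)).+1)).
  rewrite /tile pickleK_inv => i; rewrite !crdD !crdN crd_sgn_lvec expr0 mul1r.
  have -> : crd i 0 = 0%R by rewrite /crd linear0.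
  rewrite oppr0 addr0 !ffunE /= gez0_abs; last by case: (hf i).
  rewrite addrK.
  have /andP[f1 f2] := floor_itv (crd i y).
  by rewrite subr_ge0 f1 ltrBlDl -intrD1 f2.
apply: (@le_trans _ _ (\int[mu]_(y in \big[setU/set0]_(k < K) tile false 0%R k) h y)).
  apply: ge0_subset_integral => //; first exact: measurable_cube.
    by apply: bigsetU_measurable => k _; exact: measurable_tile.
  exact: measurable_funTS.
rewrite -(big_mkord xpredT (tile false 0%R)) ge0_integral_bigsetU//=; last 4 first.
- by move=> k; exact: measurable_tile.
- exact: iota_uniq.
- by apply/trivIsetP => i j _ _; move/trivIsetP: (@trivIset_tile false 0%R) => /(_ i j); apply.
- exact: measurable_funTS.
apply: (@le_trans _ _ (\sum_(0 <= k < K) \int[mu]_(y in cell b) h y)).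
  apply: lee_sum => k _; rewrite /tile; case: pickle_inv => [m|]; last first.
    by rewrite integral_set0 integral_ge0.
  rewrite expr0 scale1r integral_cell//.
  have mA : measurable [set x | hcell (x - 0 - lvec m)%R].
    by under eq_set do rewrite subr0; exact: measurable_hcell_shift.
  rewrite -(@integral_aff3 R false (lvec m) [set x | hcell (x - 0 - lvec m)%R] h) //; last exact: measurable_funTS.
  have -> : aff3 false (lvec m) @^-1` [set x | hcell (x - 0 - lvec m)%R] = hcell.
    by apply/seteqP; split => x; rewrite /= aff3_0 subr0 addrK.
  under eq_integral do rewrite aff3_0.
  by rewrite hcell_shift.
have sum_const (c : \bar R) n : \sum_(0 <= k < n) c = n%:R%:E * c.
  elim: n => [|n IH]; first by rewrite big_geq// mul0e.
  by rewrite big_nat_recr//= IH -natr1 EFinD ge0_muleDl ?mul1e ?lee_fin.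
by rewrite sum_const.
Qed.

End tiling.

(** * Periodic square-integrable functions *)

Section Riesz_Fischer.
Context d (T : measurableType d) (R : realType) (m : {measure set T -> \bar R}).

Lemma nneseries_geo_bound (a : nat -> \bar R) (c : R) : (forall i, 0 <= a i)%E ->
  (forall i, (a i <= (c * 2^-1 ^+ i)%:E)%E) -> 0 <= c -> (\sum_(i <oo) a i < +oo)%E.
Proof.
move=> a0 ac c0; apply: (@le_lt_trans _ _ (c / (1 - 2^-1))%:E); last exact: ltry.
apply: lime_le; first exact: is_cvg_nneseries.
apply: nearW => n; apply: (@le_trans _ _ (\sum_(0 <= i < n) (c * 2^-1 ^+ i)%:E)%E).
  by apply: lee_sum => i _; exact: ac.
rewrite sumEFin lee_fin; apply: (@geometric_le_lim R n c 2^-1) => //.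
by rewrite ger0_norm ?invr_ge0//; lra.
Qed.

Lemma nneseries_telescope_cvg (v : nat -> R) :
  (\sum_(i <oo) (`|v i.+1 - v i|)%:E < +oo)%E -> cvgn v.
Proof.
move=> h.
have cn : cvgn [normed series (telescope v)].
  apply: nondecreasing_is_cvgn.
    by apply/nondecreasing_seqP => n; rewrite /= /series /= big_nat_recr//= lerDl.
  have hf : (\sum_(i <oo) (`|v i.+1 - v i|)%:E)%E \is a fin_num.
    by rewrite ge0_fin_numE//; apply: nneseries_ge0 => n _ _; rewrite lee_fin.
  exists (fine (\sum_(i <oo) (`|v i.+1 - v i|)%:E)%E) => _ [n _ <-].
  rewrite -lee_fin fineK// /= /series /= -sumEFin.
  exact: nneseries_lim_ge.
have /cvg_ex[l hl] := normed_cvg cn.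
apply/cvg_ex; exists (v 0%N + l).
have eq_cvg (w : nat -> R) : w = (fun n => v 0%N + series (telescope v) n) ->
    w @ \oo --> v 0%N + l.
  by move=> ->; apply: cvgD => //; exact: cvg_cst.
by apply: eq_cvg; apply/funext => n; exact: eq_sum_telescope.
Qed.

Variables (D : set T) (u : nat -> T -> R).
Hypothesis mD : measurable D.
Hypothesis Dfin : (m D < +oo)%E.
Hypothesis mu_ : forall n, measurable_fun setT (u n).
Hypothesis iu : forall i j, m.-integrable D (EFin \o (fun x => (u i x - u j x) ^+ 2)).
Hypothesis cu : forall e, 0 < e -> exists N, forall i j, (N <= i)%N -> (N <= j)%N ->
  \int[m]_(x in D) ((u i x - u j x) ^+ 2) <= e.

(** The limit is given by a formula in the values at [x], the upper limit of a subsequence, so that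
    a property of all the [u n] such as periodicity passes to it. Summable increments give
    convergence of the subsequence almost everywhere, and Fatou's lemma turns this into convergence
    in L^2 of the full sequence. *)
Lemma Riesz_Fischer : exists k : nat -> nat,
  let l x := fine (limn_esup (fun i => (u (k i) x)%:E)) in
  measurable_fun setT l /\
  forall e, 0 < e -> exists N, forall n, (N <= n)%N ->
    m.-integrable D (EFin \o (fun x => (u n x - l x) ^+ 2)) /\
    \int[m]_(x in D) ((u n x - l x) ^+ 2) <= e.
Proof.
(* The rate 4^-i leaves a summable 2^-i after the weighted inequality y <= 2^i y^2 + 2^-i used in
   [idk]. *)
have /choice[N hN] i : exists N, forall p q, (N <= p)%N -> (N <= q)%N ->
    \int[m]_(x in D) ((u p x - u q x) ^+ 2) <= 4^-1 ^+ i.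
  by apply: cu; rewrite exprn_gt0// invr_gt0.
(* A sum rather than a maximum: it dominates N i, is monotone, and the successors force i <= k i. *)
pose k i := (\sum_(j < i.+1) (N j).+1)%N.
have kN i : (N i <= k i)%N by rewrite /k big_ord_recr /= (leq_trans (leqnSn _))// leq_addl.
have kS i : (k i <= k i.+1)%N by rewrite /k [leqRHS]big_ord_recr leq_addr.
have ki i : (i <= k i)%N.
  by elim: i => // i IH; apply: (leq_ltn_trans IH); rewrite /k [ltnRHS]big_ord_recr /= addnS ltnS leq_addr.
exists k => l.
have ml : measurable_fun setT l.
  apply: measurableT_comp; first exact: fine_measurable.
  by apply: measurable_fun_limn_esup => n; exact/measurable_EFinP.
split=> //.
pose dk i x := `|u (k i.+1) x - u (k i) x|.
have mdk i : measurable_fun setT (dk i).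
  by apply: measurableT_comp => //; exact: measurable_funB.
have dk0 i x : (0 <= (dk i x)%:E)%E by rewrite lee_fin /dk.
have c0 : 0 <= 1 + fine (m D) by rewrite addr_ge0// fine_ge0.
have mDf : m D \is a fin_num by rewrite ge0_fin_numE.
have idk i : (\int[m]_(x in D) (dk i x)%:E <= ((1 + fine (m D)) * 2^-1 ^+ i)%:E)%E.
  have i1 : m.-integrable D (EFin \o (fun x => 2 ^+ i * (u (k i.+1) x - u (k i) x) ^+ 2)).
    have := integrableZl mD (2 ^+ i) (iu (k i.+1) (k i)).
    by apply: eq_integrable.
  have i2 : m.-integrable D (EFin \o (cst (2^-1 ^+ i) : T -> R)).
    by apply: measurable_bounded_integrable => //; exact: bounded_cst.
  have e0 : 0 <= (2^-1 : R) ^+ i by rewrite exprn_ge0// invr_ge0.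
  apply: (@le_trans _ _ (\int[m]_(x in D)
     (2 ^+ i * (u (k i.+1) x - u (k i) x) ^+ 2 + 2^-1 ^+ i)%:E)%E).
    apply: ge0_le_integral => //.
    - by apply/measurable_EFinP; exact: measurable_funTS.
    - apply/measurable_EFinP/measurable_funTS; apply: measurable_funD => //.
      by apply: measurable_funM => //; apply: measurable_funX; exact: measurable_funB.
    move=> x _; rewrite lee_fin /dk exprVn; set w := _ - _; set a := (2 ^+ i).
    have a0 : 0 < a by rewrite exprn_gt0.
    rewrite -real_normK ?num_real//; have w0 := normr_ge0 w.
    move: `|w| w0 => y y0.
    have := sqr_ge0 (a * y - 1); rewrite sqrrB1 => h.
    rewrite -(ler_pM2l a0) mulrDr mulfV ?gt_eqF//.
    have : 0 <= a * y by rewrite mulr_ge0// ltW.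
    rewrite mulrA -expr2 -exprMn; move: (a * y) h => t; nra.
  have -> : (\int[m]_(x in D)
     (2 ^+ i * (u (k i.+1) x - u (k i) x) ^+ 2 + 2^-1 ^+ i)%:E =
     (2 ^+ i * \int[m]_(x in D) ((u (k i.+1) x - u (k i) x) ^+ 2) +
      2^-1 ^+ i * fine (m D))%:E)%E.
    rewrite -(RintegralZl _ mD (iu _ _)) -(Rintegral_cst _ mD) -RintegralD// fineK//.
    exact/integrable_fin_num/(integrableD mD i1 i2).
  rewrite lee_fin mulrDl mul1r mulrC [_ * fine _]mulrC lerD2r.
  apply: (@le_trans _ _ (4^-1 ^+ i * 2 ^+ i)).
    rewrite ler_wpM2r ?exprn_ge0//; apply: hN; rewrite ?kN//.
    exact: leq_trans (kN i) (kS i).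
  by rewrite -exprMn lerXn2r ?nnegrE//; lra.
have sfin : (\int[m]_(x in D) (\sum_(i <oo) (dk i x)%:E) < +oo)%E.
  rewrite integral_nneseries//; last first.
    by move=> i; apply/measurable_EFinP; exact: measurable_funTS.
  by apply: (nneseries_geo_bound _ idk) => // i; exact: integral_ge0.
have cl : {ae m, forall x, D x -> (fun i => u (k i) x) @ \oo --> l x}.
  have : m.-integrable D (fun x => \sum_(i <oo) (dk i x)%:E)%E.
    apply/integrableP; split.
      by apply: ge0_emeasurable_sum => // i *; apply/measurable_EFinP; exact: measurable_funTS.
    under eq_integral do rewrite gee0_abs ?nneseries_ge0//.
    exact: sfin.
  move/(integrable_ae mD); apply: filterS => x h Dx.
  have : cvgn (fun i => u (k i) x).
    apply: nneseries_telescope_cvg; rewrite -ge0_fin_numE; first exact: h.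
    by apply: nneseries_ge0 => n _ _; rewrite lee_fin.
  move=> /cvg_ex[L hL]; suff -> : l x = L by [].
  rewrite /l (cvg_limn_einf_sup (_ : _ --> L%:E)).2//.
  by apply: cvg_EFin; [exact: nearW|exact: hL].
move=> e e0; have [N0 hN0] := cu e0; exists N0 => n N0n.
have mul : measurable_fun setT (fun x => (u n x - l x) ^+ 2).
  by apply: measurable_funX; exact: measurable_funB.
(* Fatou's lemma along the subsequence; each lower limit is estimated at the single index max(i,
   N0), where the Cauchy condition applies. *)
have bd : (\int[m]_(x in D) ((u n x - l x) ^+ 2)%:E <= e%:E)%E.
  have -> : (\int[m]_(x in D) ((u n x - l x) ^+ 2)%:E =
     \int[m]_(x in D) limn_einf (fun i => ((u n x - u (k i) x) ^+ 2)%:E))%E.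
    apply: ae_eq_integral => //.
    - by apply/measurable_EFinP; exact: measurable_funTS.
    - apply: measurableT_comp => //; apply: measurable_fun_limn_esup => i.
      apply: measurableT_comp => //; apply/measurable_EFinP/measurable_funTS.
      by apply: measurable_funX; exact: measurable_funB.
    apply: filterS cl => x h Dx; rewrite (cvg_limn_einf_sup (_ : _ --> ((u n x - l x) ^+ 2)%:E)).1//.
    apply: cvg_EFin; first exact: nearW.
    by apply: cvgM; apply: cvgB => //; (exact: cvg_cst || exact: h).
  apply: (le_trans (fatou m mD _ _)) => //.
  - move=> i; apply/measurable_EFinP/measurable_funTS.
    by apply: measurable_funX; exact: measurable_funB.
  - by move=> i x _; rewrite lee_fin sqr_ge0.
  rewrite limn_einf_lim; apply: lime_le; first exact: is_cvg_einfs.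
  apply: nearW => i; apply: (@le_trans _ _ (\int[m]_(x in D) ((u n x - u (k (maxn i N0)) x) ^+ 2)%:E)%E).
    apply: ereal_inf_lbound; exists (maxn i N0) => //=; exact: leq_maxl.
  rewrite -(fineK (integrable_fin_num mD (iu _ _))) lee_fin; apply: hN0 => //.
  exact: leq_trans (leq_maxr i N0) (ki _).
have fin : m.-integrable D (EFin \o (fun x => (u n x - l x) ^+ 2)).
  apply/integrableP; split; first by apply/measurable_EFinP; exact: measurable_funTS.
  under eq_integral do rewrite gee0_abs ?lee_fin ?sqr_ge0//.
  exact: le_lt_trans bd (ltry _).
split=> //; rewrite -lee_fin fineK//; exact: integrable_fin_num.
Qed.

End Riesz_Fischer.

(** * The space of periodic L^2 functions and its completeness *)

Section periodic_L2.
Variable R : realType.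
Local Notation E := 'cV[R]_3.
Local Notation mu := (@lebesgue3 R).
Implicit Types f g : E -> R.

Lemma L2loc_measurable f : L2loc f -> measurable_fun setT f.
Proof. by case. Qed.

Lemma L2loc_of_cube f : measurable_fun setT f ->
  (forall r, mu.-integrable (cube r) (EFin \o (fun x => f x ^+ 2))) -> L2loc f.
Proof.
move=> mf h; split => // K cK; have [r Kr] := compact_cube cK.
have mK : measurable K.
  by apply: measurable_closed; apply: compact_closed => //; exact: norm_hausdorff.
have mf2 : measurable_fun setT (fun x => f x ^+ 2) by exact: measurable_funX.
have /integrableP[_] := h r; apply: le_lt_trans.
under [leRHS]eq_integral do rewrite gee0_abs ?lee_fin ?sqr_ge0//.
apply: ge0_subset_integral => //; first exact: measurable_cube.
  by apply/measurable_EFinP; exact: measurable_funTS.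
by move=> x _; rewrite lee_fin sqr_ge0.
Qed.

Lemma L2loc_lin a f g : L2loc f -> L2loc g -> L2loc (fun y => a * f y + g y).
Proof.
move=> lf lg; have mfg : measurable_fun setT (fun y => a * f y + g y).
  apply: measurable_funD; last exact: L2loc_measurable.
  by apply: measurable_funM => //; exact: L2loc_measurable.
apply: L2loc_of_cube => // r; have mc := @measurable_cube R r.
have i1 := integrableZl mc (2 * a ^+ 2) (L2loc_cube r lf).
have i2 := integrableZl mc 2 (L2loc_cube r lg).
apply: (@integrable_le _ _ _ _ _ _ (fun x => 2 * a ^+ 2 * f x ^+ 2 + 2 * g x ^+ 2)) => //.
- by apply: measurable_funTS; exact: measurable_funX.
- by apply: eq_integrable (integrableD mc i1 i2) => //; exact: measurable_cube.
- move=> x _; rewrite ger0_norm ?sqr_ge0//.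
  by rewrite -subr_ge0 (_ : _ - _ = (a * f x - g x) ^+ 2) ?sqr_ge0//; ring.
Qed.

Lemma L2loc_mul_bounded f g M : measurable_fun setT g -> (forall x, `|g x| <= M) ->
  L2loc f -> L2loc (fun y => g y * f y).
Proof.
move=> mg gM lf; have mfg : measurable_fun setT (fun y => g y * f y).
  by apply: measurable_funM => //; exact: L2loc_measurable.
apply: L2loc_of_cube => // r; have mc := @measurable_cube R r.
have i1 := integrableZl mc (M ^+ 2) (L2loc_cube r lf).
apply: (@integrable_le _ _ _ _ _ _ (fun x => M ^+ 2 * f x ^+ 2)) => //.
  by apply: measurable_funTS; exact: measurable_funX.
move=> x _; rewrite ger0_norm ?sqr_ge0// exprMn ler_wpM2r ?sqr_ge0//.
rewrite -real_normK ?num_real// lerXn2r ?nnegrE ?gM//.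
by rewrite (le_trans _ (gM x)).
Qed.

Lemma L2loc_shift (v : E) f : L2loc f -> L2loc (fun y => f (y + v)).
Proof.
move=> lf; have mfv : measurable_fun [set: E] (fun y => f (y + v)).
  by apply: measurableT_comp (measurable_shiftv v); exact: L2loc_measurable.
have mfv2 : measurable_fun setT (fun y => f y ^+ 2) by apply: measurable_funX; exact: L2loc_measurable.
have mfv3 : measurable_fun [set: E] (fun y => f (y + v) ^+ 2) by exact: measurable_funX.
apply: L2loc_of_cube => // r; have mc := @measurable_cube R r.
pose s := \sum_i (`|r| + `|v i 0|).
have rs i : `|r| + `|v i 0| <= s.
  by rewrite /s (bigD1 i)//= lerDl sumr_ge0// => j _; rewrite addr_ge0.
have mcs := @measurable_cube R s.
have /integrableP[_] := L2loc_cube s lf.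
under eq_integral do rewrite gee0_abs ?lee_fin ?sqr_ge0//.
rewrite /= -(@integral_aff3 R false v (cube s) (fun x => (f x ^+ 2)%:E)) //; last first.
  by apply/measurable_EFinP; exact: measurable_funTS.
move=> h; apply/integrableP; split; first by apply/measurable_EFinP; exact: measurable_funTS.
under eq_integral do rewrite gee0_abs ?lee_fin ?sqr_ge0//.
apply: le_lt_trans h; under [leRHS]eq_integral do rewrite aff3_0.
apply: ge0_subset_integral => //.
- by rewrite -[X in measurable X]setTI; exact: measurable_aff3.
- by apply/measurable_EFinP; exact: measurable_funTS.
- by move=> x _; rewrite lee_fin sqr_ge0.
move=> x xr i; rewrite aff3_0 mxE; apply: (le_lt_trans (ler_normD _ _)).
apply: (lt_le_trans _ (rs i)); rewrite ltrD2r.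
by rewrite (lt_le_trans (xr i))// ler_norm.
Qed.

Variable b : 3.-tuple E.

Lemma periodic_cst T (c : T) : @Defs.periodic R b T (fun=> c).
Proof. by move=> a _; exact: aeW. Qed.

Lemma periodic_comp T U (h : T -> U) (f : E -> T) :
  @Defs.periodic R b _ f -> @Defs.periodic R b _ (fun y => h (f y)).
Proof. by move=> pf a la; apply: filterS (pf a la) => x ->. Qed.

Lemma periodic_op2 T U W (op : T -> U -> W) (f : E -> T) (g : E -> U) :
  @Defs.periodic R b _ f -> @Defs.periodic R b _ g ->
  @Defs.periodic R b _ (fun y => op (f y) (g y)).
Proof. by move=> pf pg a la; apply: filterS2 (pf a la) (pg a la) => x -> ->. Qed.

Lemma periodic_shift T (z : E) (f : E -> T) :
  @Defs.periodic R b _ f -> @Defs.periodic R b _ (fun y => f (y + z)).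
Proof.
move=> pf a la; have := ae_shift z (pf a la).
by apply: filterS => x /=; rewrite addrAC.
Qed.

Definition L2per f := L2loc f /\ @Defs.periodic R b _ f.

Lemma L2per_lin a f g : L2per f -> L2per g -> L2per (fun y => a * f y + g y).
Proof.
move=> [lf pf] [lg pg]; split; first exact: L2loc_lin.
exact: (periodic_op2 (fun x y => a * x + y)).
Qed.

Lemma L2per_shift z f : L2per f -> L2per (fun y => f (y + z)).
Proof. by move=> [lf pf]; split; [exact: L2loc_shift|exact: periodic_shift]. Qed.

Lemma L2loc_cst (c : R) : L2loc (fun _ : E => c).
Proof. by apply: loc_bounded_L2loc => // r; exists `|c|. Qed.

Lemma L2per_cst (c : R) : L2per (fun=> c).
Proof. by split; [exact: L2loc_cst|exact: periodic_cst]. Qed.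

Lemma L2per_sum (I : Type) (l : seq I) (F : I -> E -> R) : (forall i, L2per (F i)) ->
  L2per (fun y => \sum_(i <- l) F i y).
Proof.
move=> LF; elim: l => [|i l IH].
  by rewrite (_ : (fun _ => _) = fun=> 0); [exact: L2per_cst|apply/funext => y; rewrite big_nil].
rewrite (_ : (fun _ => _) = (fun y => 1 * F i y + \sum_(k <- l) F k y)).
  exact: L2per_lin.
by apply/funext => y; rewrite big_cons mul1r.
Qed.

Hypothesis hb : free b.

Lemma cell_cube : exists r, cell b `<=` cube r.
Proof. exact: cell_bounded. Qed.

Lemma cube_cell_integrable (f : E -> \bar R) : (forall r, mu.-integrable (cube r) f) ->
  mu.-integrable (cell b) f.
Proof.
have [r hr] := cell_cube; move=> /(_ r); apply: integrableS => //.
- exact: measurable_cube.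
- exact: measurable_cell.
Qed.

Lemma cell_mul_integrable f g : L2loc f -> L2loc g ->
  mu.-integrable (cell b) (EFin \o (fun y => f y * g y)).
Proof. by move=> lf lg; apply: cube_cell_integrable => r; exact: L2loc_mul_integrable. Qed.

Lemma cell_L2_integrable f : L2loc f -> mu.-integrable (cell b) (EFin \o f).
Proof. by move=> lf; apply: cube_cell_integrable => r; exact: L2loc_integrable. Qed.

Lemma cell_sqr_integrable f : L2loc f ->
  mu.-integrable (cell b) (EFin \o (fun y => f y ^+ 2)).
Proof. by move=> lf; apply: cube_cell_integrable => r; exact: L2loc_cube. Qed.

Lemma L2per_of_cell f : measurable_fun setT f -> @Defs.periodic R b _ f ->
  mu.-integrable (cell b) (EFin \o (fun y => f y ^+ 2)) -> L2per f.
Proof.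
move=> mf pf fi; split => //; have mf2 : measurable_fun setT (fun y => f y ^+ 2).
  exact: measurable_funX.
apply: L2loc_of_cube => // r; have [K hK] := cube_cell_bound hb r.
apply/integrableP; split; first by apply/measurable_EFinP; exact: measurable_funTS.
under eq_integral do rewrite gee0_abs ?lee_fin ?sqr_ge0//.
apply: (le_lt_trans (hK (fun y => (f y ^+ 2)%:E) _ _ _)).
- exact/measurable_EFinP.
- by move=> x; rewrite lee_fin sqr_ge0.
- by move=> a la; apply: filterS (pf a la) => x ->.
case/integrableP : fi => _; under eq_integral do rewrite gee0_abs ?lee_fin ?sqr_ge0//.
by move=> h; rewrite lte_mul_pinfty ?lee_fin.
Qed.

Definition ip f g := cell_int b (fun y => f y * g y).

Lemma ipC f g : ip f g = ip g f.
Proof. by apply: eq_Rintegral => x _; rewrite mulrC. Qed.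

Lemma ip_linl a f g h : L2loc f -> L2loc g -> L2loc h ->
  ip (fun y => a * f y + g y) h = a * ip f h + ip g h.
Proof.
move=> lf lg lh; have mc := measurable_cell hb; rewrite /ip /cell_int.
rewrite -RintegralZl; [|exact: mc|exact: cell_mul_integrable].
rewrite -RintegralD; [|exact: mc| |exact: cell_mul_integrable].
  by apply: eq_Rintegral => x _; ring.
have := integrableZl mc a (cell_mul_integrable lf lh).
by apply: eq_integrable.
Qed.

Lemma ip_ge0 f : 0 <= ip f f.
Proof. by apply: Rintegral_ge0 => x _; rewrite -expr2 sqr_ge0. Qed.

Lemma ip_shift z f g : L2per f -> L2per g ->
  ip (fun y => f (y + z)) (fun y => g (y + z)) = ip f g.
Proof.
move=> [lf pf] [lg pg]; apply: (cell_int_shift hb z (f := fun y => f y * g y)).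
  by apply: measurable_funM; exact: L2loc_measurable.
exact: (periodic_op2 *%R).
Qed.

Lemma eq_ip f f' g : L2loc f -> L2loc f' -> L2loc g ->
  {ae mu, forall y, f y = f' y} -> ip f g = ip f' g.
Proof.
move=> lf lf' lg h; apply: ae_eq_Rintegral; first exact: measurable_cell.
- by apply: measurable_funTS; apply: measurable_funM; exact: L2loc_measurable.
- by apply: measurable_funTS; apply: measurable_funM; exact: L2loc_measurable.
- by apply: filterS h => x ->.
Qed.

Lemma L2per_complete (u : nat -> E -> R) : (forall n, L2per (u n)) ->
  (forall e, 0 < e -> exists N, forall i j, (N <= i)%N -> (N <= j)%N ->
     ip (fun y => u i y - u j y) (fun y => u i y - u j y) <= e) ->
  exists2 l, L2per l & forall e, 0 < e -> exists N, forall n, (N <= n)%N ->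
     ip (fun y => u n y - l y) (fun y => u n y - l y) <= e.
Proof.
move=> Lu cu.
have Lsub f g : L2loc f -> L2loc g -> L2loc (fun y => f y - g y).
  move=> lf lg; rewrite (_ : (fun _ => _) = (fun y => -1 * g y + f y)).
    exact: L2loc_lin.
  by apply/funext => y; ring.
have mu_ n : measurable_fun setT (u n) by apply: L2loc_measurable; case: (Lu n).
have [||k [ml hl]] := @Riesz_Fischer _ _ _ mu (cell b) u (measurable_cell hb) (cell_fin hb) mu_.
- by move=> i j; apply: cell_sqr_integrable; apply: Lsub; case: (Lu i); case: (Lu j).
- move=> e e0; have [N hN] := cu e e0; exists N => i j Ni Nj.
  by have := hN i j Ni Nj; rewrite /ip /cell_int; under eq_Rintegral do rewrite -expr2.
set l := fun x => _ in ml hl.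
have pl : @Defs.periodic R b _ l.
  (* For a given lattice vector, a countable union of null sets: off it the whole sequence takes
     equal values at the two points, hence so does [l]. *)
  move=> a la; have : {ae mu, forall x, forall n, u n (x + a) = u n x}.
    by apply/ae_foralln => n; case: (Lu n) => _; exact.
  apply: filterS => x h; rewrite /l; congr fine; congr limn_esup.
  by apply/funext => i; rewrite h.
have [N hN] := hl 1 ltr01; have [iN _] := hN N (leqnn N).
have Ll : L2per l.
  apply: L2per_of_cell => //.
  have mc := measurable_cell hb.
  have lN : L2loc (u N) by case: (Lu N).
  have := integrableD mc (integrableZl mc 2 iN) (integrableZl mc 2 (cell_sqr_integrable lN)).
  move/(fun h => @integrable_le _ _ _ _ _ (fun x => l x ^+ 2) (fun x => 2 * (u N x - l x) ^+ 2 + 2 * u N x ^+ 2) mc _ h).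
  apply; first by apply: measurable_funTS; exact: measurable_funX.
  move=> x _; rewrite ger0_norm ?sqr_ge0// -subr_ge0.
  by rewrite (_ : _ - _ = (2 * u N x - l x) ^+ 2) ?sqr_ge0//; ring.
exists l => // e e0; have [N' hN'] := hl e e0; exists N' => n Nn.
have [_] := hN' n Nn; rewrite /ip /cell_int.
by under [X in _ -> X <= _]eq_Rintegral do rewrite -expr2.
Qed.

End periodic_L2.

(** * Convolutions and correlations *)

Section convolution.
Variable R : realType.
Local Notation E := 'cV[R]_3.
Local Notation mu := (@lebesgue3 R).
Implicit Types f g phi : E -> R.

(** Contraposition and countable choice. Continuity is handled through sequences at rate 1/(n+1),
    since dominated convergence speaks of sequences; this lemma and [seq_continuous] convert
    back. *)
Lemma seq_eps (h : E -> R) y :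
  (forall z : nat -> E, (forall n, `|z n - y| <= n.+1%:R^-1) -> h (z n) @[n --> \oo] --> h y) ->
  forall e, 0 < e -> exists n : nat, forall z, `|z - y| <= n.+1%:R^-1 -> `|h z - h y| <= e.
Proof.
move=> H e e0; apply: contrapT => /forallNP C.
have /choice[z hz] n : exists z, `|z - y| <= n.+1%:R^-1 /\ e < `|h z - h y|.
  have /existsNP[z /not_implyP[h1 /negP h2]] := C n.
  by exists z; rewrite ltNge.
have /cvgrPdist_le /(_ _ e0) [N _ hN] := H z (fun n => (hz n).1).
by have := hN N (leqnn N); rewrite /= distrC leNgt (hz N).2.
Qed.

Lemma seq_continuous (h : E -> R) :
  (forall y (z : nat -> E), (forall n, `|z n - y| <= n.+1%:R^-1) ->
    h (z n) @[n --> \oo] --> h y) -> continuous h.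
Proof.
move=> H y; apply/(@cvgrPdist_le R R E (nbhs y) (nbhs_filter y) h (h y)) => e e0; have [n hn] := seq_eps (H y) e0.
have n0 : 0 < n.+1%:R^-1 :> R by rewrite invr_gt0.
near=> z; rewrite distrC; apply: hn; rewrite distrC ltW//.
Unshelve. all: by end_near. Qed.

Lemma near_seq_cvg (y : E) (z : nat -> E) :
  (forall n, `|z n - y| <= n.+1%:R^-1) -> z @ \oo --> y.
Proof.
move=> hz; apply/cvgrPdist_le => e e0; near=> n; rewrite distrC.
apply: (le_trans (hz n)); apply: ltW.
by near: n; exact: near_infty_natSinv_lt (PosNum e0).
Unshelve. all: by end_near. Qed.

Lemma cubeD r s (x y : E) : cube r x -> cube s y -> cube (r + s) (x + y).
Proof.
by move=> xr ys i; rewrite mxE (le_lt_trans (ler_normD _ _))// ltrD.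
Qed.

Lemma cubeN r (x : E) : cube r x -> cube r (- x).
Proof. by move=> xr i; rewrite mxE normrN. Qed.

(** The argument of [phi] is x - y, not y - x: this is the average of the translates f(. + z) with
    weight phi(z), see [conv_shiftE], and a derivative in y falls on [phi] with a minus sign. The
    usual convolution has the kernel phi(- .). *)
Definition conv phi f (y : E) : R := \int[mu]_x (f x * phi (x - y)).

Lemma cbounded_cube M r : 0 <= M -> cbounded M r (fun x => M * \1_(@cube R r) x).
Proof.
move=> M0; split; first by apply: measurable_funM => //; apply: measurable_indic; exact: measurable_cube.
by move=> x; rewrite ger0_norm// mulr_ge0// indic_ge0.
Qed.

Section kernel.
Variables (M r : R) (phi : E -> R).
Hypothesis r0 : 0 < r.
Hypothesis cphi : cbounded M r phi.

Let M0 : 0 <= M. Proof. exact: cbounded_M_ge0 cphi r0. Qed.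

Lemma measurable_kernel y : measurable_fun [set: E] (fun x => phi (x - y)).
Proof. by apply: measurableT_comp (measurable_shiftv (- y)); case: cphi. Qed.

Lemma conv_dom f s y x : cube s y ->
  `|f x * phi (x - y)| <= `|f x| * (M * \1_(cube (r + s)) x).
Proof.
move=> ys; rewrite normrM ler_wpM2l//; have [_ h] := cphi.
apply: (le_trans (h _)); rewrite ler_wpM2l// !indicE.
have [xy|_] := boolP (x - y \in cube r); last exact: ler0n.
rewrite mem_set//; move: xy; rewrite inE => xy.
by have := cubeD xy ys; rewrite subrK.
Qed.

Lemma conv_dom_integrable f s : L2loc f ->
  mu.-integrable setT (EFin \o (fun x => `|f x| * (M * \1_(cube s) x))).
Proof.
move=> lf; apply: (cbounded_mul_integrable (cbounded_cube s M0)).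
have := integrable_norm (L2loc_integrable s lf).
by apply: eq_integrable => //; exact: measurable_cube.
Qed.

Lemma norm_in_cube (y : E) : cube (`|y| + 1) y.
Proof. by apply: cube_norm; rewrite ltrDl. Qed.

Lemma conv_integrable f y : L2loc f ->
  mu.-integrable setT (EFin \o (fun x => f x * phi (x - y))).
Proof.
move=> lf; apply: (integrable_le _ _ (conv_dom_integrable (r + (`|y| + 1)) lf)) => //.
  by apply: measurable_funM; [exact: L2loc_measurable|exact: measurable_kernel].
move=> x _; apply: conv_dom; exact: norm_in_cube.
Qed.

Lemma conv_shiftE f y : L2loc f -> conv phi f y = \int[mu]_z (f (z + y) * phi z).
Proof.
move=> lf; rewrite /conv -(Rintegral_shift y).
  by apply: eq_Rintegral => x _; rewrite addrK.
by apply: measurable_funM; [exact: L2loc_measurable|exact: measurable_kernel].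
Qed.

Lemma conv_bound f s y : L2loc f -> cube s y ->
  `|conv phi f y| <= \int[mu]_x (`|f x| * (M * \1_(cube (r + s)) x)).
Proof.
move=> lf ys; apply: (le_trans (le_normr_Rintegral measurableT (conv_integrable y lf))).
apply: le_Rintegral => //.
- have := integrable_norm (conv_integrable y lf).
  by apply: eq_integrable.
- exact: conv_dom_integrable.
- by move=> x _; exact: conv_dom.
Qed.

Lemma conv_loc_bounded f : L2loc f -> loc_bounded (conv phi f).
Proof.
move=> lf s; exists (\int[mu]_x (`|f x| * (M * \1_(cube (r + s)) x))) => y ys.
exact: conv_bound.
Qed.

Hypothesis cont : continuous phi.

Lemma conv_continuous f : L2loc f -> continuous (conv phi f).
Proof.
move=> lf; apply: seq_continuous => y z hz.
have zy := near_seq_cvg hz.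
apply: (@Rintegral_dominated _ _ _ _ _ _ _
   (fun x => `|f x| * (M * \1_(cube (r + (`|y| + 2))) x)) measurableT _ _ _ _ _).2.
- by move=> n; apply: measurable_funM; [exact: L2loc_measurable|exact: measurable_kernel].
- by apply: measurable_funM; [exact: L2loc_measurable|exact: measurable_kernel].
- apply: aeW => x _; apply: cvgM; first exact: cvg_cst.
  apply: continuous_cvg; first exact: cont.
  by apply: cvgB => //; exact: cvg_cst.
- exact: conv_dom_integrable.
- move=> n x _; apply: conv_dom; apply: cube_norm.
  rewrite -(subrK y (z n)) (le_lt_trans (ler_normD _ _))// addrC ler_ltD//.
  by rewrite (le_lt_trans (hz n))// (le_lt_trans (_ : _ <= 1))// ?ltr1n// invf_le1 ?ler1n.
Qed.

Lemma measurable_conv f : L2loc f -> measurable_fun setT (conv phi f).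
Proof. by move=> lf; apply: measurable_continuous; exact: conv_continuous. Qed.

Lemma conv_L2per b f : L2per b f -> L2per b (conv phi f).
Proof.
move=> [lf pf]; split.
  by apply: loc_bounded_L2loc; [exact: measurable_conv|exact: conv_loc_bounded].
move=> a la; apply: aeW => y; rewrite !conv_shiftE//.
apply: ae_eq_Rintegral => //.
- apply: measurable_funM; last by case: cphi.
  by apply: L2loc_measurable; exact: L2loc_shift.
- apply: measurable_funM; last by case: cphi.
  by apply: L2loc_measurable; exact: L2loc_shift.
- have := ae_shift y (pf a la).
  by apply: filterS => x /= h _; rewrite addrA h.
Qed.

End kernel.

Lemma cbounded_reflect K r (phi : E -> R) : 0 < r -> cbounded K r phi ->
  cbounded K r (fun x => phi (- x)).
Proof.
move=> r0 c; have K0 := cbounded_M_ge0 c r0; case: c => mphi hphi; split.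
  have mN : measurable_fun [set: E] (fun x : E => - x).
    by under eq_fun do rewrite -scaleN1r; exact: measurable_scalev.
  exact: measurableT_comp mphi mN.
move=> x; apply: le_trans (hphi _) _; rewrite !indicE.
have [xr|_] := boolP (- x \in cube r); last by rewrite mulr0 mulr_ge0.
by rewrite mem_set//; move: xr; rewrite inE => /cubeN; rewrite opprK.
Qed.

Lemma prodf_kernel (k : 'I_3 -> R -> R) : test_factors k ->
  exists M r, [/\ 0 < r, cbounded M r (prodf k) & continuous (prodf k)].
Proof.
move=> tk; have [M [r [r0 c]]] := test_cbounded (test_factors_test tk).
exists M, r; split => //; apply: smooth_continuous.
by case: (test_factors_test tk).
Qed.

Lemma conv_prodf_L2per b k f : test_factors k -> L2per b f -> L2per b (conv (prodf k) f).
Proof. by move=> /prodf_kernel[M [r [r0 c cc]]]; exact: (conv_L2per r0 c cc). Qed.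

Lemma conv_prodf_continuous k f : test_factors k -> L2loc f -> continuous (conv (prodf k) f).
Proof. by move=> /prodf_kernel[M [r [r0 c cc]]]; exact: (conv_continuous r0 c cc). Qed.

Lemma conv_weak_partial j p w k y : weak_partial j p w -> test_factors k ->
  conv (prodf (prodf_d j k)) p y = - conv (prodf k) w y.
Proof.
move=> pw tk; have ta := test_factors_aff false (- y) tk.
have sk : smooth_factors k by case: tk.
transitivity (\int[mu]_x (p x * partial j (prodf (aff_factors false (- y) k)) x)).
  apply: eq_Rintegral => x _.
  by rewrite partial_prodf_aff// expr0 mul1r aff3_0 partial_prodf.
rewrite (pw _ (test_factors_test ta)); congr (- _).
by apply: eq_Rintegral => x _; rewrite prodf_aff aff3_0.
Qed.

Lemma integral_indicM (D : set E) f : measurable D ->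
  (\int[mu]_y (\1_D y * f y)%:E = \int[mu]_(y in D) (f y)%:E)%E.
Proof.
move=> mD; rewrite [RHS]integral_mkcond; apply: eq_integral => y _.
by rewrite patchE indicE; case: ifPn => yD; rewrite ?mul1r ?mul0r.
Qed.

Variable b : 3.-tuple E.
Hypothesis hb : free b.

Definition corr g f (z : E) : R := ip b g (fun y => f (y + z)).

(** Fubini on the product of the space of shifts and the cell: averaging the correlation over shifts
    amounts to averaging one factor. *)
Lemma corr_conv g f phi M r : 0 < r -> cbounded M r phi -> L2per b g -> L2per b f ->
  mu.-integrable setT (EFin \o (fun z => corr g f z * phi z)) /\
  \int[mu]_z (corr g f z * phi z) = ip b g (conv phi f).
Proof.
move=> r0 cphi Lg Lf; have [lg pg] := Lg; have [lf pf] := Lf.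
have mphi : measurable_fun setT phi by case: cphi.
have mg := L2loc_measurable lg; have mf := L2loc_measurable lf.
have mc := measurable_cell hb.
pose F (p : E * E) := (\1_(cell b) p.2 * (g p.2 * f (p.2 + p.1) * phi p.1))%:E.
have mF : measurable_fun setT F.
  apply/measurable_EFinP; apply: measurable_funM.
    by apply: measurableT_comp => //; exact: measurable_indic.
  apply: measurable_funM; last by apply: measurableT_comp.
  apply: measurable_funM; first by apply: measurableT_comp.
  by apply: (measurableT_comp mf); exact: measurable_addv.
have Fz z : (\int[mu]_y F (z, y) = (corr g f z * phi z)%:E)%E.
  have lfz := L2loc_shift z lf.
  rewrite /F /= integral_indicM// /corr /ip /cell_int.
  rewrite -RintegralZr//; last exact: cell_mul_integrable.
  rewrite fineK//; apply: integrable_fin_num => //.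
  have := integrableZr mc (phi z) (cell_mul_integrable hb lg lfz).
  by apply: eq_integrable.
have iF : (mu \x mu)%E.-integrable setT F.
  apply/integrable12ltyP => //.
  (* From |g f| <= (g^2 + f^2) / 2; the cell integral of f(y + z)^2 does not depend on z, so the
     bound is uniform over all shifts. *)
  pose K := 2^-1 * (ip b g g + ip b f f).
  have bz z : (\int[mu]_y `|F (z, y)| <= (K * `|phi z|)%:E)%E.
    have lfz := L2loc_shift z lf.
    rewrite /F /=.
    under eq_integral do rewrite normrM ger0_norm ?indic_ge0//.
    rewrite integral_indicM// /K -(ip_shift hb z Lf Lf) /ip /cell_int.
    rewrite -RintegralD//; [|exact: cell_mul_integrable|exact: cell_mul_integrable].
    have i1 : mu.-integrable (cell b) (EFin \o (fun x => g x * g x + f (x + z) * f (x + z))).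
      have := integrableD mc (cell_mul_integrable hb lg lg) (cell_mul_integrable hb lfz lfz).
      by apply: eq_integrable.
    rewrite -(RintegralZl _ mc i1) -RintegralZr//; last first.
      have := integrableZl mc 2^-1 i1; exact: eq_integrable.
    rewrite fineK; last first.
      apply: integrable_fin_num => //.
      have := integrableZr mc `|phi z| (integrableZl mc 2^-1 i1).
      by apply: eq_integrable => // y _.
    apply: ge0_le_integral => //.
    - apply/measurable_EFinP/measurable_funTS; apply: measurableT_comp => //.
      apply: measurable_funM => //; apply: measurable_funM => //.
      exact: L2loc_measurable.
    - apply/measurable_EFinP/measurable_funTS; apply: measurable_funM => //.
      apply: measurable_funM => //; apply: measurable_funD; apply: measurable_funM => //; exact: L2loc_measurable.
    move=> y _; rewrite lee_fin normrM ler_wpM2r// ler_norml.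
    move: (g y) (f (y + z)) => s t; have := sqr_ge0 (s - t); have := sqr_ge0 (s + t).
    by move=> *; apply/andP; split; nra.
  apply: (@le_lt_trans _ _ (\int[mu]_z (K * `|phi z|)%:E)%E).
    apply: ge0_le_integral => //.
    - by move=> z _; apply: integral_ge0 => y _.
    - apply: (measurable_fun_fubini_tonelli_F (fun p => `|F p|%E)) => //.
      exact: measurableT_comp.
    - by apply/measurable_EFinP; apply: measurable_funM => //; exact: measurableT_comp.
  have := integrableZl measurableT K (integrable_norm (cbounded_integrable cphi)).
  move=> /integrableP[_]; apply: le_lt_trans.
  rewrite le_eqVlt; apply/orP; left; apply/eqP.
  have K0 : 0 <= K by rewrite mulr_ge0// addr_ge0// ip_ge0.
  by apply: eq_integral => z _; rewrite gee0_abs//= lee_fin mulr_ge0.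
split.
  have := integrable_fubini_F iF; apply: eq_integrable => //.
  by move=> z _; rewrite /fubini_F Fz.
rewrite [LHS]/Rintegral.
transitivity (fine (\int[mu]_z \int[mu]_y F (z, y))%E).
  by congr fine; apply: eq_integral => z _; rewrite Fz.
rewrite (Fubini iF) /ip /cell_int /Rintegral -integral_indicM//; congr fine.
apply: eq_integral => y _; rewrite /F /=.
have iy : mu.-integrable setT (EFin \o (fun z => f (z + y) * phi z)).
  apply: (cbounded_mul_integrable cphi); exact/L2loc_integrable/L2loc_shift.
transitivity (\int[mu]_z ((\1_(cell b) y * g y)%:E * (f (z + y) * phi z)%:E))%E.
  by apply: eq_integral => z _; rewrite -EFinM addrC; congr EFin; ring.
rewrite integralZl// [in RHS]mulrA [RHS]EFinM; congr (_ * _)%E.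
rewrite (conv_shiftE cphi)// /Rintegral fineK//.
exact: integrable_fin_num.
Qed.

Lemma corr_sym g f z : L2per b g -> L2per b f -> corr g f (- z) = corr f g z.
Proof.
move=> Lg Lf; rewrite /corr -(ip_shift hb z Lg (L2per_shift (- z) Lf)) ipC.
by congr ip; apply/funext => y; rewrite addrK.
Qed.

(** Both sides integrate a correlation against the kernel, and exchanging the two factors of a
    correlation reflects its variable. *)
Lemma conv_adjoint g f phi M r : 0 < r -> cbounded M r phi -> L2per b g -> L2per b f ->
  ip b g (conv phi f) = ip b f (conv (fun x => phi (- x)) g).
Proof.
move=> r0 c Lg Lf; have c' := cbounded_reflect r0 c.
have [i1 <-] := corr_conv r0 c Lg Lf; have [i2 <-] := corr_conv r0 c' Lf Lg.
rewrite -(Rintegral_reflect 0); last by move/integrableP : i1 => [/measurable_EFinP].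
by apply: eq_Rintegral => z _; rewrite sub0r corr_sym.
Qed.

Lemma conv_adjoint_prodf g f k : test_factors k -> L2per b g -> L2per b f ->
  ip b g (conv (prodf k) f) = ip b f (conv (prodf (aff_factors true 0 k)) g).
Proof.
move=> tk Lg Lf; have [M [r [r0 c _]]] := prodf_kernel tk.
apply: (etrans (conv_adjoint r0 c Lg Lf)); apply: (congr1 (fun h => ip b f (conv h g))).
by apply/funext => x; rewrite prodf_aff aff3_1 sub0r.
Qed.


Lemma ip_eq0 f : L2per b f -> ip b f f = 0 -> {ae mu, forall y, f y = 0}.
Proof.
move=> [lf pf] f0.
have mf2 : measurable_fun setT (fun x => f x ^+ 2) by apply: measurable_funX; exact: L2loc_measurable.
have q0 x : (0 <= (f x ^+ 2)%:E)%E by rewrite lee_fin sqr_ge0.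
have c0 : (\int[mu]_(y in cell b) (f y ^+ 2)%:E = 0)%E.
  rewrite -(fineK (integrable_fin_num (measurable_cell hb) (cell_sqr_integrable hb lf))).
  by congr EFin; rewrite -[RHS]f0.
have h n : {ae mu, forall y, cube n%:R y -> f y = 0}.
  have [K hK] := cube_cell_bound hb n%:R.
  have mq := @measurable_cube R n%:R.
  have : (\int[mu]_(y in cube n%:R) `|(f y ^+ 2)%:E| = 0)%E.
    apply/eqP; rewrite eq_le integral_ge0 ?andbT//.
    under eq_integral do rewrite gee0_abs//.
    apply: (le_trans (hK (fun x => (f x ^+ 2)%:E) _ q0 _)).
    - exact/measurable_EFinP.
    - by move=> a la; apply: filterS (pf a la) => x ->.
    - by rewrite c0 mule0.
  have mf2' : measurable_fun (cube n%:R : set E) (fun y => (f y ^+ 2)%:E).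
    by apply/measurable_EFinP; exact: measurable_funTS.
  move=> /(ae_eq_integral_abs mu mq mf2').
  by apply: filterS => y + qy => /(_ qy) [/eqP]; rewrite sqrf_eq0 => /eqP.
have : {ae mu, forall y, forall n, cube n%:R y -> f y = 0} by exact/ae_foralln.
apply: filterS => y hy.
have [n _ /hy //] : (\bigcup_n cube n%:R) y by rewrite bigcup_cube.
Qed.

(** Around a point where [h] is nonzero there would be an open box inside a null set. *)
Lemma continuous_ip_eq0 (h : E -> R) : continuous h -> L2per b h -> ip b h h = 0 ->
  forall y, h y = 0.
Proof.
move=> ch Lh h0 y; have [N [mN N0 hN]] := ip_eq0 Lh h0.
apply: contrapT => /eqP hy.
have /cvgrPdist_lt /(_ `|h y|) := ch y; rewrite normr_gt0 => /(_ hy).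
rewrite -nbhs_ballE /= => -[e /= e0 he].
pose a i := y i 0 - e / 2; pose c i := y i 0 + e / 2.
have : (0 < mu [set x : E | forall i, (a i < x i 0 < c i)%R])%E.
  rewrite lebesgue3_box lte_fin; apply: prodr_gt0 => i _.
  by rewrite lt_max /a /c; apply/orP; right; lra.
apply/negP; rewrite -leNgt -N0; apply: le_measure; rewrite ?inE//.
  exact: measurable_box.
move=> x hx; apply: hN => /= hx0.
have : ball y e x.
  rewrite -ball_normE /=; apply: (@le_lt_trans _ _ (e / 2)); last lra.
  apply: norm_cube => [|i]; first lra.
  by have := hx i; rewrite /a /c !mxE ler_norml => /andP[]; move=> *; apply/andP; split; lra.
by move=> /he /=; rewrite hx0 subr0 ltxx.
Qed.


Lemma ip_lincomb (a : R) f g h : L2per b f -> L2per b g -> L2per b h ->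
  ip b (a *: f + g) h = a * ip b f h + ip b g h.
Proof. by move=> [lf _] [lg _] [lh _]; exact: ip_linl. Qed.

Lemma L2per_lincomb (a : R) f g : L2per b f -> L2per b g -> L2per b (a *: f + g).
Proof. exact: L2per_lin. Qed.

Lemma ip_Cauchy_Schwarz f g : L2per b f -> L2per b g ->
  (ip b f g) ^+ 2 <= ip b f f * ip b g g.
Proof.
move=> Lf Lg; apply: (Cauchy_Schwarz_form (V := E -> R) (H := L2per b)) => //.
- by move=> *; exact: L2per_lincomb.
- by move=> *; exact: ip_lincomb.
- by move=> *; exact: ipC.
- by move=> *; exact: ip_ge0.
Qed.

Lemma corr_lin a f g q z : L2per b f -> L2per b g -> L2per b q ->
  corr (a *: f + g) q z = a * corr f q z + corr g q z.
Proof. by move=> Lf Lg Lq; apply: ip_lincomb => //; exact: L2per_shift. Qed.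

Lemma corr_bound f q z : L2per b f -> L2per b q ->
  (corr f q z) ^+ 2 <= ip b f f * ip b q q.
Proof.
move=> Lf Lq; rewrite -[X in _ <= _ * X](ip_shift hb z Lq Lq).
by apply: ip_Cauchy_Schwarz => //; exact: L2per_shift.
Qed.

(** The shift can be moved from [q] onto the convolution, which is continuous and locally bounded,
    so dominated convergence applies. *)
Lemma corr_conv_cvg k r q (z : nat -> E) : test_factors k -> L2per b r -> L2per b q ->
  (forall n, `|z n| <= n.+1%:R^-1) ->
  corr (conv (prodf k) r) q (z n) @[n --> \oo] --> corr (conv (prodf k) r) q 0.
Proof.
move=> tk Lr Lq hz; pose h := conv (prodf k) r.
have Lh : L2per b h by exact: conv_prodf_L2per.
have ch : continuous h by apply: conv_prodf_continuous => //; case: Lr.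
have cE t : corr h q t = ip b (fun y => h (y - t)) q.
  rewrite -[RHS](ip_shift hb t (L2per_shift (- t) Lh) Lq) /corr /ip.
  by congr (cell_int b _); apply/funext => y; rewrite addrK.
have mc := measurable_cell hb.
have lb : loc_bounded h.
  have [M [s [s0 c cc]]] := prodf_kernel tk.
  by apply: (conv_loc_bounded s0 c); case: Lr.
have [s hs] := cell_cube b.
have [M hM] := lb (s + 2).
rewrite -/h cE; under eq_fun do rewrite cE.
have z2 n : cube 2 (z n).
  apply: cube_norm; apply: (le_lt_trans (hz n)); apply: (@le_lt_trans _ _ 1).
    by rewrite invf_le1 ?ler1n.
  by rewrite ltr1n.
have lq : L2loc q by case: Lq.
have mh : measurable_fun setT h by apply: L2loc_measurable; case: Lh.
apply: (@Rintegral_dominated _ _ _ _ _ _ _ (fun y => M * `|q y|) mc _ _ _ _ _).2.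
- move=> n; apply: measurable_funTS; apply: measurable_funM; last exact: L2loc_measurable.
  by apply: measurableT_comp (measurable_shiftv _).
- apply: measurable_funTS; apply: measurable_funM; last exact: L2loc_measurable.
  by apply: measurableT_comp (measurable_shiftv _).
- apply: aeW => y _; apply: cvgM; last exact: cvg_cst.
  apply: continuous_cvg; first exact: ch.
  apply: cvgB; first exact: cvg_cst.
  by apply: near_seq_cvg => n; rewrite subr0.
- have := integrableZl mc M (integrable_norm (cell_L2_integrable hb lq)).
  by apply: eq_integrable.
- move=> n y Yy; rewrite normrM ler_wpM2r//; apply: hM.
  by apply: cubeD; [exact: hs|apply: cubeN; exact: z2].
Qed.

(* The p for which z |-> corr p q z is continuous at 0 along z form a closed
   subspace of L2per containing all convolutions; r orthogonal to it has all
   its convolutions zero, so r = 0 almost everywhere. *)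
Lemma corr_cvg p q (z : nat -> E) : L2per b p -> L2per b q ->
  (forall n, `|z n| <= n.+1%:R^-1) ->
  corr p q (z n) @[n --> \oo] --> corr p q 0.
Proof.
move=> Lp Lq hz.
pose F : set (E -> R) := [set f | L2per b f /\ corr f q (z n) @[n --> \oo] --> corr f q 0].
have L0 : L2per b (0 : E -> R) by exact: (L2per_cst b 0).
have Lsub f g : L2per b f -> L2per b g -> L2per b (f - g).
  by move=> Lf Lg; rewrite addrC -scaleN1r; exact: L2per_lincomb.
have FH : F `<=` L2per b by move=> f [].
have F0 : F 0.
  split=> //; rewrite (_ : corr 0 q = cst 0); first exact: cvg_cst.
  apply/funext => t; rewrite /corr /ip /cell_int.
  under eq_Rintegral do rewrite mul0r.
  by rewrite Rintegral_cst ?mul0r//; exact: measurable_cell.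
have Flin a f g : F f -> F g -> F (a *: f + g).
  move=> [Lf cf] [Lg cg]; split; first exact: L2per_lincomb.
  rewrite corr_lin//; under eq_fun do rewrite corr_lin//.
  by apply: cvgD => //; apply: cvgM => //; exact: cvg_cst.
have Fcomp (u : nat -> E -> R) : (forall n, F (u n)) ->
    (forall e, 0 < e -> exists N, forall m n, (N <= m)%N -> (N <= n)%N ->
     ip b (u m - u n) (u m - u n) <= e) ->
    exists2 l, F l & forall e, 0 < e -> exists N, forall n, (N <= n)%N ->
     ip b (u n - l) (u n - l) <= e.
  move=> Fu cu; have [l Ll hl] := L2per_complete hb (fun n => (Fu n).1) cu.
  exists l => //; split=> //.
  apply/cvgrPdist_le => e e0.
  have q0 := ip_ge0 b q; have q1 : 0 < ip b q q + 1 by rewrite ltr_wpDl.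
  (* By Cauchy-Schwarz this L^2 distance changes the correlation with [q] by at most e / 3, at every
     shift at once; the 1 admits [ip b q q = 0]. *)
  have e1 : 0 < (e / 3) ^+ 2 / (ip b q q + 1) by rewrite divr_gt0// exprn_gt0// divr_gt0.
  have [N hN] := hl _ e1.
  have e3 : 0 <= e / 3 by rewrite divr_ge0// ltW.
  have bd t : `|corr (u N) q t - corr l q t| <= e / 3.
    have -> : corr (u N) q t - corr l q t = corr ((-1) *: l + u N) q t.
      by rewrite corr_lin// ?mulN1r 1?addrC//; exact: (Fu N).1.
    rewrite -ler_sqr ?nnegrE// real_normK ?num_real//.
    apply: (le_trans (corr_bound _ _ _)) => //.
      by apply: L2per_lincomb => //; exact: (Fu N).1.
    have -> : -1 *: l + u N = (fun y => u N y - l y).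
      by apply/funext => y; rewrite -[LHS]/(-1 * l y + u N y); ring.
    apply: (le_trans (ler_wpM2r q0 (hN N (leqnn N)))).
    rewrite -mulrA ler_piMr ?sqr_ge0// mulrC ler_pdivrMr// mul1r.
    by rewrite lerDl.
  have /cvgrPdist_le /(_ (e / 3)) := (Fu N).2.
  rewrite divr_gt0// => /(_ isT); apply: filterS => n hn.
  have := bd 0; have := bd (z n); move: hn.
  by rewrite !ler_norml => /andP[? ?] /andP[? ?] /andP[? ?]; apply/andP; split; lra.
have [p' [Lp' cp'] hp'] := @projection R (E -> R) (L2per b) (ip b)
  (fun a u v => @L2per_lincomb a u v) (fun a u v w => @ip_lincomb a u v w)
  (fun u v _ _ => ipC b u v) (fun u _ => ip_ge0 b u) F F0 FH Flin Fcomp p Lp.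
pose r := p - p'; have Lr : L2per b r by exact: Lsub.
have r0 : {ae mu, forall x, r x = 0}.
  have lr : L2loc r by case: Lr.
  apply: fundamental_lemma; first exact: L2loc_measurable.
    by move=> s; exact: L2loc_integrable.
  move=> k tk; pose k' := aff_factors true 0 k.
  have tk' : test_factors k' by exact: test_factors_aff.
  (* Reflecting twice restores [k], so h is the convolution of [r] with [k]. By adjointness |h|^2
     pairs [r] with a convolution of h, which lies in [F]; hence h vanishes identically, and h 0 is
     the integral of [r] against [k]. *)
  pose h := conv (prodf (aff_factors true 0 k')) r.
  have tk'' : test_factors (aff_factors true 0 k') by exact: test_factors_aff.
  have Lh : L2per b h by exact: conv_prodf_L2per.
  have : ip b h h = 0.
    rewrite -(conv_adjoint_prodf tk' Lr Lh); apply: hp'; split; first exact: conv_prodf_L2per.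
    exact: corr_conv_cvg.
  have ch : continuous h by apply: conv_prodf_continuous.
  move=> /(continuous_ip_eq0 ch Lh) /(_ 0) <-; apply: eq_Rintegral => x _.
  by rewrite !prodf_aff !aff3_1 !sub0r subr0 opprK.
have pe t : corr p q t = corr p' q t.
  have [lp _] := Lp; have [lp' _] := Lp'; have [lq _] := L2per_shift t Lq.
  apply: eq_ip => //; apply: filterS r0 => x /eqP.
  by rewrite -[r x]/(p x - p' x) subr_eq0 => /eqP.
by rewrite pe; under eq_fun do rewrite pe.
Qed.

End convolution.

(** * Weak derivatives *)

Section weak_derivatives.
Variable R : realType.
Local Notation E := 'cV[R]_3.
Local Notation mu := (@lebesgue3 R).
Variable b : 3.-tuple E.
Hypothesis hb : free b.
Implicit Types f g : E -> R.

Lemma L2per0 : L2per b (fun=> 0).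
Proof. exact: L2per_cst. Qed.

Lemma ip_suml (I : Type) (s : seq I) (F : I -> E -> R) g : (forall i, L2loc (F i)) -> L2loc g ->
  ip b (fun y => \sum_(i <- s) F i y) g = \sum_(i <- s) ip b (F i) g.
Proof.
move=> LF Lg; rewrite -(Rintegral_sum s (measurable_cell hb) (fun i => cell_mul_integrable hb (LF i) Lg)).1.
by apply: eq_Rintegral => y _; rewrite mulr_suml.
Qed.

(** The mollifiers have mass 1 and supports shrinking to 0, so the averages of [c] approximate c 0.
    Sequential continuity at the one point 0 suffices, which is all that is known of a
    correlation. *)
Lemma moll_bound (c : E -> R) K :
  (forall n, mu.-integrable setT (EFin \o (fun z => c z * prodf (moll_factors n) z))) ->
  (forall z : nat -> E, (forall n, `|z n| <= n.+1%:R^-1) -> c (z n) @[n --> \oo] --> c 0) ->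
  (forall n, `|\int[mu]_z (c z * prodf (moll_factors n) z)| <= K) -> `|c 0| <= K.
Proof.
move=> ic cc bc; rewrite leNgt; apply/negP => Kc.
have e0 : 0 < (`|c 0| - K) / 2 by rewrite divr_gt0// subr_gt0.
have [|n hn] := seq_eps (h := c) (y := 0) _ e0.
  by move=> z hz; apply: cc => n; rewrite -[z n]subr0.
set e := (_ / 2) in e0 hn.
pose phi := prodf (@moll_factors R n).
have iphi : mu.-integrable setT (EFin \o phi).
  have [M [r [r0 cphi _]]] := prodf_kernel (moll_test R n).
  exact: cbounded_integrable cphi.
have phi1 : \int[mu]_z phi z = 1 by rewrite /Rintegral integral_moll.
have := bc n; rewrite -/phi.
have -> : \int[mu]_z (c z * phi z) = c 0 - \int[mu]_z ((c 0 - c z) * phi z).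
  have E1 : \int[mu]_z (c 0 * phi z) = c 0 by rewrite RintegralZl// phi1 mulr1.
  rewrite -[X in X - _]E1 -RintegralB//.
  - by apply: eq_Rintegral => z _; ring.
  - by have := integrableZl measurableT (c 0) iphi; exact: eq_integrable.
  - have := integrableB measurableT (integrableZl measurableT (c 0) iphi) (ic n).
    by apply: eq_integrable => // z _; rewrite /= mulrBl.
have id : mu.-integrable setT (EFin \o (fun z => (c 0 - c z) * phi z)).
  have := integrableB measurableT (integrableZl measurableT (c 0) iphi) (ic n).
  by apply: eq_integrable => // z _; rewrite /= mulrBl.
have : `|\int[mu]_z ((c 0 - c z) * phi z)| <= e.
  apply: (le_trans (le_normr_Rintegral measurableT id)).
  have -> : e = \int[mu]_z (e * phi z) by rewrite RintegralZl// phi1 mulr1.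
  apply: le_Rintegral => //.
  - by have := integrable_norm id; exact: eq_integrable.
  - by have := integrableZl measurableT e iphi; exact: eq_integrable.
  move=> z _; rewrite normrM (ger0_norm (moll_ge0 n z)) -/(phi z).
  have [->|z0] := eqVneq (phi z) 0; first by rewrite !mulr0.
  rewrite ler_wpM2r ?moll_ge0// distrC; apply: hn; rewrite subr0.
  by apply: norm_cube; [rewrite invr_ge0|exact: moll_out].
move=> h1 h2; have := lerB_normD (c 0) (- \int[mu]_z ((c 0 - c z) * phi z)).
rewrite normrN => h3; move: h1 h2 h3 Kc; rewrite /e; lra.
Qed.

Lemma corr_cvg3 (m P : 'I_3 -> E -> R) (z : nat -> E) :
  (forall j, L2per b (m j)) -> (forall j, L2per b (P j)) ->
  (forall n, `|z n| <= n.+1%:R^-1) ->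
  \sum_j corr b (m j) (P j) (z n) @[n --> \oo] --> \sum_j corr b (m j) (P j) 0.
Proof.
move=> Lm LP hz; rewrite !big_ord_recl big_ord0.
under eq_fun do rewrite !big_ord_recl big_ord0.
apply: cvgD; first exact: corr_cvg.
apply: cvgD; first exact: corr_cvg.
by apply: cvgD; [exact: corr_cvg|exact: cvg_cst].
Qed.

(* z |-> \sum_j corr (m j) (P j) z has zero integral against every test function
   and is continuous at 0, hence it vanishes there. *)
Lemma div_free_orth (m P : 'I_3 -> E -> R) p :
  (forall j, L2per b (m j)) -> (forall j, L2per b (P j)) -> L2per b p ->
  (forall j, weak_partial j p (P j)) ->
  (forall k, test_factors k -> \sum_j \int[mu]_x (m j x * partial j (prodf k) x) = 0) ->
  \sum_j ip b (m j) (P j) = 0.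
Proof.
move=> Lm LP Lp wP dm.
pose c z := \sum_j corr b (m j) (P j) z.
have -> : \sum_j ip b (m j) (P j) = c 0.
  apply: eq_bigr => j _; rewrite /corr; congr (ip b _ _).
  by apply/funext => y; rewrite addr0.
have cs k : test_factors k -> \int[mu]_z (c z * prodf k z) = 0 /\
    mu.-integrable setT (EFin \o (fun z => c z * prodf k z)).
  move=> tk; have [M [r [r0 ck _]]] := prodf_kernel tk.
  have H j := corr_conv hb r0 ck (Lm j) (LP j).
  have [E1 i1] := Rintegral_sum (index_enum 'I_3) measurableT (fun j => (H j).1).
  have cE : (fun z => c z * prodf k z) = (fun z => \sum_j corr b (m j) (P j) z * prodf k z).
    by apply/funext => z; rewrite mulr_suml.
  split; last by rewrite cE.
  rewrite cE E1.
  have sk : smooth_factors k by case: tk.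
  (* The derivative passes from [p] to [k], then the convolution passes from [p] to [m j]. At each y
     the sum over j is then the divergence of [m] tested against a reflected translate of [k], which
     is 0. *)
  transitivity (\sum_j - ip b (conv (prodf (aff_factors true 0 (prodf_d j k))) (m j)) p).
    apply: eq_bigr => j _; rewrite (H j).2 ipC.
    have tkj := test_factors_d j tk.
    have L1 : L2per b (conv (prodf (prodf_d j k)) p) by exact: conv_prodf_L2per.
    rewrite [in RHS]ipC -(conv_adjoint_prodf hb tkj (Lm j) Lp) [in RHS]ipC.
    rewrite (_ : conv (prodf k) (P j) = -1 *: conv (prodf (prodf_d j k)) p + (fun=> 0)).
      rewrite ip_lincomb//; last exact: L2per0.
      rewrite [X in _ + X]/ip /cell_int.
      under [X in _ + X]eq_Rintegral do rewrite mul0r.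
      by rewrite Rintegral_cst ?mul0r ?addr0 ?mulN1r//; exact: measurable_cell.
    apply/funext => y; rewrite -[RHS]/(-1 * conv (prodf (prodf_d j k)) p y + 0).
    by rewrite (conv_weak_partial y (wP j) tk); ring.
  rewrite sumrN -ip_suml; last 2 first.
  - move=> j; apply: (proj1 (_ : L2per b _)); apply: conv_prodf_L2per => //.
    by apply: test_factors_aff; exact: test_factors_d.
  - by case: Lp.
  rewrite (_ : (fun _ => _) = (fun=> 0)).
    rewrite /ip /cell_int; under eq_Rintegral do rewrite mul0r.
    by rewrite Rintegral_cst ?mul0r ?oppr0//; exact: measurable_cell.
  apply/funext => y; have ta := test_factors_aff true y tk.
  have d0 : \sum_j (- (\int[mu]_x (m j x * partial j (prodf (aff_factors true y k)) x))) = 0.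
    by rewrite sumrN dm// oppr0.
  rewrite -[RHS]d0.
  apply: eq_bigr => j _; rewrite /conv.
  have i2 : mu.-integrable setT (EFin \o (fun x => m j x * partial j (prodf (aff_factors true y k)) x)).
    have [M' [r' [r0' ck' _]]] := prodf_kernel (test_factors_d j ta).
    rewrite partial_prodf; last by case: ta.
    by apply: (cbounded_mul_integrable ck'); apply: L2loc_integrable; case: (Lm j).
  rewrite -mulN1r -RintegralZl//.
  apply: eq_Rintegral => x _.
  rewrite partial_prodf_aff// prodf_aff !aff3_1 -partial_prodf// sub0r opprB expr1; ring.
suff : `|c 0| <= 0 by rewrite normr_le0 => /eqP.
apply: moll_bound => [n|z hz|n].
- exact: (cs _ (moll_test R n)).2.
- exact: corr_cvg3.
- by rewrite (cs _ (moll_test R n)).1 normr0.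
Qed.

Lemma sum_coord_shift (a : 'I_3 -> R) j (x : E) t :
  \sum_k a k * (x - t *: delta_mx j 0 : E) k 0 = \sum_k a k * x k 0 - t * a j.
Proof.
rewrite (eq_bigr (fun k => a k * x k 0 - (k == j)%:R * (t * a k))).
  rewrite sumrB; congr (_ - _); rewrite (bigD1 j)//= eqxx mul1r big1 ?addr0// => k /negbTE ->.
  by rewrite mul0r.
by move=> k _; rewrite !mxE eqxx andbT; ring.
Qed.

Lemma affine_loc_bounded (a : 'I_3 -> R) c : loc_bounded (fun y : E => c + \sum_k a k * y k 0).
Proof.
move=> r; exists (`|c| + \sum_k `|a k| * r) => x xr.
apply: (le_trans (ler_normD _ _)); rewrite lerD2l.
apply: (le_trans (ler_norm_sum _ _ _)); apply: ler_sum => k _.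
by rewrite normrM ler_wpM2l// ltW.
Qed.

Lemma measurable_affine (a : 'I_3 -> R) c : measurable_fun [set: E] (fun y : E => c + \sum_k a k * y k 0).
Proof.
apply: measurable_funD => //; apply: measurable_sum => k; apply: measurable_funM => //.
exact: measurable_coord.
Qed.

Lemma weak_partial_affine (a : 'I_3 -> R) c j :
  weak_partial j (fun y : E => c + \sum_k a k * y k 0) (fun=> a j).
Proof.
have dq x n : n.+1%:R * ((c + \sum_k a k * (x - n.+1%:R^-1 *: delta_mx j 0 : E) k 0) -
   (c + \sum_k a k * x k 0)) = - a j.
  rewrite sum_coord_shift; have : n.+1%:R != 0 :> R by rewrite pnatr_eq0.
  by move: (n.+1%:R) => t t0; field.
apply: classical_weak_partial => //.
- exact: measurable_affine.
- exact: affine_loc_bounded.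
- by move=> r; exists `|- a j| => x n _; rewrite dq.
- by move=> x; under eq_fun do rewrite dq; exact: cvg_cst.
Qed.

Lemma test_partial_int0 j (phi : E -> R) : test_function phi -> \int[mu]_x partial j phi x = 0.
Proof.
move=> tphi; have := weak_partial_affine (fun=> 0) 1 j tphi.
under [X in _ = - X]eq_Rintegral do rewrite mul0r.
rewrite Rintegral_cst// mul0r oppr0 => <-; apply: eq_Rintegral => x _.
by rewrite big1 ?addr0 ?mul1r// => k _; rewrite mul0r.
Qed.

Lemma sum_delta (j : 'I_3) (F : 'I_3 -> R) : \sum_l (l == j)%:R * F l = F j.
Proof.
by rewrite (bigD1 j)//= eqxx mul1r big1 ?addr0// => k /negbTE ->; rewrite mul0r.
Qed.

Lemma ip_scale (a : R) f g : L2per b f -> L2per b g -> ip b (a *: f) g = a * ip b f g.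
Proof.
move=> [Lf _] [Lg _]; rewrite /ip /cell_int -RintegralZl//; last 2 first.
- exact: measurable_cell.
- exact: cell_mul_integrable.
by apply: eq_Rintegral => x _; rewrite -[(a *: f) x]/(a * f x) mulrA.
Qed.

Lemma L2per_scale (a : R) f : L2per b f -> L2per b (a *: f).
Proof. by move=> Lf; rewrite -[a *: f]addr0; apply: L2per_lincomb => //; exact: L2per0. Qed.

(** The constant field e_j is divergence free, because derivatives of test functions integrate to 0;
    orthogonality to gradients does the rest. *)
Lemma grad_mean0 (P : 'I_3 -> E -> R) p j : L2per b p -> (forall j, L2per b (P j)) ->
  (forall j, weak_partial j p (P j)) -> cell_int b (P j) = 0.
Proof.
move=> Lp LP wP; pose m (l : 'I_3) : E -> R := (l == j)%:R *: (fun=> 1).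
have Lm l : L2per b (m l) by apply: L2per_scale; exact: L2per_cst.
have div0 k : test_factors k -> \sum_l (\int[mu]_x (m l x * partial l (prodf k) x)) = 0.
  move=> tk; rewrite (eq_bigr (fun l => (l == j)%:R * \int[mu]_x partial l (prodf k) x)).
    by rewrite sum_delta test_partial_int0//; exact: test_factors_test.
  move=> l _; have [M [r [r0 c]]] := test_cbounded (test_partial l (test_factors_test tk)).
  rewrite -RintegralZl//; last exact: cbounded_integrable c.
  by apply: eq_Rintegral => x _; rewrite -[m l x]/((l == j)%:R * 1) mulr1.
have := div_free_orth Lm LP Lp wP div0.
rewrite (eq_bigr (fun l => (l == j)%:R * cell_int b (P l))) ?sum_delta// => l _.
rewrite ip_scale//; last exact: L2per_cst.
by congr (_ * _); apply: eq_Rintegral => x _; rewrite mul1r.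
Qed.

Lemma Rintegral_lincombM a c f g phi M r : 0 < r -> cbounded M r phi -> L2loc f -> L2loc g ->
  \int[mu]_x ((a *: f + c *: g) x * phi x) =
  a * \int[mu]_x (f x * phi x) + c * \int[mu]_x (g x * phi x).
Proof.
move=> r0 cphi lf lg.
have i1 := cbounded_mul_integrable cphi (L2loc_integrable r lf).
have i2 := cbounded_mul_integrable cphi (L2loc_integrable r lg).
rewrite -!RintegralZl// -RintegralD//.
- by apply: eq_Rintegral => x _; rewrite -[(_ + _) x]/(a * f x + c * g x); ring.
- by have := integrableZl measurableT a i1; exact: eq_integrable.
- by have := integrableZl measurableT c i2; exact: eq_integrable.
Qed.

(* The field (W j i) e_j - (W j j) e_i is divergence free. *)
Lemma Korn_swap (v : 'I_3 -> E -> R) (W : 'I_3 -> 'I_3 -> E -> R) i j :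
  (forall i, L2per b (v i)) -> (forall i j, L2per b (W i j)) ->
  (forall i j, weak_partial j (v i) (W i j)) ->
  ip b (W i j) (W j i) = ip b (W i i) (W j j).
Proof.
move=> Lv LW wW.
pose m (l : 'I_3) : E -> R := (l == j)%:R *: W j i + (- (l == i)%:R) *: W j j.
have Lm l : L2per b (m l) by apply: L2per_lincomb => //; exact: L2per_scale.
(* Here d_j d_i v_j = d_i d_j v_j in the weak sense: both terms are moved onto [k], where second
   derivatives commute. *)
have div0 k : test_factors k -> \sum_l (\int[mu]_x (m l x * partial l (prodf k) x)) = 0.
  move=> tk; have sk : smooth_factors k by case: tk.
  have tp := test_partial _ (test_factors_test tk).
  rewrite (eq_bigr (fun l => (l == j)%:R * \int[mu]_x (W j i x * partial l (prodf k) x) -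
    (l == i)%:R * \int[mu]_x (W j j x * partial l (prodf k) x))).
    rewrite sumrB !sum_delta.
    have := wW j i _ (tp j); have := wW j j _ (tp i).
    by rewrite partial_prodfC// => -> /eqP; rewrite eqr_opp => /eqP ->; rewrite subrr.
  move=> l _; have [M [r [r0 c]]] := test_cbounded (tp l).
  have [l1 _] := LW j i; have [l2 _] := LW j j.
  by rewrite (Rintegral_lincombM _ _ r0 c l1 l2) mulNr.
have := div_free_orth Lm (LW i) (Lv i) (wW i) div0.
rewrite (eq_bigr (fun l => (l == j)%:R * ip b (W j i) (W i l) - (l == i)%:R * ip b (W j j) (W i l))).
  by rewrite sumrB !sum_delta ipC => /eqP; rewrite subr_eq0 ipC => /eqP ->; rewrite ipC.
by move=> l _; rewrite ip_lincomb ?ip_scale// ?mulNr//; exact: L2per_scale.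
Qed.

(** Translating the variable puts the difference on the mollifier, and a difference of mollifiers is
    the derivative of a tent. *)
Lemma tent_difference (F G : E -> R) n j t : 0 <= t ->
  let e : E := t *: delta_mx j 0 in let phi := prodf (moll_factors n) in
  (forall z, F (z + e) = G z) ->
  mu.-integrable setT (EFin \o (fun z => F z * phi z)) ->
  mu.-integrable setT (EFin \o (fun z => G z * phi z)) ->
  mu.-integrable setT (EFin \o (fun z => F z * prodf (aff_factors false (- e) (moll_factors n)) z)) ->
  \int[mu]_z ((F z - F (z + e)) * phi z) =
  \int[mu]_z (F z * prodf (prodf_d j (tent_factors n j t)) z).
Proof.
move=> t0 e phi FG i1 i2 i3.
transitivity (\int[mu]_z (F z * phi z) - \int[mu]_z (G z * phi z)).
  rewrite -(RintegralB measurableT i1 i2).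
  by apply: eq_Rintegral => z _; rewrite FG mulrBl.
rewrite (_ : \int[mu]_z (G z * phi z) =
  \int[mu]_z (F z * prodf (aff_factors false (- e) (moll_factors n)) z)).
  rewrite -(RintegralB measurableT i1 i3); apply: eq_Rintegral => z _.
  rewrite -partial_prodf; last exact: smooth_tent.
  have h1 : partial j (prodf (tent_factors n j t)) z = phi z - phi (z - e) by exact: partial_tent.
  have h2 : prodf (aff_factors false (- e) (moll_factors n)) z = phi (z - e).
    by rewrite prodf_aff aff3_0.
  exact: (etrans (f_equal (fun u => F z * phi z - F z * u) h2)
    (etrans (esym (mulrBr _ _ _)) (f_equal _ (esym h1)))).
rewrite -[RHS](Rintegral_shift e); last by case/integrableP: i3 => /measurable_EFinP.
by apply: eq_Rintegral => z _; rewrite FG prodf_aff aff3_0 addrK.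
Qed.

(** A fundamental theorem of calculus in weak form: tested against a mollifier, the difference
    equals minus the integral of corr g w against a tent. Cauchy-Schwarz bounds corr g w at every
    shift, and the tent has mass at most t + 1. *)
Lemma corr_translate g v w j t : L2per b g -> L2per b v -> L2per b w ->
  weak_partial j v w -> 0 <= t ->
  `|corr b g v 0 - corr b g v (t *: delta_mx j 0)| <=
  (t + 1) * Num.sqrt (ip b g g * ip b w w).
Proof.
move=> Lg Lv Lw wvw t0; pose e : E := t *: delta_mx j 0.
pose N := Num.sqrt (ip b g g * ip b w w).
pose c z := corr b g v z - corr b g v (z + e).
have ce z : corr b g v (z + e) = corr b g (fun y => v (y + e)) z.
  by rewrite /corr; congr (ip b _ _); apply/funext => y; rewrite addrA.
have Lve : L2per b (fun y => v (y + e)) by exact: L2per_shift.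
have c0 : corr b g v 0 - corr b g v (t *: delta_mx j 0) = c 0 by rewrite /c add0r.
rewrite c0; apply: moll_bound => [n|z hz|n].
- have [M [r [r0 cphi _]]] := prodf_kernel (moll_test R n).
  have [i1 _] := corr_conv hb r0 cphi Lg Lv; have [i2 _] := corr_conv hb r0 cphi Lg Lve.
  have := integrableB measurableT i1 i2; apply: eq_integrable => // z _.
  by rewrite /= /c ce mulrBl EFinB.
- rewrite /c ce; under eq_fun do rewrite ce.
  by apply: cvgB; exact: corr_cvg.
have tm := moll_test R n.
have [M [r [r0 cphi _]]] := prodf_kernel tm.
have [i1 _] := corr_conv hb r0 cphi Lg Lv; have [i2 _] := corr_conv hb r0 cphi Lg Lve.
have tms := test_factors_aff false (- e) tm.
have [M' [r' [r0' cphi' _]]] := prodf_kernel tms.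
have [i3 _] := corr_conv hb r0' cphi' Lg Lv.
have tt := tent_test n j t0.
have [M1 [r1 [r10 c1 _]]] := prodf_kernel tt.
have [M2 [r2 [r20 c2 _]]] := prodf_kernel (test_factors_d j tt).
rewrite (tent_difference t0 ce i1 i2 i3).
have [i4 ->] := corr_conv hb r20 c2 Lg Lv.
rewrite (_ : conv _ v = -1 *: conv (prodf (tent_factors n j t)) w); last first.
  apply/funext => y; rewrite (conv_weak_partial y wvw tt).
  by rewrite -[RHS]/(-1 * conv (prodf (tent_factors n j t)) w y) mulN1r.
have Lc : L2per b (conv (prodf (tent_factors n j t)) w) by exact: conv_prodf_L2per.
rewrite ipC ip_scale// ipC mulN1r normrN.
have [i5 <-] := corr_conv hb r10 c1 Lg Lw.
have it := cbounded_integrable c1.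
apply: (le_trans (le_normr_Rintegral measurableT i5)).
apply: (@le_trans _ _ (\int[mu]_z (N * prodf (tent_factors n j t) z))).
  apply: le_Rintegral => //.
  - by have := integrable_norm i5; exact: eq_integrable.
  - by have := integrableZl measurableT N it; exact: eq_integrable.
  move=> z _; rewrite normrM [X in _ * X]ger0_norm; last by apply: prodr_ge0 => i _; exact: tent_ge0.
  apply: ler_wpM2r; first by apply: prodr_ge0 => i _; exact: tent_ge0.
  rewrite -ler_sqr ?nnegrE ?sqrtr_ge0// real_normK ?num_real// sqr_sqrtr ?mulr_ge0 ?ip_ge0//.
  exact: corr_bound.
rewrite RintegralZl// mulrC ler_wpM2r ?sqrtr_ge0//.
rewrite -lee_fin fineK ?integral_tent//.
exact: integrable_fin_num.
Qed.

End weak_derivatives.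

(** * Poincare's inequality by translation *)

Section Poincare.
Variable R : realType.
Local Notation E := 'cV[R]_3.
Local Notation mu := (@lebesgue3 R).
Variable b : 3.-tuple E.
Hypothesis hb : free b.
Implicit Types f g v w : E -> R.

Definition incr v (z : E) : E -> R := -1 *: v + (fun y => v (y + z)).

Lemma incrE v z y : incr v z y = v (y + z) - v y.
Proof. by rewrite -[incr v z y]/(-1 * v y + v (y + z)) mulN1r addrC. Qed.

Lemma L2per_incr v z : L2per b v -> L2per b (incr v z).
Proof. by move=> Lv; apply: L2per_lincomb => //; exact: L2per_shift. Qed.

Lemma ip_lincombr (a : R) f g h : L2per b f -> L2per b g -> L2per b h ->
  ip b h (a *: f + g) = a * ip b h f + ip b h g.
Proof. by move=> Lf Lg Lh; rewrite ipC ip_lincomb// (ipC b f) (ipC b g). Qed.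

Lemma ip_corr0 f g : ip b f g = corr b f g 0.
Proof. by rewrite /corr; congr (ip b _ _); apply/funext => y; rewrite addr0. Qed.

Lemma ip_incr g v z : L2per b g -> L2per b v ->
  ip b g (incr v z) = corr b g v z - corr b g v 0.
Proof.
move=> Lg Lv; rewrite ip_lincombr//; last exact: L2per_shift.
by rewrite -/(corr b g v z) ip_corr0 mulN1r addrC.
Qed.

Lemma incr_norm v z : L2per b v ->
  ip b (incr v z) (incr v z) = 2 * ip b v v - 2 * corr b v v z.
Proof.
move=> Lv; have Lz : L2per b (fun y => v (y + z)) by exact: L2per_shift.
rewrite ip_incr//; last exact: L2per_incr.
rewrite !corr_lin// -ip_corr0; have -> : corr b v v z = ip b v (fun y => v (y + z)) by [].
have -> : corr b (fun y => v (y + z)) v z = ip b v v by exact: ip_shift.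
have -> : corr b (fun y => v (y + z)) v 0 = ip b v (fun y => v (y + z)) by rewrite -ip_corr0 ipC.
by ring.
Qed.

Lemma ip_sqrD f g : L2per b f -> L2per b g ->
  ip b (f + g) (f + g) <= 2 * ip b f f + 2 * ip b g g.
Proof.
move=> Lf Lg; have := ip_ge0 b (-1 *: f + g); rewrite -[f in f + g]scale1r.
rewrite !ip_lincomb ?ip_lincombr//; try exact: L2per_lincomb.
by rewrite (ipC b g f); lra.
Qed.

Lemma ip_oppr f : ip b (- f) (- f) = ip b f f.
Proof. by apply: eq_Rintegral => y _; rewrite -[(- f) y]/(- f y) mulrNN. Qed.

(** Duality: choosing the increment itself as [g] in [corr_translate] gives |d|^2 <= (t + 1) |d|
    |w|. A negative t reduces to a positive one, since the increment by -e is, up to sign, a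
    translate of the increment by e. *)
Lemma incr_axis v w j t : L2per b v -> L2per b w -> weak_partial j v w ->
  ip b (incr v (t *: delta_mx j 0)) (incr v (t *: delta_mx j 0)) <=
  (`|t| + 1) ^+ 2 * ip b w w.
Proof.
move=> Lv Lw wvw; wlog t0 : t / 0 <= t => [H|].
  have [|t0] := leP 0 t; first exact: H.
  have := H (- t); rewrite oppr_ge0 (ltW t0) normrN => /(_ isT).
  set e' : E := - t *: _; set e : E := t *: _; apply: le_trans.
  have ee : e' = - e by rewrite /e' scaleNr.
  rewrite -(ip_shift hb (- e) (L2per_incr e Lv) (L2per_incr e Lv)) -(ip_oppr (incr v e')).
  rewrite le_eqVlt; apply/orP; left; apply/eqP; congr (ip b _ _); apply/funext => y.
    by rewrite -[RHS]/(- incr v e' y) !incrE ee subrK; ring.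
  by rewrite -[RHS]/(- incr v e' y) !incrE ee subrK; ring.
pose e : E := t *: delta_mx j 0; rewrite -/e.
set d := incr v e; have Ld : L2per b d by exact: L2per_incr.
have := corr_translate hb Ld Lv Lw wvw t0.
rewrite distrC -ip_incr// -/d -/e ger0_norm ?ip_ge0// (ger0_norm t0).
set G := ip b d d; set W := ip b w w => h.
have G0 : 0 <= G by exact: ip_ge0. have W0 : 0 <= W by exact: ip_ge0.
have [->|G1] := eqVneq G 0; first by rewrite mulr_ge0 ?sqr_ge0.
have Gp : 0 < G by rewrite lt_neqAle eq_sym G1.
rewrite -(ler_pM2l Gp) -expr2.
have : G ^+ 2 <= ((t + 1) * Num.sqrt (G * W)) ^+ 2.
  by rewrite ler_sqr ?nnegrE// mulr_ge0 ?sqrtr_ge0// addr_ge0.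
by rewrite exprMn sqr_sqrtr ?mulr_ge0// mulrCA.
Qed.

Lemma incrD v a c : L2per b v ->
  ip b (incr v (a + c)) (incr v (a + c)) <=
  2 * ip b (incr v a) (incr v a) + 2 * ip b (incr v c) (incr v c).
Proof.
move=> Lv; have La := L2per_incr a Lv; have Lc := L2per_incr c Lv.
rewrite -(ip_shift hb c La La).
have -> : incr v (a + c) = (fun y => incr v a (y + c)) + incr v c.
  apply/funext => y; rewrite -[RHS]/(incr v a (y + c) + incr v c y) !incrE.
  by rewrite (addrC a) addrA; ring.
by apply: ip_sqrD => //; exact: L2per_shift.
Qed.

(** The shift is made one axis at a time; two uses of [incrD] produce the factor 4. *)
Lemma incr_cube v (w : 'I_3 -> E -> R) s z : L2per b v -> (forall j, L2per b (w j)) ->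
  (forall j, weak_partial j v (w j)) -> cube s z ->
  ip b (incr v z) (incr v z) <= 4 * (s + 1) ^+ 2 * \sum_j ip b (w j) (w j).
Proof.
move=> Lv Lw wv zs.
have ax j : ip b (incr v (z j 0 *: delta_mx j 0)) (incr v (z j 0 *: delta_mx j 0)) <=
    (s + 1) ^+ 2 * ip b (w j) (w j).
  apply: (le_trans (incr_axis (z j 0) Lv (Lw j) (wv j))).
  have z1 := zs j; have z0 := normr_ge0 (z j 0).
  apply: ler_wpM2r; first exact: ip_ge0.
  by rewrite ler_sqr ?nnegrE ?lerD2r ?(ltW z1)//; move: z0 z1; lra.
have W0 j : 0 <= (s + 1) ^+ 2 * ip b (w j) (w j) by rewrite mulr_ge0 ?sqr_ge0 ?ip_ge0.
have zE : z = z 0 0 *: delta_mx 0 0 + z 1 0 *: delta_mx 1 0 + z 2 0 *: delta_mx 2 0.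
  rewrite {1}[z]matrix_sum_delta.
  under eq_bigr do rewrite big_ord1.
  rewrite !big_ord_recl big_ord0 addr0 addrA.
  by congr (_ + _ + _); congr (z _ _ *: delta_mx _ _); exact: val_inj.
rewrite zE; apply: (le_trans (incrD _ _ Lv)).
have := incrD (z 0 0 *: delta_mx 0 0) (z 1 0 *: delta_mx 1 0) Lv.
have := ax 0; have := ax 1; have := ax 2; have := W0 0; have := W0 1; have := W0 2.
rewrite -mulrA mulr_sumr !big_ord_recl big_ord0 addr0 -/(ord0 : 'I_3).
have -> : lift ord0 (ord0 : 'I_2) = 1 :> 'I_3 by exact: val_inj.
have -> : lift ord0 (lift ord0 (ord0 : 'I_1)) = 2 :> 'I_3 by exact: val_inj.
move: (ip b (incr v (_ + _)) _) (ip b (incr v (z 0 0 *: _)) _)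
  (ip b (incr v (z 1 0 *: _)) _) (ip b (incr v (z 2 0 *: _)) _)
  (_ * ip b (w 0) _) (_ * ip b (w 1) _) (_ * ip b (w 2) _) => *.
by lra.
Qed.

(* Integrating corr v v z >= |v|^2 - (1/2)|incr v z|^2 over the cell, where the
   integral of corr v v vanishes. *)
Lemma Poincare : exists2 K, 0 <= K & forall v (w : 'I_3 -> E -> R),
  L2per b v -> (forall j, L2per b (w j)) -> (forall j, weak_partial j v (w j)) ->
  cell_int b v = 0 -> ip b v v <= K * \sum_j ip b (w j) (w j).
Proof.
have [r hr] := cell_cube b; pose s := `|r| + 1.
have s0 : 0 < s by rewrite ltr_wpDl.
have hs : cell b `<=` cube s.
  apply: (subset_trans hr); apply: cubeS; rewrite /s.
  by apply: (le_trans (ler_norm r)); rewrite lerDl.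
have mc := measurable_cell hb.
exists (2 * (s + 1) ^+ 2) => [|v w Lv Lw wv v0]; first by rewrite mulr_ge0 ?sqr_ge0.
have cY : cbounded 1 s (\1_(cell b)).
  split; first exact: measurable_indic.
  move=> x; rewrite mul1r ger0_norm ?indic_ge0//; exact: indic_mono.
have [i1] := corr_conv hb s0 cY Lv Lv.
have lv : L2loc v by case: Lv.
(* This convolution with the indicator of the cell is the integral of [v] over a translated cell,
   which is 0 by periodicity and zero mean. *)
rewrite (_ : conv _ v = fun=> 0); last first.
  apply/funext => y; rewrite (conv_shiftE cY)// -[RHS]v0 -(cell_int_shift hb y); last 2 first.
  - exact: L2loc_measurable.
  - by case: Lv.
  rewrite /cell_int /Rintegral -(integral_indicM (fun z => v (z + y)) mc); congr fine.
  by apply: eq_integral => z _; rewrite mulrC.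
rewrite [X in _ = X]/ip /cell_int; under [X in _ = X]eq_Rintegral do rewrite mulr0.
rewrite Rintegral_cst// mul0r => c0.
(* Were c = |v|^2 - 2 (s + 1)^2 W positive, [incr_norm] and [incr_cube] would give corr v v >= c on
   the cell, so that its integral there would be positive instead of 0. *)
set W := \sum_j _; rewrite -subr_le0 leNgt; apply/negP => h.
set c := _ - _ in h.
have : 0 < c * cell_vol b by rewrite mulr_gt0// cell_vol_gt0.
rewrite -(Rintegral_cst _ mc) -c0 ltNge => /negP; apply.
have i0 : mu.-integrable (cell b) (EFin \o cst c).
  by apply: measurable_bounded_integrable => //; [exact: cell_fin|exact: bounded_cst].
have -> : \int[mu]_(z in cell b) cst c z = \int[mu]_z (\1_(cell b) z * c).
  by rewrite /Rintegral integral_indicM.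
apply: le_Rintegral => //.
  have := integrableZr measurableT c (cbounded_integrable cY).
  by apply: eq_integrable.
move=> z _; rewrite mulrC indicE; have [zY|_] := boolP (z \in cell b); last by rewrite !mulr0.
rewrite !mulr1 /c -/W; move: zY; rewrite inE => /hs zs.
have := incr_cube Lv Lw wv zs; rewrite incr_norm// -/W.
by rewrite -!mulrA; lra.
Qed.

End Poincare.

(** * Uniqueness, periodicity and limits of weak gradients *)

Section weak_gradients.
Variable R : realType.
Local Notation E := 'cV[R]_3.
Local Notation mu := (@lebesgue3 R).
Implicit Types f g v w : E -> R.

Lemma ord3P (P : 'I_3 -> Prop) : P 0 -> P 1 -> P 2 -> forall i, P i.
Proof.
move=> P0 P1 P2 [[|[|[|//]]] hi].
- by rewrite (_ : Ordinal hi = 0)//; exact: val_inj.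
- by rewrite (_ : Ordinal hi = 1)//; exact: val_inj.
- by rewrite (_ : Ordinal hi = 2)//; exact: val_inj.
Qed.

Lemma ae_ord3 (P : 'I_3 -> E -> Prop) : (forall i, {ae mu, forall y, P i y}) ->
  {ae mu, forall y, forall i, P i y}.
Proof.
move=> h; apply: filterS3 (h 0) (h 1) (h 2) => y h0 h1 h2.
exact: (@ord3P (fun i => P i y)).
Qed.

Lemma test_mul_integrable f (phi : E -> R) : L2loc f -> test_function phi ->
  mu.-integrable setT (EFin \o (fun x => f x * phi x)).
Proof.
move=> lf tphi; have [M [r [r0 c]]] := test_cbounded tphi.
by apply: (cbounded_mul_integrable c); exact: L2loc_integrable.
Qed.

Lemma prod_weak_partial_unique w w' : L2loc w -> L2loc w' ->
  (forall k, test_factors k -> \int[mu]_x (w x * prodf k x) = \int[mu]_x (w' x * prodf k x)) ->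
  {ae mu, forall x, w x = w' x}.
Proof.
move=> lw lw' h; have Lsub : L2loc (fun x => -1 * w' x + w x) by exact: L2loc_lin.
have : {ae mu, forall x, -1 * w' x + w x = 0}.
  apply: fundamental_lemma; first exact: L2loc_measurable.
    by move=> r; exact: L2loc_integrable.
  move=> k tk; have tt := test_factors_test tk.
  have := h k tk => /eqP; rewrite -subr_eq0.
  rewrite -(RintegralB measurableT (test_mul_integrable lw tt) (test_mul_integrable lw' tt)) => /eqP <-.
  by apply: eq_Rintegral => x _; ring.
by apply: filterS => x h0; apply/eqP; rewrite -subr_eq0 -h0; apply/eqP; ring.
Qed.

Lemma weak_partial_unique j f w w' : L2loc w -> L2loc w' ->
  weak_partial j f w -> weak_partial j f w' -> {ae mu, forall x, w x = w' x}.
Proof.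
move=> lw lw' hw hw'; apply: prod_weak_partial_unique => // k tk.
have tt := test_factors_test tk.
by apply: oppr_inj; rewrite -hw// -hw'.
Qed.

Lemma weak_partial_lin j a f w g v : L2loc f -> L2loc w -> L2loc g -> L2loc v ->
  weak_partial j f w -> weak_partial j g v ->
  weak_partial j (fun x => a * f x + g x) (fun x => a * w x + v x).
Proof.
move=> lf lw lg lv hf hg phi tphi.
have tp := test_partial j tphi.
have L f' g' (psi : E -> R) : L2loc f' -> L2loc g' -> test_function psi ->
    \int[mu]_x ((a * f' x + g' x) * psi x) = a * \int[mu]_x (f' x * psi x) + \int[mu]_x (g' x * psi x).
  move=> lf' lg' tpsi.
  have i1 := test_mul_integrable lf' tpsi; have i2 := test_mul_integrable lg' tpsi.
  rewrite -(RintegralZl a measurableT i1) -RintegralD//.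
  - by apply: eq_Rintegral => x _; ring.
  - by have := integrableZl measurableT a i1; exact: eq_integrable.
by rewrite !L// hf// hg//; ring.
Qed.


(** [grad] is a chosen weak gradient; this allows any concrete one to stand in for it, up to a null
    set. *)
Lemma weak_gradient_ae_grad (u : E -> E) (W : E -> 'M[R]_3) : weak_gradient u W ->
  weak_gradient u (grad u) /\ {ae mu, forall y, grad u y = W y}.
Proof.
move=> hW; have hG : weak_gradient u (grad u) by apply: (xgetPex _ (ex_intro _ W hW)).
split=> //; have : {ae mu, forall y, forall i j, grad u y i j = W y i j}.
  apply: ae_ord3 => i; apply: ae_ord3 => j.
  have [l1 w1] := hG i j; have [l2 w2] := hW i j.
  exact: weak_partial_unique w1 w2.
by apply: filterS => y h; apply/matrixP => i j.
Qed.

Variable b : 3.-tuple E.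
Hypothesis hb : free b.

(** A lattice translate of [w] is again a weak derivative of [f], so uniqueness applies. The
    definition of [H1per] asks for periodicity of the field only, and this lemma supplies that of
    its gradient. *)
Lemma weak_partial_periodic j f w : L2per b f -> L2loc w -> weak_partial j f w -> L2per b w.
Proof.
move=> [lf pf] lw hw; split=> // a la.
have lwa := L2loc_shift a lw.
apply: prod_weak_partial_unique => // k tk.
have ta := test_factors_aff false (- a) tk; have tt := test_factors_test ta.
have sk : smooth_factors k by case: tk.
have I g (lg : L2loc g) k' (tk' : test_factors k') : measurable_fun [set: E] (fun x => g x * prodf k' x).
  by have /integrableP[/measurable_EFinP] := test_mul_integrable lg (test_factors_test tk').
transitivity (\int[mu]_x (w x * prodf (aff_factors false (- a) k) x)).
  rewrite -[RHS](Rintegral_shift a); last exact: I.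
  by apply: eq_Rintegral => x _; rewrite prodf_aff aff3_0 addrK.
apply: oppr_inj; rewrite -hw// -hw; last exact: test_factors_test.
have mk : measurable_fun [set: E] (partial j (prodf k)).
  by have [M [r [r0 [m _]]]] := test_cbounded (test_partial j (test_factors_test tk)).
rewrite -[LHS](Rintegral_shift a); last first.
  by rewrite partial_prodf; [apply: I => //; exact: test_factors_d|case: ta].
apply: ae_eq_Rintegral => //.
- apply: measurable_funM; first by apply: L2loc_measurable; exact: L2loc_shift.
  rewrite partial_prodf; last by case: ta.
  have [M [r [r0 [m _] _]]] := prodf_kernel (test_factors_d j ta).
  by apply: (measurableT_comp m); exact: measurable_shiftv.
- by apply: measurable_funM => //; exact: L2loc_measurable.
- apply: filterS (pf a la) => x h _; rewrite h partial_prodf_aff// expr0 mul1r aff3_0.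
  by rewrite addrK.
Qed.

Lemma H1per_components (v : E -> E) : H1per b v ->
  [/\ weak_gradient v (grad v), forall i, L2per b (fun y => v y i 0)
    & forall i j, L2per b (fun y => grad v y i j)].
Proof.
move=> [[lv [W hW]] pv]; have [hG _] := weak_gradient_ae_grad hW.
have Lv i : L2per b (fun y => v y i 0).
  by split=> //; exact: (periodic_comp (fun x : E => x i 0) pv).
split=> // i j; have [l w] := hG i j.
exact: weak_partial_periodic (Lv i) l w.
Qed.

Lemma cube_cell_sqr r : exists2 K, 0 <= K & forall d, L2per b d ->
  \int[mu]_(x in cube r) (d x ^+ 2) <= K * ip b d d.
Proof.
have [K hK] := cube_cell_bound hb r; exists K%:R => // d [ld pd].
have mc := measurable_cell hb; have mq := @measurable_cube R r.
have i1 := integrable_fin_num mq (L2loc_cube r ld).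
have i2 := integrable_fin_num mc (cell_sqr_integrable hb ld).
have md : measurable_fun [set: E] (fun x => d x ^+ 2).
  by apply: measurable_funX; exact: L2loc_measurable.
rewrite -lee_fin fineK//.
have -> : ip b d d = \int[mu]_(x in cell b) (d x ^+ 2).
  by apply: eq_Rintegral => x _; rewrite expr2.
rewrite EFinM fineK//; apply: (hK (fun x => (d x ^+ 2)%:E)).
- exact/measurable_EFinP.
- by move=> x; rewrite lee_fin sqr_ge0.
- by move=> a la; apply: filterS (pd a la) => x ->.
Qed.

(** The inequality |d| <= e + d^2 / e, integrated over the support of [phi], plays the role of
    Cauchy-Schwarz; the free parameter e makes the bound small once |d|^2 <= e^2. It shows that
    pairings pass to L^2 limits. *)
Lemma test_pairing_bound (phi : E -> R) : test_function phi ->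
  exists2 C, 0 <= C & forall d e, L2per b d -> 0 < e ->
    `|\int[mu]_x (d x * phi x)| <= C * (e + ip b d d / e).
Proof.
move=> tphi; have [M [r [r0 c]]] := test_cbounded tphi.
have M0 := cbounded_M_ge0 c r0.
have [K K0 hK] := cube_cell_sqr r.
have mq := @measurable_cube R r.
pose V := fine (mu (cube r)).
have V0 : 0 <= V by rewrite fine_ge0.
exists (M * (V + K)) => [|d e Ld e0]; first by rewrite mulr_ge0// addr_ge0.
have ld : L2loc d by case: Ld.
have id := test_mul_integrable ld tphi.
have i2 := L2loc_cube r ld.
have ie : mu.-integrable (cube r) (EFin \o (fun x => e + e^-1 * d x ^+ 2)).
  have := integrableD mq (integrable_cst_cube e r) (integrableZl mq e^-1 i2).
  by apply: eq_integrable.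
have ie2 : mu.-integrable (cube r) (EFin \o (fun x => M * (e + e^-1 * d x ^+ 2))).
  by have := integrableZl mq M ie; exact: eq_integrable.
have EI (f : E -> R) : \int[mu]_x (\1_(cube r) x * f x) = \int[mu]_(x in cube r) f x.
  by rewrite /Rintegral integral_indicM.
apply: (@le_trans _ _ (\int[mu]_x (\1_(cube r) x * (M * (e + e^-1 * d x ^+ 2))))).
  apply: (le_trans (le_normr_Rintegral measurableT id)); apply: le_Rintegral => //.
  - by have := integrable_norm id; exact: eq_integrable.
  - move/(integrable_mkcond _ mq) : ie2; apply: eq_integrable => // x _.
    by rewrite restrict_EFin /= patchE indicE; case: ifPn; rewrite ?mul1r ?mul0r.
  move=> x _; rewrite normrM; have [_ /(_ x) h] := c.
  have h2 : `|d x| <= e + e^-1 * d x ^+ 2.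
    rewrite -(ler_pM2l e0) mulrDr mulrA mulfV ?gt_eqF// mul1r -real_normK ?num_real//.
    have := normr_ge0 (d x); move: `|d x| e e0 {ie ie2} => t e e0 t0; nra.
  apply: (le_trans (ler_wpM2l (normr_ge0 _) h)).
  rewrite mulrA mulrC ler_wpM2l ?indic_ge0// mulrC ler_wpM2l//.
rewrite EI RintegralZl// RintegralD//; last 2 first.
- exact: integrable_cst_cube.
- by have := integrableZl mq e^-1 i2; exact: eq_integrable.
rewrite Rintegral_cst// RintegralZl// -/V -mulrA ler_wpM2l//.
have h := hK d Ld; have q0 := ip_ge0 b d.
have e1 : 0 < e^-1 by rewrite invr_gt0.
have := ler_wpM2l (ltW e1) h.
have := mulr_ge0 V0 (mulr_ge0 q0 (ltW e1)); have := mulr_ge0 K0 (ltW e0).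
by rewrite mulrDl !mulrDr !(mulrC e^-1); lra.
Qed.

Lemma weak_partial_lim j (u w : nat -> E -> R) l m :
  (forall n, L2per b (u n)) -> (forall n, L2per b (w n)) -> L2per b l -> L2per b m ->
  (forall n, weak_partial j (u n) (w n)) ->
  (forall e, 0 < e -> exists N, forall n, (N <= n)%N ->
     ip b (fun y => u n y - l y) (fun y => u n y - l y) <= e) ->
  (forall e, 0 < e -> exists N, forall n, (N <= n)%N ->
     ip b (fun y => w n y - m y) (fun y => w n y - m y) <= e) ->
  weak_partial j l m.
Proof.
move=> Lu Lw Ll Lm huw hu hw phi tphi; have tp := test_partial j tphi.
have [C1 C10 h1] := test_pairing_bound tp; have [C2 C20 h2] := test_pairing_bound tphi.
have Lsub f g : L2per b f -> L2per b g -> L2per b (fun y => f y - g y).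
  move=> Lf Lg; rewrite (_ : (fun _ => _) = (fun y => -1 * g y + f y)).
    exact: L2per_lin.
  by apply/funext => y; ring.
have diff f g (psi : E -> R) : L2per b f -> L2per b g -> test_function psi ->
    \int[mu]_x (f x * psi x) - \int[mu]_x (g x * psi x) = \int[mu]_x ((f x - g x) * psi x).
  move=> [lf _] [lg _] tpsi.
  rewrite -(RintegralB measurableT (test_mul_integrable lf tpsi) (test_mul_integrable lg tpsi)).
  by apply: eq_Rintegral => x _; rewrite mulrBl.
apply/eqP; rewrite -subr_eq0 opprK -normr_eq0 eq_le normr_ge0 andbT.
apply/ler_addgt0Pr => e e0; rewrite add0r.
(* With t = e / D the two errors are at most 2 C1 t and 2 C2 t, together below e; the extra 1 keeps
   D positive. *)
pose D := 2 * (C1 + C2) + 1.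
have D0 : 0 < D by rewrite ltr_wpDl// mulr_ge0// addr_ge0.
pose t := e / D; have t0 : 0 < t by rewrite divr_gt0.
have t2 : 0 < t ^+ 2 by rewrite exprn_gt0.
have [N1 hN1] := hu _ t2; have [N2 hN2] := hw _ t2.
pose n := maxn N1 N2.
have b1 := hN1 n (leq_maxl _ _); have b2 := hN2 n (leq_maxr _ _).
have := h1 _ t (Lsub _ _ (Lu n) Ll) t0; have := h2 _ t (Lsub _ _ (Lw n) Lm) t0.
rewrite -!diff// (huw n phi tphi).
have q1 : ip b (fun y => u n y - l y) (fun y => u n y - l y) / t <= t.
  by rewrite ler_pdivrMr// -expr2.
have q2 : ip b (fun y => w n y - m y) (fun y => w n y - m y) / t <= t.
  by rewrite ler_pdivrMr// -expr2.
move=> k2 k1.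
have {}k2 := le_trans k2 (ler_wpM2l C20 (lerD (lexx t) q2)).
have {}k1 := le_trans k1 (ler_wpM2l C10 (lerD (lexx t) q1)).
have -> : e = 2 * (C1 * t) + 2 * (C2 * t) + t.
  by rewrite -[LHS](divfK (lt0r_neq0 D0)) -/t /D; ring.
move: k1 k2; rewrite !mulrDr.
move: (\int[mu]_x (w n x * phi x)) (\int[mu]_x (l x * partial j phi x))
  (\int[mu]_x (m x * phi x)) (C1 * t) (C2 * t) => I1 I2 I3 x1 x2.
clear -t0; rewrite !ler_norml => /andP[? ?] /andP[? ?].
by apply/andP; split; lra.
Qed.

End weak_gradients.

(** * Tensor fields *)

Section tensor_algebra.
Variable R : realType.
Implicit Types (xi eta : 'M[R]_3) (c : 'M[R]_(3 * 3)).

Lemma frobE xi eta : frob xi eta = \sum_i \sum_j xi i j * eta i j.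
Proof.
rewrite /frob /mxtrace exchange_big; apply: eq_bigr => j _.
by rewrite mxE; apply: eq_bigr => i _; rewrite mxE.
Qed.

Lemma frob_mxvec xi eta : frob xi eta = \sum_m mxvec xi 0 m * mxvec eta 0 m.
Proof.
rewrite frobE pair_bigA /= (reindex _ (curry_mxvec_bij 3 3)) /=.
by apply: eq_bigr => -[i j] _; rewrite !mxvecE.
Qed.

Lemma frobC xi eta : frob xi eta = frob eta xi.
Proof. by rewrite !frobE; apply: eq_bigr => i _; apply: eq_bigr => j _; rewrite mulrC. Qed.

Lemma frobDl a xi xi' eta : frob (a *: xi + xi') eta = a * frob xi eta + frob xi' eta.
Proof. by rewrite /frob linearP mulmxDl linearD -scalemxAl linearZ. Qed.

Lemma frob_ge0 xi : 0 <= frob xi xi.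
Proof. by rewrite frobE; apply: sumr_ge0 => i _; apply: sumr_ge0 => j _; rewrite -expr2 sqr_ge0. Qed.

Lemma frob_eq0 xi : frob xi xi = 0 -> xi = 0.
Proof.
rewrite frobE => /eqP; rewrite psumr_eq0 => [|i _]; last first.
  by apply: sumr_ge0 => j _; rewrite -expr2 sqr_ge0.
move=> /allP h; apply/matrixP => i j; rewrite mxE.
have := h i (mem_index_enum i); rewrite psumr_eq0 => [|k _]; last by rewrite -expr2 sqr_ge0.
by move=> /allP /(_ j (mem_index_enum j)); rewrite mulf_eq0 orbb => /eqP.
Qed.

Lemma tensD c a xi xi' : tens c (a *: xi + xi') = a *: tens c xi + tens c xi'.
Proof. by rewrite /tens linearP mulmxDl -scalemxAl linearP. Qed.

Lemma tensE c xi i j : tens c xi i j = \sum_m mxvec xi 0 m * c m (mxvec_index i j).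
Proof. by rewrite /tens !mxE. Qed.

Lemma frob_tens c xi eta :
  frob (tens c xi) eta = \sum_m \sum_n mxvec xi 0 n * c n m * mxvec eta 0 m.
Proof.
rewrite frob_mxvec; apply: eq_bigr => m _; rewrite /tens vec_mxK mxE mulr_suml.
by apply: eq_bigr => n _.
Qed.

(** Each of the 81 terms is at most (B / 2) (x_n^2 + x_m^2), and every square then occurs 9 times in
    either position. *)
Lemma frob_tens_bound c xi B : (forall i j, `|c i j| <= B) ->
  frob (tens c xi) xi <= B * 9 * frob xi xi.
Proof.
move=> cB; rewrite frob_tens frob_mxvec.
pose x m := mxvec xi 0 m.
apply: (@le_trans _ _ (\sum_m \sum_n (B / 2 * x n ^+ 2 + B / 2 * x m ^+ 2))).
  apply: ler_sum => m _; apply: ler_sum => n _; rewrite -/(x m) -/(x n).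
  have := cB n m; rewrite ler_norml => /andP[h1 h2].
  have B0 : 0 <= B by apply: le_trans (cB n m).
  move: (x m) (x n) (c n m) h1 h2 => s t k h1 h2.
  have a1 := sqr_ge0 (s - t); have a2 := sqr_ge0 (s + t).
  have := mulr_ge0 (_ : 0 <= B - k) a2; rewrite subr_ge0 => /(_ h2).
  have := mulr_ge0 (_ : 0 <= B + k) a1; rewrite -subr_ge0 -(opprK k) subr_ge0 in h1 *.
  by nra.
have -> : \sum_m mxvec xi 0 m * mxvec xi 0 m = \sum_m x m ^+ 2.
  by apply: eq_bigr => m _; rewrite expr2.
under eq_bigr do rewrite big_split /= sumr_const card_ord -mulr_sumr.
rewrite big_split /= sumr_const card_ord sumrMnl -mulr_sumr.
move: (\sum_(m < 3 * 3) x m ^+ 2) => q; rewrite (_ : (3 * 3)%N = 9%N)//.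
by rewrite -mulr_natr; lra.
Qed.

Lemma sympart_symm xi : symmx (sympart xi).
Proof. by apply/matrixP => i j; rewrite !mxE addrC. Qed.

Lemma sympart_id xi : symmx xi -> sympart xi = xi.
Proof. by move=> /matrixP h; apply/matrixP => i j; move: (h i j); rewrite !mxE => ->; lra. Qed.

Lemma sympartD a xi xi' : sympart (a *: xi + xi') = a *: sympart xi + sympart xi'.
Proof. by apply/matrixP => i j; rewrite !mxE; ring. Qed.

Lemma frob_sympart xi eta : symmx xi -> frob xi (sympart eta) = frob xi eta.
Proof.
move=> /matrixP h; rewrite !frobE.
have -> : \sum_i \sum_j xi i j * sympart eta i j =
    2^-1 * (\sum_i \sum_j xi i j * eta i j + \sum_i \sum_j xi i j * eta j i).
  rewrite -big_split /= mulr_sumr; apply: eq_bigr => i _; rewrite -big_split /= mulr_sumr.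
  by apply: eq_bigr => j _; rewrite !mxE; ring.
rewrite [X in _ + X]exchange_big.
have -> : \sum_j \sum_i xi i j * eta j i = \sum_i \sum_j xi i j * eta i j.
  by apply: eq_bigr => i _; apply: eq_bigr => j _; move: (h i j); rewrite mxE => ->.
lra.
Qed.

End tensor_algebra.

Section tensor_fields.
Variable R : realType.
Local Notation E := 'cV[R]_3.
Local Notation M := 'M[R]_3.
Local Notation mu := (@lebesgue3 R).
Variable b : 3.-tuple E.
Hypothesis hb : free b.
Implicit Types (f g : E -> R) (s t r : E -> M).

Lemma L2loc_ae f g : L2loc f -> measurable_fun setT g -> {ae mu, forall x, f x = g x} ->
  L2loc g.
Proof.
move=> lf mg fg; apply: L2loc_of_cube => // q.
have mq := @measurable_cube R q.
have mf2 : measurable_fun setT (fun x => f x ^+ 2) by apply: measurable_funX; exact: L2loc_measurable.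
have mg2 : measurable_fun setT (fun x => g x ^+ 2) by exact: measurable_funX.
have /integrableP[_ h] := L2loc_cube q lf.
apply/integrableP; split; first by apply/measurable_EFinP; exact: measurable_funTS.
apply: le_lt_trans h; rewrite le_eqVlt; apply/orP; left; apply/eqP.
apply: ae_eq_integral => //.
- by apply: measurableT_comp => //; apply/measurable_EFinP; exact: measurable_funTS.
- by apply: measurableT_comp => //; apply/measurable_EFinP; exact: measurable_funTS.
- by apply: filterS fg => x /= -> _.
Qed.

Lemma L2per_mul_ae_bounded f g B : measurable_fun setT g -> @Defs.periodic R b _ g ->
  {ae mu, forall x, `|g x| <= B} -> L2per b f -> L2per b (fun y => f y * g y).
Proof.
move=> mg pg gB [lf pf].
(* [g] is bounded only almost everywhere; its truncation is bounded everywhere and differs from it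
   on a null set. *)
pose g' x := Num.max (- B) (Num.min (g x) B).
have mg' : measurable_fun setT g'.
  by apply: measurable_maxr => //; exact: measurable_minr.
split; last exact: (periodic_op2 *%R pf pg).
apply: (@L2loc_ae (fun y => g' y * f y)).
- apply: (@L2loc_mul_bounded R f g' `|B|) => // x; rewrite /g' ler_norml.
  have := ler_norm B; have := ler_norm (- B); rewrite normrN => h1 h2.
  by rewrite le_max lerN2 h2 ge_max h1 ge_min h2 orbT.
- by apply: measurable_funM => //; exact: L2loc_measurable.
- apply: filterS gB => x; rewrite ler_norml mulrC => /andP[h1 h2]; congr (_ * _).
  by rewrite /g' min_l// max_r.
Qed.


Definition mL2 s := forall i j, L2per b (fun y => s y i j).

Definition mip s t := cell_int b (fun y => frob (s y) (t y)).

Lemma mL2_lin a s t : mL2 s -> mL2 t -> mL2 (a *: s + t).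
Proof.
move=> Ls Lt i j; rewrite (_ : (fun _ => _) = (fun y => a * s y i j + t y i j)).
  exact: L2per_lin.
by apply/funext => y; rewrite -[(_ + _) y]/(a *: s y + t y) !mxE.
Qed.

Lemma mL2_measurable s i j : mL2 s -> measurable_fun setT (fun y => s y i j).
Proof. by move=> Ls; apply: L2loc_measurable; case: (Ls i j). Qed.

Lemma mL2_L2loc s i j : mL2 s -> L2loc (fun y => s y i j).
Proof. by move=> Ls; case: (Ls i j). Qed.

Lemma mipE s t : mL2 s -> mL2 t ->
  mip s t = \sum_i \sum_j ip b (fun y => s y i j) (fun y => t y i j) /\
  mu.-integrable (cell b) (EFin \o (fun y => frob (s y) (t y))).
Proof.
move=> Ls Lt; have mc := measurable_cell hb.
have ii i j := cell_mul_integrable hb (mL2_L2loc i j Ls) (mL2_L2loc i j Lt).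
have H i := Rintegral_sum (index_enum 'I_3) mc (ii i).
have [E1 i1] := Rintegral_sum (index_enum 'I_3) mc (fun i => (H i).2).
have -> : mip s t = \int[mu]_(y in cell b) (\sum_i \sum_j s y i j * t y i j).
  by apply: eq_Rintegral => y _; rewrite frobE.
split; first by rewrite E1; apply: eq_bigr => i _; rewrite (H i).1.
move: i1; congr (mu.-integrable _ _).
by apply/funext => y; rewrite /= frobE.
Qed.

Lemma mipC s t : mip s t = mip t s.
Proof. by apply: eq_Rintegral => y _; rewrite frobC. Qed.

Lemma mip_lin a s t r : mL2 s -> mL2 t -> mL2 r ->
  mip (a *: s + t) r = a * mip s r + mip t r.
Proof.
move=> Ls Lt Lr; have mc := measurable_cell hb.
have [_ i1] := mipE Ls Lr; have [_ i2] := mipE Lt Lr.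
rewrite /mip /cell_int -(RintegralZl a mc i1) -RintegralD//.
  by apply: eq_Rintegral => y _; rewrite -[(_ + _) y]/(a *: s y + t y) frobDl.
by have := integrableZl mc a i1; exact: eq_integrable.
Qed.

Lemma mip_ge0 s : 0 <= mip s s.
Proof. by apply: Rintegral_ge0 => y _; exact: frob_ge0. Qed.

Lemma measurable_frob s t : mL2 s -> mL2 t -> measurable_fun setT (fun y => frob (s y) (t y)).
Proof.
move=> Ls Lt; rewrite (_ : (fun _ => _) = (fun y => \sum_i \sum_j s y i j * t y i j)).
  apply: measurable_sum => i; apply: measurable_sum => j; apply: measurable_funM; exact: mL2_measurable.
by apply/funext => y; rewrite frobE.
Qed.

Lemma eq_mip s s' t t' : mL2 s -> mL2 s' -> mL2 t -> mL2 t' ->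
  {ae mu, forall y, s y = s' y} -> {ae mu, forall y, t y = t' y} ->
  mip s t = mip s' t'.
Proof.
move=> Ls Ls' Lt Lt' h h'; apply: ae_eq_Rintegral; first exact: measurable_cell.
- by apply: measurable_funTS; exact: measurable_frob.
- by apply: measurable_funTS; exact: measurable_frob.
- by apply: filterS2 h h' => y -> ->.
Qed.

Lemma le_mip s t s' t' k : mL2 s -> mL2 t -> mL2 s' -> mL2 t' ->
  {ae mu, forall y, frob (s y) (t y) <= k * frob (s' y) (t' y)} ->
  mip s t <= k * mip s' t'.
Proof.
move=> Ls Lt Ls' Lt' h; have mc := measurable_cell hb.
have [_ i1] := mipE Ls Lt; have [_ i2] := mipE Ls' Lt'.
rewrite /mip /cell_int -(RintegralZl k mc i2) -subr_ge0.
have i3 : mu.-integrable (cell b) (EFin \o (fun y => k * frob (s' y) (t' y))).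
  by have := integrableZl mc k i2; exact: eq_integrable.
rewrite -(RintegralB mc i3 i1).
(* Truncation turns an inequality that holds almost everywhere into one that holds everywhere,
   without changing the integral. *)
pose h0 y := Num.max 0 (k * frob (s' y) (t' y) - frob (s y) (t y)).
have mm : measurable_fun setT (fun y => k * frob (s' y) (t' y) - frob (s y) (t y)).
  by apply: measurable_funB; [apply: measurable_funM => //|]; exact: measurable_frob.
rewrite (_ : Rintegral _ _ _ = \int[mu]_(y in cell b) h0 y).
  by apply: Rintegral_ge0 => y _; rewrite /h0 le_max lexx.
apply: ae_eq_Rintegral => //.
- exact: measurable_funTS.
- by apply: measurable_funTS; exact: measurable_maxr.
- by apply: filterS h => y h _; rewrite /h0 max_r// subr_ge0.
Qed.

End tensor_fields.

(** * The rigidity tensor acting on square-integrable fields *)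

Section rigidity.
Variable R : realType.
Local Notation E := 'cV[R]_3.
Local Notation M := 'M[R]_3.
Local Notation mu := (@lebesgue3 R).
Variable b : 3.-tuple E.
Hypothesis hb : free b.
Implicit Types (s t : E -> M) (D : E -> 'M[R]_(3 * 3)).

Definition bounded_tensor D := [/\ @Defs.periodic R b _ D,
  forall i j, measurable_fun setT (fun y => D y i j)
  & exists B : R, {ae mu, forall y, forall i j, `|D y i j| <= B}].

Lemma mL2_tens D s : bounded_tensor D -> mL2 b s -> mL2 b (fun y => tens (D y) (s y)).
Proof.
move=> [pD mD [B DB]] Ls i j.
rewrite (_ : (fun _ => _) = (fun y => \sum_(m <- index_enum 'I_(3 * 3))
   mxvec (s y) 0 m * D y m (mxvec_index i j))); last first.
  by apply/funext => y; rewrite tensE.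
apply: L2per_sum => m; apply: (@L2per_mul_ae_bounded R b _ _ B) => //.
- exact: (periodic_comp (fun A : 'M[R]_(3 * 3) => A m (mxvec_index i j)) pD).
- by apply: filterS DB => y; exact.
- case/mxvec_indexP: m => k n.
  rewrite (_ : (fun _ => _) = (fun y => s y k n)); first exact: Ls.
  by apply/funext => y; rewrite mxvecE.
Qed.

Lemma tens_field_lin D a s t : (fun y => tens (D y) ((a *: s + t) y)) =
  a *: (fun y => tens (D y) (s y)) + (fun y => tens (D y) (t y)).
Proof. by apply/funext => y; rewrite -[LHS]/(tens (D y) (a *: s y + t y)) tensD. Qed.

Lemma mip_tens_bound D : bounded_tensor D -> exists2 K, 0 <= K & forall s, mL2 b s ->
  mip b (fun y => tens (D y) (s y)) s <= K * mip b s s.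
Proof.
move=> bD; have [_ _ [B DB]] := bD; exists (`|B| * 9) => [|s Ls]; first by rewrite mulr_ge0.
apply: le_mip => //; first exact: mL2_tens.
apply: filterS DB => y h; apply: frob_tens_bound => i j.
exact: le_trans (h i j) (ler_norm B).
Qed.

Variable C : E -> 'M[R]_(3 * 3).
Hypothesis hC : rigidity_tensor b C.

Lemma rigidity_bounded : bounded_tensor C.
Proof. by case: hC. Qed.

Definition symm_field s := {ae mu, forall y, symmx (s y)}.

Lemma mip_C_sym s t : mL2 b s -> mL2 b t -> symm_field s -> symm_field t ->
  mip b (fun y => tens (C y) (s y)) t = mip b s (fun y => tens (C y) (t y)).
Proof.
move=> Ls Lt ss st; have bC := rigidity_bounded.
apply: ae_eq_Rintegral; first exact: measurable_cell.
- by apply: measurable_funTS; apply: measurable_frob => //; exact: mL2_tens.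
- by apply: measurable_funTS; apply: measurable_frob => //; exact: mL2_tens.
have [_ _ _ h _] := hC; apply: filterS3 h ss st => y [_ h] sy ty _.
exact: h.
Qed.

Lemma mip_C_ge : exists2 alpha, 0 < alpha & forall s, mL2 b s -> symm_field s ->
  alpha * mip b s s <= mip b (fun y => tens (C y) (s y)) s.
Proof.
have [_ _ _ _ [alpha a0 h]] := hC; exists alpha => // s Ls ss.
have bC := rigidity_bounded.
rewrite -ler_pdivlMl//; apply: le_mip => //; first exact: mL2_tens.
by apply: filterS2 h ss => y h sy; rewrite ler_pdivlMl//; exact: h.
Qed.

Lemma mip_eq0 s : mL2 b s -> mip b s s = 0 -> {ae mu, forall y, s y = 0}.
Proof.
move=> Ls; rewrite (mipE hb Ls Ls).1 => /eqP.
rewrite psumr_eq0 => [|i _]; last by apply: sumr_ge0 => j _; exact: ip_ge0.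
move=> /allP h; have {}h i j : {ae mu, forall y, s y i j = 0}.
  have := h i (mem_index_enum i); rewrite psumr_eq0 => [|k _]; last exact: ip_ge0.
  by move=> /allP /(_ j (mem_index_enum j)) /eqP; exact: ip_eq0.
have := ae_ord3 (fun i => ae_ord3 (h i)).
by apply: filterS => y h0; apply/matrixP => i j; rewrite h0 mxE.
Qed.

End rigidity.

(** * The cell problem *)

Lemma frob_sympart_le (R : realType) (A : 'M[R]_3) :
  frob (sympart A) (sympart A) <= frob A A.
Proof.
have h : frob (sympart A) (sympart A) = frob (sympart A) A.
  by rewrite frob_sympart//; exact: sympart_symm.
have := frob_ge0 (-1 *: sympart A + A).
rewrite frobDl (frobC (sympart A)) (frobC A) !frobDl (frobC A (sympart A)) -h; lra.
Qed.

Section energy_space.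
Variable R : realType.
Local Notation E := 'cV[R]_3.
Local Notation M := 'M[R]_3.
Local Notation mu := (@lebesgue3 R).
Variable b : 3.-tuple E.
Hypothesis hb : free b.
Implicit Types (f g : E -> R) (u v w : E -> E).

Lemma L2per_ae f g : L2per b f -> L2loc g -> {ae mu, forall y, f y = g y} -> L2per b g.
Proof.
move=> [lf pf] lg fg; split=> // a la.
by apply: filterS3 (pf a la) fg (ae_shift a fg) => y h h1 <-; rewrite h.
Qed.

(** Fields with a periodic gradient, not necessarily periodic themselves: a linear space that holds
    both affine maps and [H1per], hence the ambient space for the projection that solves the cell
    problem. *)
Definition per_grad u := [/\ forall i, L2loc (fun y => u y i 0),
  weak_gradient u (grad u) & mL2 b (grad u)].

Lemma per_grad_of u (W : E -> M) : (forall i, L2loc (fun y => u y i 0)) ->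
  weak_gradient u W -> mL2 b W -> per_grad u /\ {ae mu, forall y, grad u y = W y}.
Proof.
move=> lu hW LW; have [hG GW] := weak_gradient_ae_grad hW; split=> //; split=> // i j.
apply: (L2per_ae (LW i j)); first by case: (hG i j).
by apply: filterS GW => y ->.
Qed.

Lemma H1per_per_grad v : H1per b v -> per_grad v.
Proof.
move=> hv; have [hG _ LG] := H1per_components hv; split => //.
by case: hv => -[].
Qed.

Lemma comp_lin a u v y i : (a *: u + v) y i 0 = a * u y i 0 + v y i 0.
Proof. by rewrite -[(_ + _) y]/(a *: u y + v y) !mxE. Qed.

Lemma L2loc_comp_lin a u v i : L2loc (fun y => u y i 0) -> L2loc (fun y => v y i 0) ->
  L2loc (fun y => (a *: u + v) y i 0).
Proof.
move=> lu lv; rewrite (_ : (fun _ => _) = (fun y => a * u y i 0 + v y i 0)).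
  exact: L2loc_lin.
by apply/funext => y; rewrite comp_lin.
Qed.

Lemma weak_gradient_lin a u v (U V : E -> M) :
  (forall i, L2loc (fun y => u y i 0)) -> (forall i, L2loc (fun y => v y i 0)) ->
  weak_gradient u U -> weak_gradient v V -> weak_gradient (a *: u + v) (a *: U + V).
Proof.
move=> lu lv hU hV i j; have [lU wU] := hU i j; have [lV wV] := hV i j.
have -> : (fun y => (a *: U + V) y i j) = (fun y => a * U y i j + V y i j).
  by apply/funext => y; rewrite -[(_ + _) y]/(a *: U y + V y) !mxE.
have -> : (fun y => (a *: u + v) y i 0) = (fun y => a * u y i 0 + v y i 0).
  by apply/funext => y; rewrite comp_lin.
by split; [exact: L2loc_lin|exact: weak_partial_lin].
Qed.

Lemma per_grad_lin a u v : per_grad u -> per_grad v ->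
  per_grad (a *: u + v) /\
  {ae mu, forall y, grad (a *: u + v) y = (a *: grad u + grad v) y}.
Proof.
move=> [lu hu Lu] [lv hv Lv]; apply: per_grad_of.
- by move=> i; exact: L2loc_comp_lin.
- exact: weak_gradient_lin.
- exact: mL2_lin.
Qed.

Lemma per_grad_affine (A : M) (c : E) : per_grad (fun y => c + A *m y) /\
  {ae mu, forall y, grad (fun y => c + A *m y) y = A}.
Proof.
have cE i : (fun y : E => (c + A *m y) i 0) = (fun y => c i 0 + \sum_k A i k * y k 0).
  by apply/funext => y; rewrite !mxE.
apply: (@per_grad_of _ (fun=> A)).
- move=> i; rewrite cE; apply: loc_bounded_L2loc; first exact: measurable_affine.
  exact: affine_loc_bounded.
- move=> i j; split; first exact: L2loc_cst.
  by rewrite cE; exact: weak_partial_affine.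
- by move=> i j; exact: L2per_cst.
Qed.

Lemma H1per_lin a u v : H1per b u -> H1per b v -> H1per b (a *: u + v).
Proof.
move=> [[lu [U hU]] pu] [[lv [V hV]] pv]; split; last first.
  exact: (periodic_op2 (fun x y : E => a *: x + y) pu pv).
split; first by move=> i; exact: L2loc_comp_lin.
by exists (a *: U + V); exact: weak_gradient_lin.
Qed.

Lemma H1per_cst (c : E) : H1per b (fun=> c).
Proof.
have [[l h _] _] := per_grad_affine 0 c.
have cE : (fun y : E => c + (0 : M) *m y) = (fun=> c).
  by apply/funext => y; rewrite mul0mx addr0.
rewrite cE in l h; split; last exact: periodic_cst.
by split; [move=> i; exact: L2loc_cst|exists (grad (fun=> c))].
Qed.

Lemma cell_int_lin a f g : L2loc f -> L2loc g ->
  cell_int b (fun y => a * f y + g y) = a * cell_int b f + cell_int b g.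
Proof.
move=> lf lg; have mc := measurable_cell hb.
have i1 := cell_L2_integrable hb lf; have i2 := cell_L2_integrable hb lg.
rewrite /cell_int -(RintegralZl a mc i1) -RintegralD//.
by have := integrableZl mc a i1; exact: eq_integrable.
Qed.

Lemma zero_mean_lin a u v : (forall i, L2loc (fun y => u y i 0)) ->
  (forall i, L2loc (fun y => v y i 0)) -> zero_mean b u -> zero_mean b v ->
  zero_mean b (a *: u + v).
Proof.
move=> lu lv zu zv i.
rewrite (_ : (fun _ => _) = (fun y => a * u y i 0 + v y i 0)).
  by rewrite cell_int_lin// zu zv mulr0 addr0.
by apply/funext => y; rewrite comp_lin.
Qed.

Lemma H1per0_lin a u v : H1per0 b u -> H1per0 b v -> H1per0 b (a *: u + v).
Proof.
move=> [hu zu] [hv zv]; split; first exact: H1per_lin.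
by apply: zero_mean_lin => //; [case: hu => -[]|case: hv => -[]].
Qed.

Lemma cell_int0 : cell_int b (fun=> 0) = 0.
Proof. by rewrite /cell_int Rintegral_cst ?mul0r//; exact: measurable_cell. Qed.

Lemma H1per00 : H1per0 b (0 : E -> E).
Proof.
split; first exact: (H1per_cst 0).
by move=> i; rewrite -[RHS]cell_int0; apply: eq_Rintegral => y _; rewrite mxE.
Qed.

Lemma symgrad_symm u y : symmx (symgrad u y).
Proof. exact: sympart_symm. Qed.

Lemma symgrad_symm_field u : symm_field (symgrad u).
Proof. by apply: aeW => y; exact: symgrad_symm. Qed.

Lemma mL2_symgrad u : per_grad u -> mL2 b (symgrad u).
Proof.
move=> [_ _ LG] i j.
rewrite (_ : (fun _ => _) = (fun y => 2^-1 * grad u y i j + (2^-1 * grad u y j i + 0))).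
  by apply: L2per_lin => //; apply: L2per_lin => //; exact: L2per_cst.
by apply/funext => y; rewrite !mxE; ring.
Qed.

Lemma symgrad_lin a u v : per_grad u -> per_grad v ->
  {ae mu, forall y, symgrad (a *: u + v) y = (a *: symgrad u + symgrad v) y}.
Proof.
move=> hu hv; have [_] := per_grad_lin a hu hv; apply: filterS => y h.
by rewrite /symgrad h -[(_ + grad v) y]/(a *: grad u y + grad v y) sympartD.
Qed.

(** By [Korn_swap] the mixed products of the gradient sum to the squared norm of the divergence, so
    that 2 |symgrad v|^2 = |grad v|^2 + |div v|^2, whence the constant 2. *)
Lemma Korn v : H1per b v -> mip b (grad v) (grad v) <= 2 * mip b (symgrad v) (symgrad v).
Proof.
move=> hv; have pv := H1per_per_grad hv; have [hG Lv LG] := H1per_components hv.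
have LS := mL2_symgrad pv.
rewrite (mipE hb LG LG).1 (mipE hb LS LS).1.
pose g i j : E -> R := fun y => grad v y i j.
have Lg i j : L2per b (g i j) by exact: LG.
have Sij i j : ip b (fun y => symgrad v y i j) (fun y => symgrad v y i j) =
    4^-1 * ip b (g i j) (g i j) + 2^-1 * ip b (g i i) (g j j) + 4^-1 * ip b (g j i) (g j i).
  rewrite -(Korn_swap hb (v := fun i y => v y i 0) (W := g) i j Lv Lg (fun i j => (hG i j).2)).
  have -> : (fun y => symgrad v y i j) = 2^-1 *: g i j + (2^-1 *: g j i).
    apply/funext => y; rewrite -[RHS]/(2^-1 * grad v y i j + 2^-1 * grad v y j i) !mxE.
    by ring.
  have L2 : L2per b (2^-1 *: g j i) by exact: L2per_scale.
  have L12 : L2per b (2^-1 *: g i j + 2^-1 *: g j i) by exact: L2per_lincomb.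
  rewrite ip_lincomb// ip_scale// !ip_lincombr// (ipC b (g i j) (2^-1 *: _)) (ipC b (g j i) (2^-1 *: _)).
  by rewrite !ip_scale// (ipC b (g j i) (g i j)); field.
under [X in _ <= 2 * X]eq_bigr => i _ do
  (under eq_bigr => j _ do rewrite Sij; rewrite !big_split /= -!mulr_sumr).
rewrite !big_split /= -!mulr_sumr.
have -> : \sum_i \sum_j ip b (g j i) (g j i) = \sum_i \sum_j ip b (g i j) (g i j).
  by rewrite exchange_big.
have tr0 : 0 <= \sum_i \sum_j ip b (g i i) (g j j).
  have lg i : L2loc (g i i) by case: (Lg i i).
  have lt : L2loc (fun y => \sum_(i <- index_enum 'I_3) g i i y).
    by apply: (proj1 (_ : L2per b _)); exact: L2per_sum.
  have := ip_ge0 b (fun y => \sum_(i <- index_enum 'I_3) g i i y).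
  rewrite (ip_suml hb)//; congr (_ <= _); apply: eq_bigr => i _.
  by rewrite ipC (ip_suml hb)//; apply: eq_bigr => j _; rewrite ipC.
lra.
Qed.

Variable C : E -> 'M[R]_(3 * 3).
Hypothesis hC : rigidity_tensor b C.

Definition form u w := mip b (fun y => tens (C y) (symgrad u y)) (symgrad w).

Lemma mL2_stress u : per_grad u -> mL2 b (fun y => tens (C y) (symgrad u y)).
Proof. by move=> hu; apply: mL2_tens; [exact: rigidity_bounded hC|exact: mL2_symgrad]. Qed.

Lemma stress_lin a u v : per_grad u -> per_grad v ->
  {ae mu, forall y, tens (C y) (symgrad (a *: u + v) y) =
    (a *: (fun y => tens (C y) (symgrad u y)) + (fun y => tens (C y) (symgrad v y))) y}.
Proof.
move=> hu hv; apply: filterS (symgrad_lin a hu hv) => y ->.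
by rewrite -[LHS]/(tens (C y) (a *: symgrad u y + symgrad v y)) tensD.
Qed.

Lemma form_lin a u v w : per_grad u -> per_grad v -> per_grad w ->
  form (a *: u + v) w = a * form u w + form v w.
Proof.
move=> hu hv hw; have [huv _] := per_grad_lin a hu hv.
rewrite -mip_lin//; try exact: mL2_stress; try exact: mL2_symgrad.
apply: eq_mip => //; try exact: mL2_stress; try exact: mL2_symgrad.
- by apply: mL2_lin; exact: mL2_stress.
- exact: stress_lin.
- exact: aeW.
Qed.

Lemma form_sym u w : per_grad u -> per_grad w -> form u w = form w u.
Proof.
move=> hu hw; transitivity (mip b (symgrad u) (fun y => tens (C y) (symgrad w y))); last exact: mipC.
apply: (mip_C_sym hb hC).
- exact: mL2_symgrad.
- exact: mL2_symgrad.
- exact: symgrad_symm_field.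
- exact: symgrad_symm_field.
Qed.

Lemma form_ge0 u : per_grad u -> 0 <= form u u.
Proof.
move=> hu; have [al a0 h] := mip_C_ge hb hC.
apply: le_trans (h _ (mL2_symgrad hu) (symgrad_symm_field u)).
by apply: mulr_ge0; [exact: ltW|exact: mip_ge0].
Qed.

(** Ellipticity and Korn's inequality give the gradient with constant 2 / alpha; Poincare's
    inequality, applied to each component, adds the field itself. *)
Lemma form_coercive : exists2 K, 0 <= K & forall v, H1per0 b v ->
  mip b (grad v) (grad v) <= K * form v v /\
  forall i, ip b (fun y => v y i 0) (fun y => v y i 0) <= K * form v v.
Proof.
have [al a0 h] := mip_C_ge hb hC; have [P P0 hP] := Poincare hb.
have K0 : 0 <= 2 / al by rewrite divr_ge0 ?ltW.
exists (2 / al * (1 + P)) => [|v [hv zv]]; first by rewrite mulr_ge0// addr_ge0.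
have pv := H1per_per_grad hv; have [hG Lv LG] := H1per_components hv.
have F0 := form_ge0 pv.
have G0 := mip_ge0 b (grad v).
have hk : mip b (grad v) (grad v) <= 2 / al * form v v.
  apply: (le_trans (Korn hv)); rewrite -mulrA ler_pM2l// ler_pdivlMl//.
  by apply: h; [exact: mL2_symgrad|exact: symgrad_symm_field].
split.
  apply: (le_trans hk); rewrite ler_wpM2r// -[leLHS]mulr1 ler_wpM2l//.
  by rewrite lerDl.
move=> i; apply: (le_trans (hP _ (fun j y => grad v y i j) (Lv i) (LG i) (fun j => (hG i j).2) (zv i))).
apply: (@le_trans _ _ (P * mip b (grad v) (grad v))).
  rewrite ler_wpM2l// (mipE hb LG LG).1 [leRHS](bigD1 i)//= lerDl.
  by apply: sumr_ge0 => k _; apply: sumr_ge0 => j _; exact: ip_ge0.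
apply: (le_trans (ler_wpM2l P0 hk)).
by rewrite mulrA ler_wpM2r// mulrC ler_wpM2l// lerDr ler01.
Qed.

Lemma form_bound : exists2 K, 0 <= K & forall v, per_grad v ->
  form v v <= K * mip b (grad v) (grad v).
Proof.
have [K K0 hK] := mip_tens_bound hb (rigidity_bounded hC).
exists K => // v hv; apply: (le_trans (hK _ (mL2_symgrad hv))); rewrite ler_wpM2l//.
have [_ _ LG] := hv; have LS := mL2_symgrad hv.
rewrite -[leRHS]mul1r; apply: le_mip => //; apply: aeW => y; rewrite mul1r.
exact: frob_sympart_le.
Qed.

Lemma cell_int_sqr f : L2per b f -> (cell_int b f) ^+ 2 <= cell_vol b * ip b f f.
Proof.
move=> Lf; have L1 : L2per b (fun=> 1) by exact: L2per_cst.
have -> : cell_int b f = ip b (fun=> 1) f by apply: eq_Rintegral => y _; rewrite mul1r.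
have -> : cell_vol b = ip b (fun=> 1) (fun=> 1).
  by rewrite /ip /cell_int Rintegral_cst ?mulr1 ?mul1r//; exact: measurable_cell.
exact: (ip_Cauchy_Schwarz hb).
Qed.

(** By coercivity, components and gradient entries are Cauchy in L^2. Their limits are again related
    by weak differentiation ([weak_partial_lim]), and [form_bound] returns from L^2 convergence of
    the gradient to convergence in energy. *)
Lemma H1per0_complete (u : nat -> E -> E) : (forall n, H1per0 b (u n)) ->
  (forall e, 0 < e -> exists N, forall m n, (N <= m)%N -> (N <= n)%N ->
     form (u m - u n) (u m - u n) <= e) ->
  exists2 v, H1per0 b v & forall e, 0 < e -> exists N, forall n, (N <= n)%N ->
     form (u n - v) (u n - v) <= e.
Proof.
move=> hu cu; have [K K0 hK] := form_coercive.
have K1 : 0 < K + 1 by rewrite ltr_wpDl.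
have Hsub v w : v - w = -1 *: w + v by rewrite addrC scaleN1r.
have hsub m n : H1per0 b (u m - u n) by rewrite Hsub; exact: H1per0_lin.
have Lu n i : L2per b (fun y => u n y i 0) by have [_ L _] := H1per_components (hu n).1.
have Lg n i j : L2per b (fun y => grad (u n) y i j) by have [_ _ L] := H1per_components (hu n).1.
have pu n := H1per_per_grad (hu n).1.
have cu' e : 0 < e -> exists N, forall m n, (N <= m)%N -> (N <= n)%N ->
    K * form (u m - u n) (u m - u n) <= e.
  move=> e0; have [|N hN] := cu (e / (K + 1)); first by rewrite divr_gt0.
  exists N => m n Nm Nn; apply: (le_trans (ler_wpM2l K0 (hN m n Nm Nn))).
  rewrite mulrCA ler_piMr ?(ltW e0)// ler_pdivrMr// mul1r.
  by rewrite lerDl.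
have /choice[l hl] i : exists l, L2per b l /\ forall e, 0 < e -> exists N, forall n, (N <= n)%N ->
    ip b (fun y => u n y i 0 - l y) (fun y => u n y i 0 - l y) <= e.
  have [|l Ll hl] := L2per_complete hb (fun n => Lu n i); last by exists l.
  move=> e /cu'[N hN]; exists N => m n Nm Nn; apply: le_trans (hN m n Nm Nn).
  have := (hK _ (hsub m n)).2 i; congr (_ <= _); congr (ip b _ _).
    by apply/funext => y; rewrite !mxE.
  by apply/funext => y; rewrite !mxE.
have /choice[W hW] ij : exists l, L2per b l /\ forall e, 0 < e -> exists N, forall n, (N <= n)%N ->
    ip b (fun y => grad (u n) y ij.1 ij.2 - l y) (fun y => grad (u n) y ij.1 ij.2 - l y) <= e.
  have [|l' Ll' hl'] := L2per_complete hb (fun n => Lg n ij.1 ij.2); last by exists l'.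
  move=> e /cu'[N hN]; exists N => m n Nm Nn; apply: le_trans (hN m n Nm Nn).
  apply: le_trans (hK _ (hsub m n)).1.
  have [pd _] := per_grad_lin (-1) (pu n) (pu m); rewrite -Hsub in pd.
  have [_ _ LGd] := pd.
  have [_ gd] := per_grad_lin (-1) (pu n) (pu m); rewrite -Hsub in gd.
  rewrite (mipE hb LGd LGd).1 (bigD1 ij.1)//= (bigD1 ij.2)//= -addrA.
  have s0 : 0 <= \sum_(i < 3 | i != ij.2) ip b (fun y => grad (u m - u n) y ij.1 i) (fun y => grad (u m - u n) y ij.1 i) +
     \sum_(i < 3 | i != ij.1) \sum_j ip b (fun y => grad (u m - u n) y i j) (fun y => grad (u m - u n) y i j).
    apply: addr_ge0; apply: sumr_ge0 => i _; first exact: ip_ge0.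
    by apply: sumr_ge0 => j _; exact: ip_ge0.
  rewrite -[leLHS]addr0 lerD// le_eqVlt; apply/orP; left; apply/eqP.
  have ga : {ae mu, forall y, grad (u m) y ij.1 ij.2 - grad (u n) y ij.1 ij.2 = grad (u m - u n) y ij.1 ij.2}.
    apply: filterS gd => y ->; rewrite -[(_ + grad (u m)) y]/(-1 *: grad (u n) y + grad (u m) y) !mxE.
    by ring.
  have Ls : L2loc (fun y => grad (u m) y ij.1 ij.2 - grad (u n) y ij.1 ij.2).
    rewrite (_ : (fun _ => _) = (fun y => -1 * grad (u n) y ij.1 ij.2 + grad (u m) y ij.1 ij.2)).
      by apply: L2loc_lin; [case: (Lg n ij.1 ij.2)|case: (Lg m ij.1 ij.2)].
    by apply/funext => y; ring.
  have Ld : L2loc (fun y => grad (u m - u n) y ij.1 ij.2) by case: (LGd ij.1 ij.2).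
  by rewrite (eq_ip hb _ _ _ ga)// ipC (eq_ip hb _ _ _ ga).
pose v : E -> E := fun y => \col_i l i y.
pose V : E -> M := fun y => \matrix_(i, j) W (i, j) y.
have vE i : (fun y => v y i 0) = l i by apply/funext => y; rewrite mxE.
have VE i j : (fun y => V y i j) = W (i, j) by apply/funext => y; rewrite mxE.
have hV : weak_gradient v V.
  move=> i j; rewrite vE VE; split; first by case: (hW (i, j)) => -[].
  have [Ll hl'] := hl i; have [LW hW'] := hW (i, j).
  apply: (weak_partial_lim hb (u := fun n y => u n y i 0) (w := fun n y => grad (u n) y i j)) => // n.
  by have [hG _ _] := H1per_components (hu n).1; case: (hG i j).
have lv i : L2loc (fun y => v y i 0) by rewrite vE; case: (hl i) => -[].
have LV : mL2 b V by move=> i j; rewrite VE; case: (hW (i, j)).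
have [pv gV] := per_grad_of lv hV LV.
exists v.
  split; [split; [by split=> //; exists V|]|].
    move=> a la; have : {ae mu, forall y, forall i, l i (y + a) = l i y}.
      by apply: ae_ord3 => i; have [[_ pl] _] := hl i; exact: pl.
    by apply: filterS => y h; apply/colP => i; rewrite !mxE.
  move=> i; rewrite vE; have [Ll hl'] := hl i.
  (* Zero mean survives the limit, since the mean is bounded by the L^2 norm ([cell_int_sqr]). *)
  apply/eqP; rewrite -sqrf_eq0 eq_le sqr_ge0 andbT; apply/ler_addgt0Pr => e e0; rewrite add0r.
  have vol0 := cell_vol_gt0 hb.
  have [|N hN] := hl' (e / cell_vol b); first by rewrite divr_gt0.
  have Ld : L2per b (fun y => -1 * l i y + u N y i 0) by exact: L2per_lin.
  have := cell_int_sqr Ld.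
  rewrite cell_int_lin; [|by case: Ll|by case: (Lu N i)].
  rewrite (hu N).2 addr0 mulN1r sqrrN => /le_trans; apply.
  rewrite -ler_pdivlMl// mulrC; apply: le_trans (hN N (leqnn N)).
  by rewrite le_eqVlt; apply/orP; left; apply/eqP; congr (ip b _ _); apply/funext => y; ring.
have [B B0 hB] := form_bound.
(* Nine gradient entries, each with error at most e'; B + 1 in place of B keeps the divisor
   positive. *)
move=> e e0; pose e' := e / (9 * (B + 1)).
have B1 : 0 < 9 * (B + 1) by rewrite mulr_gt0// ltr_wpDl.
have e'0 : 0 < e' by rewrite divr_gt0.
have /choice[N hN] ij : exists N, forall n, (N <= n)%N ->
    ip b (fun y => grad (u n) y ij.1 ij.2 - W ij y) (fun y => grad (u n) y ij.1 ij.2 - W ij y) <= e'.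
  by have [_ h] := hW ij; exact: h.
exists (\max_ij N ij)%N => n Nn.
have [pd gd] := per_grad_lin (-1) pv (pu n).
rewrite -Hsub in pd gd; apply: (le_trans (hB _ pd)).
have [_ _ LGd] := pd.
have bd i j : ip b (fun y => grad (u n - v) y i j) (fun y => grad (u n - v) y i j) <= e'.
  have := hN (i, j) n (leq_trans (leq_bigmax (i, j)) Nn) => /=; apply: le_trans.
  have ga : {ae mu, forall y, grad (u n) y i j - W (i, j) y = grad (u n - v) y i j}.
    apply: filterS2 gd gV => y -> h.
    rewrite -[(_ + grad (u n)) y]/(-1 *: grad v y + grad (u n) y) h !mxE; ring.
  have Ls : L2loc (fun y => grad (u n) y i j - W (i, j) y).
    rewrite (_ : (fun _ => _) = (fun y => -1 * W (i, j) y + grad (u n) y i j)).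
      by apply: L2loc_lin; [case: (hW (i, j)) => -[]|case: (Lg n i j)].
    by apply/funext => y; ring.
  have Ld : L2loc (fun y => grad (u n - v) y i j) by case: (LGd i j).
  by rewrite (eq_ip hb _ _ _ ga)// ipC (eq_ip hb _ _ _ ga)//.
rewrite (mipE hb LGd LGd).1.
apply: (@le_trans _ _ (B * (9 * e'))).
  rewrite ler_wpM2l//; apply: (@le_trans _ _ (\sum_(i < 3) \sum_(j < 3) e')).
    by apply: ler_sum => i _; apply: ler_sum => j _.
  by rewrite !big_ord_recl !big_ord0; lra.
rewrite /e' mulrA (mulrC B) mulrCA ler_piMr ?(ltW e0)// ler_pdivrMr// mul1r.
by rewrite ler_pM2l// lerDl.
Qed.

End energy_space.

(** * Solutions of the cell problem and the homogenized tensor *)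

Section cell_problem.
Variable R : realType.
Local Notation E := 'cV[R]_3.
Local Notation M := 'M[R]_3.
Local Notation mu := (@lebesgue3 R).
Variable b : 3.-tuple E.
Hypothesis hb : free b.
Variable C : E -> 'M[R]_(3 * 3).
Hypothesis hC : rigidity_tensor b C.
Implicit Types (u v w : E -> E) (A : M).

Lemma affine_zero_mean A : exists c, zero_mean b (fun y => c + A *m y : E).
Proof.
pose m i := cell_int b (fun y => (A *m y) i 0).
exists (\col_i (- (cell_vol b)^-1 * m i)) => i.
have lA : L2loc (fun y : E => (A *m y) i 0).
  have [[l _ _] _] := per_grad_affine b A 0.
  by have := l i; under eq_fun do rewrite add0r.
have -> : (fun y : E => (\col_i (- (cell_vol b)^-1 * m i) + A *m y) i 0) =
    (fun y => - (cell_vol b)^-1 * m i * 1 + (A *m y) i 0).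
  by apply/funext => y; rewrite mxE mxE mulr1.
rewrite cell_int_lin//; last exact: L2loc_cst.
rewrite -/(m i) [X in _ * X + _]/cell_int Rintegral_cst ?mul1r; last exact: measurable_cell.
have := cell_vol_gt0 hb; rewrite -/(cell_vol b) => v0.
by move: (cell_vol b) (m i) v0 => w k w0; field; rewrite gt_eqF.
Qed.

(** The constant [c] is added and subtracted so that it can later be chosen to give the affine part
    zero mean. The coefficients 1 and -1 match the form [a *: u + v] of the linearity lemmas. *)
Lemma LPA_decomp A u : LPA b A u -> exists2 phi, H1per b phi &
  forall c, u = 1 *: (fun y => c + A *m y) + (-1 *: (fun=> c) + phi).
Proof.
move=> [phi hphi hu]; exists phi => // c; apply/funext => y; rewrite hu.
rewrite -[RHS]/(1 *: (c + A *m y) + (-1 *: c + phi y)) scale1r scaleN1r.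
by rewrite addrACA subrr add0r.
Qed.

Lemma LPA_per_grad A u : LPA b A u -> per_grad b u.
Proof.
move=> /LPA_decomp[phi hphi ue]; rewrite (ue 0).
have [pA _] := per_grad_affine b A 0.
have hp := H1per_lin (-1) (H1per_cst b 0) hphi.
by have [] := per_grad_lin 1 pA (H1per_per_grad hp).
Qed.

Lemma LPA_H1per0 A u : LPA b A u -> zero_mean b u -> exists2 phi, H1per0 b phi &
  per_grad b u /\ {ae mu, forall y, symgrad u y = sympart A + symgrad phi y}.
Proof.
move=> hu zu; have [c hc] := affine_zero_mean A.
have [phi hphi ue] := LPA_decomp hu.
have [pA gA] := per_grad_affine b A c.
have h1 := H1per_lin (-1) (H1per_cst b c) hphi.
set phi0 := -1 *: (fun=> c) + phi in h1.
have pphi := H1per_per_grad h1.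
exists phi0; last first.
  split; first exact: LPA_per_grad hu.
  have := symgrad_lin 1 pA pphi; rewrite -/phi0 -(ue c).
  apply: filterS2 gA => y gy ->.
  rewrite -[LHS]/(1 *: symgrad (fun y => c + A *m y) y + symgrad phi0 y) scale1r.
  by rewrite {1}/symgrad gy.
split=> //.
have -> : phi0 = -1 *: (fun y => c + A *m y) + u.
  rewrite (ue c) -/phi0; apply/funext => y.
  rewrite -[RHS]/(-1 *: (c + A *m y) + (1 *: (c + A *m y) + phi0 y)).
  by rewrite scale1r scaleN1r addKr.
apply: zero_mean_lin => //; first by case: pA.
by have [] := LPA_per_grad hu.
Qed.

(** Take the affine map with gradient [A] and zero mean, and subtract its projection onto [H1per0]
    for the energy form; orthogonality of the remainder is the cell equation. *)
Lemma cell_solution_exists A : symmx A -> exists u, cell_solution b C A u.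
Proof.
move=> sA; have [c hc] := affine_zero_mean A.
have [px _] := per_grad_affine b A c; set x := fun y => _ in px hc.
have [p hp pf] := @projection R (E -> E) (per_grad b) (form b C)
  (fun a u v hu hv => (per_grad_lin a hu hv).1) (form_lin hb hC) (form_sym hb hC)
  (form_ge0 hb hC) (H1per0 b) (H1per00 hb) (fun v hv => H1per_per_grad hv.1)
  (H1per0_lin hb) (H1per0_complete hb hC) x px.
have xp : x - p = -1 *: p + x by rewrite addrC scaleN1r.
have hLPA : LPA b A (x - p).
  exists (-1 *: p + (fun=> c)).
    by apply: H1per_lin; [case: hp|exact: H1per_cst].
  move=> y; rewrite -[(x - p) y]/(c + A *m y - p y).
  rewrite -[(-1 *: p + (fun=> c)) y]/(-1 *: p y + c) scaleN1r.
  by rewrite (addrC c) -addrA (addrC c).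
exists (x - p); split=> //; split; first by exists A.
rewrite xp; apply: zero_mean_lin => //; last by case: hp.
  by have [[[]]] := hp.
by case: px.
Qed.

Lemma cell_solution_lin a A A' u u' : symmx A -> symmx A' ->
  cell_solution b C A u -> cell_solution b C A' u' ->
  cell_solution b C (a *: A + A') (a *: u + u').
Proof.
move=> sA sA' [[_ zu] Lu hu] [[_ zu'] Lu' hu'].
have pu := LPA_per_grad Lu; have pu' := LPA_per_grad Lu'.
have L : LPA b (a *: A + A') (a *: u + u').
  have [phi hphi ue] := Lu; have [phi' hphi' ue'] := Lu'.
  exists (a *: phi + phi'); first exact: H1per_lin.
  move=> y; rewrite -[(a *: u + u') y]/(a *: u y + u' y) ue ue'.
  rewrite -[(a *: phi + phi') y]/(a *: phi y + phi' y).
  by rewrite mulmxDl -scalemxAl scalerDr addrACA.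
split; [|exact: L|].
  split; first by exists (a *: A + A') => //; rewrite /symmx /= linearP /= sA sA'.
  by apply: zero_mean_lin => //; [case: pu|case: pu'].
move=> v hv; have pv := H1per_per_grad hv.1.
apply: (etrans (form_lin hb hC a pu pu' pv)).
have -> : form b C u v = 0 by exact: hu.
have -> : form b C u' v = 0 by exact: hu'.
by rewrite mulr0 addr0.
Qed.

Lemma H1per0_form_eq0 v : H1per0 b v -> form b C v v = 0 ->
  {ae mu, forall y, v y = 0} /\ {ae mu, forall y, symgrad v y = 0}.
Proof.
move=> hv f0; have [K K0 hK] := form_coercive hb hC.
have := hK v hv; rewrite f0 mulr0 => -[h1 h2].
have [hG Lv LG] := H1per_components hv.1.
split.
  have : {ae mu, forall y, forall i, v y i 0 = 0}.
    apply: ae_ord3 => i; apply: (ip_eq0 hb (Lv i)).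
    by apply/eqP; rewrite eq_le h2 ip_ge0.
  by apply: filterS => y h; apply/colP => i; rewrite h mxE.
have : {ae mu, forall y, grad v y = 0}.
  by apply: (mip_eq0 hb) => //; apply/eqP; rewrite eq_le h1 mip_ge0.
by apply: filterS => y; rewrite /symgrad => ->; apply/matrixP => i j; rewrite !mxE; ring.
Qed.

(** The affine parts cancel, so the difference lies in [H1per0] and may be tested against itself. *)
Lemma cell_solution_unique A u u' : cell_solution b C A u -> cell_solution b C A u' ->
  {ae mu, forall y, u y = u' y} /\ {ae mu, forall y, symgrad u y = symgrad u' y}.
Proof.
move=> [[_ zu] Lu hu] [[_ zu'] Lu' hu'].
have pu := LPA_per_grad Lu; have pu' := LPA_per_grad Lu'.
pose d := -1 *: u' + u.
have hd : H1per0 b d.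
  split; last by apply: zero_mean_lin => //; [case: pu'|case: pu].
  have [phi hphi ue] := Lu; have [phi' hphi' ue'] := Lu'.
  have -> : d = -1 *: phi' + phi.
    apply/funext => y; rewrite -[LHS]/(-1 *: u' y + u y) ue ue' -[RHS]/(-1 *: phi' y + phi y).
    by rewrite !scaleN1r opprD addrACA addNr add0r.
  exact: H1per_lin.
have pd := H1per_per_grad hd.1.
have [|d0 g0] := H1per0_form_eq0 hd.
  apply: (etrans (form_lin hb hC (-1) pu' pu pd)).
  have -> : form b C u d = 0 by exact: hu.
  have -> : form b C u' d = 0 by exact: hu'.
  by rewrite mulr0 addr0.
split.
  apply: filterS d0 => y; rewrite -[d y]/(-1 *: u' y + u y) scaleN1r => /eqP.
  by rewrite addrC subr_eq0 => /eqP.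
apply: filterS2 g0 (symgrad_lin (-1) pu' pu) => y -> /eqP.
rewrite -[(_ + symgrad u) y]/(-1 *: symgrad u' y + symgrad u y) scaleN1r eq_sym addrC subr_eq0.
by move=> /eqP.
Qed.

Lemma cell_mean_ae (s t : E -> M) : mL2 b s -> mL2 b t -> {ae mu, forall y, s y = t y} ->
  cell_mean b s = cell_mean b t.
Proof.
move=> Ls Lt st; congr (_ *: _); apply/matrixP => i j; rewrite !mxE.
apply: ae_eq_Rintegral; first exact: measurable_cell.
- by apply: measurable_funTS; exact: mL2_measurable.
- by apply: measurable_funTS; exact: mL2_measurable.
- by apply: filterS st => y -> _.
Qed.

Lemma cell_mean_lin a (s t : E -> M) : mL2 b s -> mL2 b t ->
  cell_mean b (a *: s + t) = a *: cell_mean b s + cell_mean b t.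
Proof.
move=> Ls Lt; rewrite /cell_mean scalerA mulrC -scalerA -scalerDr; congr (_ *: _).
apply/matrixP => i j; rewrite !mxE -cell_int_lin//; try exact: mL2_L2loc.
by apply: eq_Rintegral => y _; rewrite -[(_ + _) y]/(a *: s y + t y) !mxE.
Qed.

Lemma cell_sol_solution A : symmx A -> cell_solution b C A (cell_sol b C A).
Proof. by move=> /cell_solution_exists [u hu]; exact: (xgetPex _ (ex_intro _ u hu)). Qed.

Lemma homogenizedE A u : symmx A -> cell_solution b C A u ->
  homogenized b C A = cell_mean b (fun y => tens (C y) (symgrad u y)).
Proof.
move=> sA hu; have hA := cell_sol_solution sA.
have [_ LA _] := hA; have [_ Lu _] := hu.
apply: cell_mean_ae; try by apply: (mL2_stress hC); apply: LPA_per_grad; eassumption.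
by apply: filterS (cell_solution_unique hA hu).2 => y ->.
Qed.

Lemma homogenized_lin a A A' : symmx A -> symmx A' ->
  homogenized b C (a *: A + A') = a *: homogenized b C A + homogenized b C A'.
Proof.
move=> sA sA'; have hA := cell_sol_solution sA; have hA' := cell_sol_solution sA'.
have sAA : symmx (a *: A + A') by rewrite /symmx /= linearP /= sA sA'.
have h := cell_solution_lin a sA sA' hA hA'.
have [_ LA _] := hA; have [_ LA' _] := hA'; have [_ LAA _] := h.
have pA := LPA_per_grad LA; have pA' := LPA_per_grad LA'; have pAA := LPA_per_grad LAA.
rewrite (homogenizedE sAA h) -cell_mean_lin; try exact: (mL2_stress hC).
apply: cell_mean_ae.
- exact: (mL2_stress hC).
- by apply: mL2_lin; exact: (mL2_stress hC).
- exact: (stress_lin C a pA pA').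
Qed.

Lemma stress_symm u : {ae mu, forall y, symmx (tens (C y) (symgrad u y))}.
Proof.
have [_ _ _ h _] := hC; apply: filterS h => y [h _]; apply: h; exact: symgrad_symm.
Qed.

Lemma cell_mean_symm (s : E -> M) : mL2 b s -> symm_field s -> symmx (cell_mean b s).
Proof.
move=> Ls ss; apply/matrixP => i j; rewrite !mxE; congr (_ * _).
apply: ae_eq_Rintegral; first exact: measurable_cell.
- by apply: measurable_funTS; exact: mL2_measurable.
- by apply: measurable_funTS; exact: mL2_measurable.
- by apply: filterS ss => y /matrixP /(_ i j) + _; rewrite mxE.
Qed.

Lemma homogenized_symm A : symmx A -> symmx (homogenized b C A).
Proof.
move=> sA; have [_ LA _] := cell_sol_solution sA.
by apply: cell_mean_symm; [apply: (mL2_stress hC); exact: LPA_per_grad LA|exact: stress_symm].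
Qed.

Lemma mip_cst (s : E -> M) A : mL2 b s -> mip b s (fun=> A) = cell_vol b * frob (cell_mean b s) A.
Proof.
move=> Ls; have LA : mL2 b (fun=> A) by move=> i j; exact: L2per_cst.
rewrite (mipE hb Ls LA).1 frobE mulr_sumr; apply: eq_bigr => i _.
rewrite mulr_sumr; apply: eq_bigr => j _; rewrite !mxE !mulrA mulfV ?gt_eqF ?cell_vol_gt0// mul1r.
have mc := measurable_cell hb; rewrite /ip /cell_int.
by rewrite -(RintegralZr (A i j) mc (cell_L2_integrable hb (mL2_L2loc i j Ls))).
Qed.

Lemma symgrad_mean0 v : H1per b v -> cell_mean b (symgrad v) = 0.
Proof.
move=> hv; have [hG Lv LG] := H1per_components hv.
rewrite /cell_mean (_ : \matrix_(i, j) _ = 0) ?scaler0//; apply/matrixP => i j; rewrite !mxE.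
rewrite (_ : (fun _ => _) = (fun y => 2^-1 * grad v y i j + (2^-1 * grad v y j i + 0))); last first.
  by apply/funext => y; rewrite !mxE; ring.
have lG k l : L2loc (fun y => grad v y k l) by case: (LG k l).
have g0 k l : cell_int b (fun y => grad v y k l) = 0.
  by apply: (grad_mean0 hb (P := fun l y => grad v y k l) l (Lv k)) => // l'; case: (hG k l').
rewrite cell_int_lin//; last by apply: L2loc_lin => //; exact: L2loc_cst.
rewrite cell_int_lin//; last exact: L2loc_cst.
by rewrite !g0 cell_int0//; ring.
Qed.

(** The energy of the cell solution is the cell volume times the product of [A] with C^H A, the
    periodic part dropping out by the cell equation. If C^H A = 0, then symgrad u = A + symgrad phi
    vanishes; as symgrad phi has zero mean, A = 0. *)
Lemma homogenized_inj A : symmx A -> homogenized b C A = 0 -> A = 0.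
Proof.
move=> sA h0; have [[_ zu] LA hu] := cell_sol_solution sA.
set u := cell_sol b C A in zu LA hu.
have [phi hphi [pu su]] := LPA_H1per0 LA zu.
have pphi := H1per_per_grad hphi.1.
have Ls := mL2_stress hC pu.
have LcA : mL2 b (fun=> A) by move=> i j; exact: L2per_cst.
have fu0 : form b C u u = 0.
  transitivity (mip b (1 *: (fun=> A) + symgrad phi) (fun y => tens (C y) (symgrad u y))).
    rewrite [RHS]mipC; apply: eq_mip => //; first exact: mL2_symgrad.
    - by apply: mL2_lin => //; exact: mL2_symgrad.
    - exact: aeW.
    - apply: filterS su => y ->; rewrite -[RHS]/(1 *: A + symgrad phi y) scale1r.
      by rewrite sympart_id.
  rewrite (mip_lin hb)//; last exact: mL2_symgrad.
  rewrite mipC mip_cst// -/(homogenized b C A) h0.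
  rewrite frobE big1 => [|i _]; last by rewrite big1// => j _; rewrite mxE mul0r.
  by rewrite mulr0 mulr0 add0r mipC; exact: hu.
have s0 : {ae mu, forall y, symgrad u y = 0}.
  have [al a0 ha] := mip_C_ge hb hC.
  have Lu := mL2_symgrad pu.
  apply: (mip_eq0 hb) => //; apply/eqP; rewrite eq_le mip_ge0 andbT.
  by rewrite -(ler_pM2l a0) mulr0 -fu0; apply: ha => //; exact: symgrad_symm_field.
have : cell_mean b (symgrad phi) = cell_mean b (fun=> - A).
  apply: cell_mean_ae; first exact: mL2_symgrad.
    by move=> i j; exact: L2per_cst.
  apply: filterS2 s0 su => y -> /eqP; rewrite sympart_id// eq_sym addrC addr_eq0.
  by move=> /eqP.
rewrite symgrad_mean0; last by case: hphi.
move=> /matrixP h; apply/matrixP => i j; have := h i j; rewrite !mxE.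
rewrite /cell_int Rintegral_cst; last exact: measurable_cell.
have v0 := cell_vol_gt0 hb; rewrite -/(cell_vol b) mulrC mulfK ?gt_eqF// => /eqP.
by rewrite eq_sym oppr_eq0 => /eqP.
Qed.

(** C^H is precomposed with [sympart] to make it linear on all matrices and encoded as a 9 x 9
    matrix; [complianceP] then yields the inverse on symmetric matrices. *)
Lemma homogenized_bij S : symmx S -> exists A, [/\ symmx A, S = homogenized b C A
  & forall A', symmx A' -> S = homogenized b C A' -> A' = A].
Proof.
move=> sS.
have fl : linear (fun xi => homogenized b C (sympart xi)).
  by move=> a x y; rewrite sympartD homogenized_lin//; exact: sympart_symm.
pose F : {linear M -> M} := HB.pack (fun xi => homogenized b C (sympart xi))
  (GRing.isLinear.Build R _ _ _ _ fl).
pose c := lin_mx F.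
have cE xi : tens c xi = homogenized b C (sympart xi).
  by rewrite /tens /c (mul_vec_lin F) mxvecK.
have cS xi : symmx xi -> symmx (tens c xi).
  by move=> _; rewrite cE; apply: homogenized_symm; exact: sympart_symm.
have cI xi : symmx xi -> tens c xi = 0 -> xi = 0.
  by move=> sx; rewrite cE sympart_id//; exact: homogenized_inj.
have [sD D1 D2] := complianceP cS cI sS.
exists (tens (compliance c) S); split=> //.
  by rewrite -{1}D1 cE sympart_id.
move=> A' sA' SA'; have [_ _ <-] := complianceP cS cI sA'.
by rewrite cE sympart_id// -SA'.
Qed.

End cell_problem.

(** * Divergence-free stresses *)

Section div_free.
Variable R : realType.
Local Notation E := 'cV[R]_3.
Local Notation M := 'M[R]_3.
Local Notation mu := (@lebesgue3 R).

Lemma test_diff_quotN_cvg (phi : E -> R) j y : smooth phi ->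
  (n.+1%:R : R) * (phi (y - n.+1%:R^-1 *: delta_mx j 0) - phi y) @[n --> \oo]
    --> - partial j phi y.
Proof.
move=> sphi; have [d1 d2] := partial_is_derive j y sphi.
have H : (fun h : R => h^-1 *: ((phi \o shift y) (h *: delta_mx j 0) - phi y)) @ 0^'
   --> partial j phi y by [].
have n0 : (fun n => - n.+1%:R^-1 : R) @ \oo --> (0 : R)^'.
  have hN : (- n.+1%:R^-1 : R) @[n --> \oo] --> (0 : R).
    by rewrite -[X in _ --> X]oppr0; apply: cvgN; exact: cvg_harmonic.
  move=> A /= hA; have := hN _ hA; rewrite /nbhs /= /within/= => hh.
  by apply: filterS hh => n /=; apply; rewrite oppr_eq0 invr_neq0.
have H2 : - ((- n.+1%:R^-1 : R)^-1 *: (phi (- n.+1%:R^-1 *: delta_mx j 0 + y) - phi y))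
    @[n --> \oo] --> - partial j phi y.
  by apply: cvgN; exact: (cvg_comp _ _ n0 H).
apply: cvg_trans H2; apply: near_eq_cvg; near=> n.
by rewrite invrN invrK scaleNr opprK -[X in _ = X]/(n.+1%:R * _) (addrC y) scaleNr.
Unshelve. all: by end_near. Qed.


Lemma continuous_reflect (phi : E -> R) : continuous phi -> continuous (fun x : E => phi (- x)).
Proof. by move=> c x; apply: continuous_comp; [exact: opp_continuous|exact: c]. Qed.

Lemma continuous_sum (I : Type) (l : seq I) (F : I -> E -> R) : (forall i, continuous (F i)) ->
  continuous (fun y => \sum_(i <- l) F i y).
Proof.
move=> cF; elim: l => [|i l IH].
  rewrite (_ : (fun _ => _) = cst 0); first exact: cst_continuous.
  by apply/funext => y; rewrite big_nil.
rewrite (_ : (fun _ => _) = F i + (fun y => \sum_(k <- l) F k y)).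
  by move=> y; apply: continuousD; [exact: cF|exact: IH].
by apply/funext => y; rewrite big_cons.
Qed.

Lemma test_kernel (phi : E -> R) : test_function phi ->
  exists K r, [/\ 0 < r, cbounded K r phi & continuous phi].
Proof.
move=> tphi; have [K [r [r0 c]]] := test_cbounded tphi.
by exists K, r; split=> //; apply: smooth_continuous; case: tphi.
Qed.

(** With the reflected kernel this is the usual convolution of [phi] and [q], which is
    differentiable pointwise. Test functions are arbitrary here, not products, because [admissible]
    demands all of them. *)
Lemma conv_reflect_weak_partial (phi : E -> R) q j : test_function phi -> L2loc q ->
  weak_partial j (conv (fun x => phi (- x)) q) (conv (fun x => partial j phi (- x)) q).
Proof.
move=> tphi lq.
have [K0 [r0 [r00 c0 cc0]]] := test_kernel tphi.
have [K1 [r1 [r10 c1 cc1]]] := test_kernel (test_partial j tphi).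
have [K [r [rp Kp hK]]] := test_diff_quot j tphi.
have c0N := cbounded_reflect r00 c0; have c1N := cbounded_reflect r10 c1.
have cc0N := continuous_reflect cc0; have cc1N := continuous_reflect cc1.
(* The difference quotient of the convolution is the convolution with the quotient [psi n] of the
   kernel, and all of these share one bound and one support. *)
pose psi n z := n.+1%:R * (phi (- z - n.+1%:R^-1 *: delta_mx j 0) - phi (- z)).
have cpsi n : cbounded K r (psi n).
  have [m0 _] := c0N; split.
    apply: measurable_funM => //; apply: measurable_funB => //.
    rewrite (_ : (fun _ => _) = (fun z => phi (- (z + n.+1%:R^-1 *: delta_mx j 0)))).
      exact: measurableT_comp m0 (measurable_shiftv _).
    by apply/funext => z; rewrite opprD.
  move=> z; rewrite /psi normrM (ger0_norm (ler0n _ _)).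
  have := hK (- z) (- n.+1%:R^-1).
  rewrite normrN (ger0_norm (_ : 0 <= n.+1%:R^-1)) ?invr_ge0//.
  rewrite invf_le1 ?ler1n// scaleNr => /(_ isT) h.
  apply: (le_trans (ler_wpM2l (ler0n _ _) h)); rewrite mulrA mulfV ?pnatr_eq0// mul1r.
  rewrite ler_wpM2l// !indicE; have [zr|_] := boolP (- z \in cube r); last exact: ler0n.
  by rewrite mem_set//; move: zr; rewrite inE => /cubeN; rewrite opprK.
have dq x n : n.+1%:R * (conv (fun x => phi (- x)) q (x - n.+1%:R^-1 *: delta_mx j 0) -
    conv (fun x => phi (- x)) q x) = conv (psi n) q x.
  set h := n.+1%:R^-1 *: _.
  have i1 := conv_integrable r00 c0N (x - h) lq; have i2 := conv_integrable r00 c0N x lq.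
  rewrite /conv -(RintegralB measurableT i1 i2).
  have i3 : mu.-integrable setT (EFin \o (fun y => q y * phi (- (y - (x - h))) - q y * phi (- (y - x)))).
    by have := integrableB measurableT i1 i2; exact: eq_integrable.
  rewrite -(RintegralZl _ measurableT i3); apply: eq_Rintegral => y _.
  have -> : - (y - (x - h)) = - (y - x) - h by rewrite !opprB addrAC.
  by rewrite /psi -/h; ring.
have bK s x n : cube s x -> `|conv (psi n) q x| <= \int[mu]_x (`|q x| * (K * \1_(cube (r + s)) x)).
  by move=> xs; exact: (conv_bound rp (cpsi n) lq xs).
apply: classical_weak_partial.
- exact: (measurable_conv r00 c0N cc0N lq).
- exact: (measurable_conv r10 c1N cc1N lq).
- exact: (conv_loc_bounded r00 c0N lq).
- move=> s; exists (\int[mu]_x (`|q x| * (K * \1_(cube (r + s)) x))) => x n xs.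
  by rewrite dq; exact: bK.
- move=> x; under eq_fun do rewrite dq.
  have -> : - conv (fun x => partial j phi (- x)) q x =
      \int[mu]_y (q y * - partial j phi (- (y - x))).
    rewrite -mulN1r -(RintegralZl _ measurableT (conv_integrable r10 c1N x lq)).
    by apply: eq_Rintegral => y _; ring.
  apply: (@Rintegral_dominated _ _ _ mu _ (fun n y => q y * psi n (y - x)) _
    (fun y => `|q y| * (K * \1_(cube (r + (`|x| + 1))) y)) measurableT _ _ _ _ _).2.
  - by move=> n; apply: measurable_funM; [exact: L2loc_measurable|exact: measurable_kernel (cpsi n) x].
  - apply: measurable_funM; first exact: L2loc_measurable.
    by apply: measurableT_comp => //; exact: measurable_kernel c1N x.
  - apply: aeW => y _; apply: cvgM; first exact: cvg_cst.
    by apply: test_diff_quotN_cvg; case: tphi.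
  - exact: (conv_dom_integrable rp (cpsi 0%N)).
  - by move=> n y _; apply: (conv_dom rp (cpsi n)); exact: norm_in_cube.
Qed.

Variable b : 3.-tuple E.
Hypothesis hb : free b.

(* Tested against v = (conv (phi o -) q) e_i with q = \sum_j conv (d_j phi) (s i j),
   the hypothesis reads |q|^2 = 0; q is continuous, hence q 0 = 0. *)
Lemma symgrad_orth_div_free (s : E -> M) : mL2 b s -> symm_field s ->
  (forall v, H1per0 b v -> mip b s (symgrad v) = 0) ->
  forall i phi, test_function phi -> distr_div s i phi = 0.
Proof.
move=> Ls ss orth i phi tphi.
have [K0 [r0 [r00 c0 cc0]]] := test_kernel tphi.
have tp j := test_kernel (test_partial j tphi).
have Lc j : L2per b (conv (partial j phi) (fun y => s y i j)).
  by have [K [r [rp c cc]]] := tp j; exact: (conv_L2per rp c cc).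
have cont j : continuous (conv (partial j phi) (fun y => s y i j)).
  by have [K [r [rp c cc]]] := tp j; apply: (conv_continuous rp c cc); exact: mL2_L2loc.
pose q y := \sum_j conv (partial j phi) (fun y => s y i j) y.
have Lq : L2per b q by exact: L2per_sum.
have cq : continuous q by exact: continuous_sum.
have [lq pq] := Lq.
have c0N := cbounded_reflect r00 c0; have cc0N := continuous_reflect cc0.
pose vc := conv (fun x => phi (- x)) q.
pose w j := conv (fun x => partial j phi (- x)) q.
have Lvc : L2per b vc by exact: (conv_L2per r00 c0N cc0N Lq).
have Lw j : L2per b (w j).
  have [K [r [rp c cc]]] := tp j.
  exact: (conv_L2per rp (cbounded_reflect rp c) (continuous_reflect cc) Lq).
have wvc j : weak_partial j vc (w j) by exact: conv_reflect_weak_partial.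
(* Subtracting its mean puts the test field in [H1per0] without changing its gradient. *)
pose m := (cell_vol b)^-1 * cell_int b vc.
pose a (k : 'I_3) : R := (k == i)%:R.
pose v (y : E) : E := \col_k (a k * vc y + - (a k * m)).
pose W (y : E) : M := \matrix_(k, j) (a k * w j y + 0).
have vE k : (fun y => v y k 0) = (fun y => a k * vc y + - (a k * m)) by apply/funext => y; rewrite mxE.
have WE k j : (fun y => W y k j) = (fun y => a k * w j y + 0) by apply/funext => y; rewrite mxE.
have lvc : L2loc vc by case: Lvc. have lw j : L2loc (w j) by case: (Lw j).
have lv k : L2loc (fun y => v y k 0) by rewrite vE; apply: L2loc_lin => //; exact: L2loc_cst.
have hW : weak_gradient v W.
  move=> k j; rewrite vE WE; split.
    by apply: L2loc_lin; [exact: lw|exact: L2loc_cst].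
  apply: (@weak_partial_lin R j (a k) vc (w j) (fun=> - (a k * m)) (fun=> 0)
    lvc (lw j) (L2loc_cst _) (L2loc_cst _) (wvc j)).
  have := weak_partial_affine (R := R) (fun=> 0) (- (a k * m)) j.
  by congr weak_partial; apply/funext => y; rewrite big1 ?addr0// => l _; rewrite mul0r.
have LW : mL2 b W by move=> k j; rewrite WE; apply: L2per_lin => //; exact: L2per_cst.
have [pv gv] := per_grad_of lv hW LW.
have v0 : H1per0 b v.
  split; [split; [by split=> //; exists W|]|].
    have [_ pvc] := Lvc.
    exact: (periodic_comp (fun t : R => \col_k (a k * t + - (a k * m)) : E) pvc).
  move=> k; rewrite vE.
  rewrite (_ : (fun _ => _) = (fun y => a k * vc y + - (a k * m) * 1)); last by apply/funext => y; rewrite mulr1.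
  rewrite (_ : (fun _ => _) = (fun y => a k * vc y + (fun=> - (a k * m) * 1) y))// cell_int_lin//; last exact: L2loc_cst.
  rewrite [X in _ + X]/cell_int Rintegral_cst ?mulr1; last exact: measurable_cell.
  rewrite -/(cell_vol b) mulNr /m mulrA -(mulrA (a k)) (mulrC (a k)) -!mulrA.
  have vol0 := cell_vol_gt0 hb.
  by move: (cell_int b vc) (cell_vol b) vol0 => x1 x2 x3; field; rewrite gt_eqF.
have := orth v v0.
have -> : mip b s (symgrad v) = ip b q q.
  transitivity (mip b s W).
    apply: ae_eq_Rintegral; first exact: measurable_cell.
    - by apply: measurable_funTS; apply: measurable_frob => //; exact: mL2_symgrad.
    - by apply: measurable_funTS; exact: measurable_frob.
    apply: filterS2 ss gv => y sy gy _.
    by rewrite /symgrad frob_sympart// gy.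
  rewrite (mipE hb Ls LW).1.
  transitivity (\sum_k a k * \sum_j ip b (fun y => s y k j) (w j)).
    apply: eq_bigr => k _; rewrite mulr_sumr; apply: eq_bigr => j _.
    rewrite WE ipC (_ : (fun y => a k * w j y + 0) = a k *: w j).
      by rewrite ip_scale// ipC.
    by apply/funext => y; rewrite addr0.
  rewrite (sum_delta i (fun k => \sum_j ip b (fun y => s y k j) (w j))).
  have -> : ip b q q = \sum_j ip b (conv (partial j phi) (fun y => s y i j)) q.
    exact: (ip_suml hb (index_enum 'I_3) (fun j => (Lc j).1) lq).
  apply: eq_bigr => j _; have [K [r [rp c cc]]] := tp j.
  by rewrite [RHS]ipC (conv_adjoint hb rp c Lq (Ls i j)).
move=> /(continuous_ip_eq0 hb cq Lq) /(_ 0); rewrite /q /distr_div => q0.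
suff h : \sum_j (\int[mu]_x (s x i j * partial j phi x)) = 0 by rewrite h oppr0.
transitivity (\sum_j conv (partial j phi) (fun y => s y i j) 0); last exact: q0.
apply: eq_bigr => j _.
by apply: eq_Rintegral => x _; rewrite subr0.
Qed.

(** Symmetry of [m] replaces [symgrad v] by the full gradient, whose rows are then handled one at a
    time by [div_free_orth]. *)
Lemma div_free_symgrad (m : E -> M) v : mL2 b m -> symm_field m ->
  (forall i phi, test_function phi -> distr_div m i phi = 0) -> H1per b v ->
  mip b m (symgrad v) = 0.
Proof.
move=> Lm sm dm hv; have pv := H1per_per_grad hv; have [hG Lv LG] := H1per_components hv.
transitivity (mip b m (grad v)).
  apply: ae_eq_Rintegral; first exact: measurable_cell.
  - by apply: measurable_funTS; apply: measurable_frob => //; exact: mL2_symgrad.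
  - by apply: measurable_funTS; exact: measurable_frob.
  by apply: filterS sm => y sy _; rewrite /symgrad frob_sympart.
rewrite (mipE hb Lm LG).1 big1// => i _.
apply: (div_free_orth hb (m := fun j y => m y i j) (P := fun j y => grad v y i j)
  (fun j => Lm i j) (fun j => LG i j) (Lv i) (fun j => (hG i j).2)).
move=> k tk; have := dm i _ (test_factors_test tk).
by rewrite /distr_div => /eqP; rewrite oppr_eq0 => /eqP.
Qed.

End div_free.

(** * Measurability of the compliance *)

Section measurable_inverse.
Context d (T : measurableType d) (R : realType).

Lemma measurable_inv (f : T -> R) : measurable_fun setT f -> measurable_fun setT (fun x => (f x)^-1).
Proof.
move=> mf; apply: (measurableT_comp (f := fun x : R => x^-1)) => //.
have m0 : measurable (~` [set (0 : R)]) by apply: measurableC.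
rewrite -(setvU [set (0 : R)]); apply/measurable_funU => //; split.
  apply: open_continuous_measurable_fun.
    apply: closed_openC; apply: accessible_closed_set1.
    by apply: hausdorff_accessible; exact: norm_hausdorff.
  by move=> x; rewrite inE /= => /eqP x0; exact: inv_continuous.
have e0 : {in [set (0 : R)], cst (0^-1 : R) =1 (fun x => x^-1)}.
  by move=> x; rewrite inE /= => ->.
exact: eq_measurable_fun e0 _.
Qed.

Lemma measurable_det n (A : T -> 'M[R]_n) : (forall i j, measurable_fun setT (fun y => A y i j)) ->
  measurable_fun setT (fun y => \det (A y)).
Proof.
move=> mA; apply: measurable_sum => s; apply: measurable_funM => //.
by apply: measurable_prod => i _.
Qed.

Lemma measurable_invmx n (A : T -> 'M[R]_n) i j :
  (forall i j, measurable_fun setT (fun y => A y i j)) ->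
  measurable_fun setT (fun y => invmx (A y) i j).
Proof.
move=> mA.
(* Cramer's formula; on singular matrices [invmx] returns its argument, which is the first
   branch. *)
rewrite (_ : (fun _ => _) = (fun y => if \det (A y) == 0 then A y i j
    else (\det (A y))^-1 * cofactor (A y) j i)); last first.
  apply/funext => y; rewrite /invmx unitmxE unitfE.
  by case: eqP => //= _; rewrite !mxE.
apply: measurable_fun_ifT => //.
  by apply: measurable_fun_eqr => //; exact: measurable_det.
apply: measurable_funM; first by apply: measurable_inv; exact: measurable_det.
apply: measurable_funM => //; apply: measurable_det => k l.
rewrite (_ : (fun _ => _) = (fun y => A y (lift j k) (lift i l))) //.
by apply/funext => y; rewrite !mxE.
Qed.

Lemma measurable_compliance (C : T -> 'M[R]_(3 * 3)) i j :
  (forall i j, measurable_fun setT (fun y => C y i j)) ->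
  measurable_fun setT (fun y => compliance (C y) i j).
Proof.
move=> mC; apply: measurable_invmx => {i j} m n.
(* Row m of the matrix of a linear map is the image of the m-th basis matrix, here an affine
   expression in the entries of [C y]. *)
pose A : 'M[R]_3 := vec_mx (delta_mx 0 m).
rewrite (_ : (fun _ => _) = (fun y => (\sum_k mxvec (sympart A) 0 k * C y k n) +
    mxvec (A - sympart A) 0 n)).
  apply: measurable_funD => //; apply: measurable_sum => k.
  by apply: measurable_funM.
apply/funext => y; rewrite mxE /= linearD /= /tens vec_mxK !mxE.
by congr (_ + _); rewrite -/A linearB /= !mxE.
Qed.

End measurable_inverse.

(** * The variational principle for stresses *)

Section stress.
Variable R : realType.
Local Notation E := 'cV[R]_3.
Local Notation M := 'M[R]_3.
Local Notation mu := (@lebesgue3 R).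
Variable b : 3.-tuple E.
Hypothesis hb : free b.
Variable C : E -> 'M[R]_(3 * 3).
Hypothesis hC : rigidity_tensor b C.
Implicit Types s t m : E -> M.

Definition Dfield s : E -> M := fun y => tens (compliance_field C y) (s y).

(** Coercivity makes C(y) injective on symmetric matrices at almost every y, which is what
    [complianceP] asks for. *)
Lemma compliance_ae : {ae mu, forall y, forall xi, symmx xi ->
  [/\ symmx (tens (compliance_field C y) xi),
      tens (C y) (tens (compliance_field C y) xi) = xi
    & tens (compliance_field C y) (tens (C y) xi) = xi]}.
Proof.
have [_ _ _ h1 [al a0 h2]] := hC; apply: filterS2 h1 h2 => y [cS _] co xi sxi.
apply: complianceP => // eta se e0; apply: frob_eq0; apply/eqP.
rewrite eq_le frob_ge0 andbT -(ler_pM2l a0) mulr0 (le_trans (co _ se))// e0.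
by rewrite frobE big1// => i _; rewrite big1// => j _; rewrite mxE mul0r.
Qed.

Lemma Dfield_symm s : symm_field s -> symm_field (Dfield s).
Proof. by move=> ss; apply: filterS2 compliance_ae ss => y h sy; have [] := h _ sy. Qed.

Lemma Dfield_inv s : symm_field s -> {ae mu, forall y, tens (C y) (Dfield s y) = s y}.
Proof. by move=> ss; apply: filterS2 compliance_ae ss => y h sy; have [] := h _ sy. Qed.

(** Integrability rests on the pointwise bound |D s| <= |s| / alpha, a consequence of the coercivity
    of C; it holds on symmetric values, the only ones where the inverse is meaningful. *)
Lemma mL2_Dfield s : mL2 b s -> symm_field s -> mL2 b (Dfield s).
Proof.
move=> Ls ss i j; have [pC mC _ _ [al a0 co]] := hC.
have mD k l : measurable_fun setT (fun y => Dfield s y k l).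
  rewrite (_ : (fun _ => _) = (fun y => \sum_n mxvec (s y) 0 n *
      compliance (C y) n (mxvec_index k l))); last by apply/funext => y; rewrite /Dfield tensE.
  apply: measurable_sum => n; apply: measurable_funM; last exact: measurable_compliance.
  case/mxvec_indexP: n => p q.
  rewrite (_ : (fun _ => _) = (fun y => s y p q)); first exact: mL2_measurable.
  by apply/funext => y; rewrite mxvecE.
split; last first.
  apply: (periodic_op2 (fun (c : 'M[R]_(3 * 3)) (xi : M) => tens (compliance c) xi i j) pC).
  move=> a la; have : {ae mu, forall y, forall k l, s (y + a) k l = s y k l}.
    by apply: ae_ord3 => k; apply: ae_ord3 => l; have [_ p] := Ls k l; exact: p.
  by apply: filterS => y h; apply/matrixP => k l.
apply: L2loc_of_cube => // r; have mq := @measurable_cube R r.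
have mD2 : measurable_fun setT (fun y => Dfield s y i j ^+ 2) by exact: measurable_funX.
pose F y := \sum_k \sum_l s y k l ^+ 2.
have iF : mu.-integrable (cube r) (EFin \o (fun y => (al ^+ 2)^-1 * F y)).
  have H k := (Rintegral_sum (index_enum 'I_3) mq (fun l => L2loc_cube r (mL2_L2loc k l Ls))).2.
  have := integrableZl mq (al ^+ 2)^-1 (Rintegral_sum (index_enum 'I_3) mq H).2.
  by apply: eq_integrable.
have bd : {ae mu, forall y, Dfield s y i j ^+ 2 <= (al ^+ 2)^-1 * F y}.
  apply: filterS3 compliance_ae co ss => y h c sy; have [se e1 _] := h _ sy.
  have := c _ se; rewrite e1 -/(Dfield s y) => h1.
  (* Expanding |s - alpha D s|^2 >= 0 bounds the product of s and D s from above; with coercivity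
     this gives alpha^2 |D s|^2 <= |s|^2. *)
  have h2 := frob_ge0 (- al *: Dfield s y + s y).
  rewrite frobDl (frobC _ (_ + _)) (frobC _ (_ + _)) !frobDl (frobC (Dfield s y) (s y)) in h2.
  have -> : F y = frob (s y) (s y).
    by rewrite frobE; apply: eq_bigr => k _; apply: eq_bigr => l _; rewrite expr2.
  apply: (@le_trans _ _ (frob (Dfield s y) (Dfield s y))).
    rewrite frobE (bigD1 i)//= (bigD1 j)//= -expr2 -addrA lerDl.
    apply: addr_ge0; apply: sumr_ge0 => k _; first by rewrite -expr2 sqr_ge0.
    by apply: sumr_ge0 => l _; rewrite -expr2 sqr_ge0.
  have a2 : 0 < al ^+ 2 by rewrite exprn_gt0.
  rewrite ler_pdivlMl//.
  have := ler_wpM2l (ltW a0) h1.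
  move: h2; move: (frob (Dfield s y) _) (frob (s y) (Dfield s y)) (frob (s y) (s y)) => x1 x2 x3.
  by rewrite expr2; nra.
apply/integrableP; split; first by apply/measurable_EFinP; exact: measurable_funTS.
case/integrableP : iF => mF; apply: le_lt_trans.
apply: ae_ge0_le_integral => //.
- by apply: measurableT_comp => //; apply/measurable_EFinP; exact: measurable_funTS.
- exact: measurableT_comp.
- apply: filterS bd => y h _; rewrite /= lee_fin ger0_norm ?sqr_ge0//.
  exact: le_trans h (ler_norm _).
Qed.

Lemma Dfield_lin a s t : Dfield (a *: s + t) = a *: Dfield s + Dfield t.
Proof. exact: tens_field_lin. Qed.

Lemma mip_Dfield_sym s t : mL2 b s -> mL2 b t -> symm_field s -> symm_field t ->
  mip b (Dfield s) t = mip b (Dfield t) s.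
Proof.
move=> Ls Lt ss st; rewrite [RHS]mipC.
have LDs := mL2_Dfield Ls ss; have LDt := mL2_Dfield Lt st.
have bC := rigidity_bounded hC.
transitivity (mip b (Dfield s) (fun y => tens (C y) (Dfield t y))).
  apply: eq_mip => //; [exact: mL2_tens|exact: aeW|].
  by apply: filterS (Dfield_inv st) => y ->.
rewrite -(mip_C_sym hb hC)//; try exact: Dfield_symm.
by apply: eq_mip => //; [exact: mL2_tens|exact: Dfield_inv|exact: aeW].
Qed.

(** As s = C (D s), the form equals the energy of D s for C; coercivity makes it nonnegative, and if
    it vanishes then so do D s and s = C (D s). *)
Lemma mip_Dfield_ge0 s : mL2 b s -> symm_field s -> 0 <= mip b (Dfield s) s /\
  (mip b (Dfield s) s = 0 -> {ae mu, forall y, s y = 0}).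
Proof.
move=> Ls ss; have LDs := mL2_Dfield Ls ss; have bC := rigidity_bounded hC.
have [al a0 h] := mip_C_ge hb hC.
have -> : mip b (Dfield s) s = mip b (fun y => tens (C y) (Dfield s y)) (Dfield s).
  rewrite mipC; apply: eq_mip => //; [exact: mL2_tens| |exact: aeW].
  by apply: filterS (Dfield_inv ss) => y ->.
have h1 := h _ LDs (Dfield_symm ss); have h2 := mip_ge0 b (Dfield s).
split; first by apply: le_trans h1; rewrite mulr_ge0// ltW.
move=> h0; have D0 : {ae mu, forall y, Dfield s y = 0}.
  apply: (mip_eq0 hb) => //; apply/eqP; rewrite eq_le h2 andbT.
  by rewrite -(ler_pM2l a0) mulr0 -h0.
apply: filterS2 (Dfield_inv ss) D0 => y <- ->.
by apply/matrixP => i j; rewrite tensE big1 ?mxE// => k _; rewrite linear0 mxE mul0r.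
Qed.

Lemma L2per_sym_mL2 s : L2per_sym b s <-> mL2 b s /\ symm_field s.
Proof.
split=> [[l p ss]|[Ls ss]].
  by split=> // i j; split=> //; exact: (periodic_comp (fun A : M => A i j) p).
split=> // [i j|a la]; first exact: mL2_L2loc.
have : {ae mu, forall y, forall i j, s (y + a) i j = s y i j}.
  by apply: ae_ord3 => i; apply: ae_ord3 => j; have [_ p] := Ls i j; exact: p.
by apply: filterS => y h; apply/matrixP => i j.
Qed.

Lemma symm_field_lin a s t : symm_field s -> symm_field t -> symm_field (a *: s + t).
Proof.
move=> ss st; apply: filterS2 ss st => y hs ht.
by rewrite /symmx /= -[(_ + t) y]/(a *: s y + t y) linearP /= hs ht.
Qed.

Lemma admissible_lin a S S' s t : admissible b S s -> admissible b S' t ->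
  admissible b (a *: S + S') (a *: s + t).
Proof.
move=> [/L2per_sym_mL2[Ls ss] ds ms] [/L2per_sym_mL2[Lt st] dt mt]; split.
- by apply/L2per_sym_mL2; split; [exact: mL2_lin|exact: symm_field_lin].
- move=> i phi tphi; have := ds i phi tphi; have := dt i phi tphi; rewrite /distr_div.
  move=> /eqP; rewrite oppr_eq0 => /eqP h1 /eqP; rewrite oppr_eq0 => /eqP h2.
  rewrite (eq_bigr (fun j => a * \int[mu]_y (s y i j * partial j phi y) +
     \int[mu]_y (t y i j * partial j phi y))).
    by rewrite big_split /= -mulr_sumr h1 h2 mulr0 addr0 oppr0.
  move=> j _; have tp := test_partial j tphi.
  have i1 := test_mul_integrable (mL2_L2loc i j Ls) tp.
  have i2 := test_mul_integrable (mL2_L2loc i j Lt) tp.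
  rewrite -(RintegralZl a measurableT i1) -RintegralD//.
    by apply: eq_Rintegral => y _; rewrite -[(_ + t) y]/(a *: s y + t y) !mxE; ring.
  by have := integrableZl measurableT a i1; exact: eq_integrable.
- by rewrite cell_mean_lin// ms mt.
Qed.

Lemma comp_energyE s : comp_energy b C s = 2^-1 * mip b (Dfield s) s.
Proof. by []. Qed.

(** Pythagoras: t - s is admissible for mean 0, so the variational equation and the symmetry of D
    remove both cross terms. *)
Lemma energy_split S s t : stress_solution b C S s -> admissible b S t ->
  comp_energy b C t = comp_energy b C s + comp_energy b C (-1 *: s + t).
Proof.
move=> [As hs] At; have Am := admissible_lin (-1) As At.
rewrite scaleN1r addNr in Am; have hm := hs _ Am.
have [/L2per_sym_mL2[Ls ss] _ _] := As; have [/L2per_sym_mL2[Lm sm] _ _] := Am.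
set m := -1 *: s + t in hm Lm sm *.
have tE : t = 1 *: s + m.
  by rewrite /m scale1r scaleN1r addrA subrr add0r.
have hm' : mip b (Dfield s) m = 0 by exact: hm.
have LDs := mL2_Dfield Ls ss; have LDm := mL2_Dfield Lm sm.
have Lt : mL2 b t by rewrite tE; exact: mL2_lin.
clearbody m.
rewrite !comp_energyE {1}tE Dfield_lin mip_lin//.
rewrite [X in _ * X + _]mipC [X in _ + X]mipC {1 2}tE !mip_lin//.
rewrite (mipC b m (Dfield s)) hm' (mipC b s (Dfield m)) (mip_Dfield_sym Lm Ls sm ss) hm'.
by rewrite (mipC b s) (mipC b m); ring.
Qed.

(** By [energy_split] the excess energy of a competitor is the energy of its difference from [s],
    which is nonnegative and vanishes only for a null difference. *)
Lemma stress_minimizerP S s : stress_solution b C S s ->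
  stress_minimizer b C S s /\ forall t, stress_minimizer b C S t -> {ae mu, forall y, t y = s y}.
Proof.
move=> hs; have [As _] := hs.
have ge t : admissible b S t -> comp_energy b C s <= comp_energy b C t /\
    (comp_energy b C t = comp_energy b C s -> {ae mu, forall y, t y = s y}).
  move=> At; rewrite (energy_split hs At).
  have := admissible_lin (-1) As At; rewrite scaleN1r addNr.
  move=> [/L2per_sym_mL2[Lm sm] _ _]; have [g0 g1] := mip_Dfield_ge0 Lm sm.
  split; first by rewrite lerDl comp_energyE mulr_ge0// invr_ge0.
  move=> /eqP; rewrite -subr_eq0 addrAC subrr add0r comp_energyE mulf_eq0 invr_eq0 pnatr_eq0 /=.
  move=> /eqP /g1; apply: filterS => y.
  rewrite -[(_ + t) y]/(-1 *: s y + t y) scaleN1r addrC => /eqP.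
  by rewrite subr_eq0 => /eqP.
have infE : inf [set comp_energy b C t | t in admissible b S] = comp_energy b C s.
  apply/eqP; rewrite eq_le; apply/andP; split.
    apply: inf_lbound; last by exists s.
    by exists (comp_energy b C s) => _ [t At <-]; exact: (ge t At).1.
  apply: lb_le_inf; first by exists (comp_energy b C s), s.
  by move=> _ [t At <-]; exact: (ge t At).1.
split; first by split.
by move=> t [At tE]; apply: (ge t At).2; rewrite tE infE.
Qed.

Lemma stress_solution_unique S s t : stress_solution b C S s -> stress_solution b C S t ->
  {ae mu, forall y, t y = s y}.
Proof.
move=> [As hs] [At ht]; have Am := admissible_lin (-1) As At.
rewrite scaleN1r addNr in Am.
have [/L2per_sym_mL2[Ls ss] _ _] := As; have [/L2per_sym_mL2[Lt st] _ _] := At.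
have [/L2per_sym_mL2[Lm sm] _ _] := Am.
have [_] := mip_Dfield_ge0 Lm sm.
rewrite Dfield_lin mip_lin//; try exact: mL2_Dfield.
have -> : mip b (Dfield s) (-1 *: s + t) = 0 by exact: hs.
have -> : mip b (Dfield t) (-1 *: s + t) = 0 by exact: ht.
rewrite mulr0 addr0 => /(_ erefl); apply: filterS => y.
rewrite -[(_ + t) y]/(-1 *: s y + t y) scaleN1r addrC => /eqP.
by rewrite subr_eq0 => /eqP.
Qed.

(** Here D sigma = A + symgrad phi. Against a field of [admissible 0] the constant part vanishes by
    zero mean, the gradient part by zero divergence. *)
Lemma cell_stress_solution A u : symmx A -> cell_solution b C A u ->
  stress_solution b C (homogenized b C A) (fun y => tens (C y) (symgrad u y)) /\
  {ae mu, forall y, Dfield (fun y => tens (C y) (symgrad u y)) y = symgrad u y}.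
Proof.
move=> sA hu; have [[_ zu] Lu orth] := hu.
have [phi hphi [pu su]] := LPA_H1per0 hb Lu zu.
have Ls := mL2_stress hC pu; have ss := stress_symm hC u.
set s := fun y => _ in Ls ss *.
have Du : {ae mu, forall y, Dfield s y = symgrad u y}.
  by apply: filterS compliance_ae => y h; have [] := h _ (symgrad_symm u y).
split; last exact: Du.
split.
  split; [by apply/L2per_sym_mL2| |by rewrite (homogenizedE hb hC sA hu)].
  exact: (symgrad_orth_div_free hb Ls ss).
move=> m [/L2per_sym_mL2[Lm sm] dm mm].
have LDs := mL2_Dfield Ls ss.
have pphi := H1per_per_grad hphi.1.
have LA : mL2 b (fun=> A) by move=> i j; exact: L2per_cst.
transitivity (mip b (1 *: (fun=> A) + symgrad phi) m).
  apply: eq_mip => //; first by apply: mL2_lin => //; exact: mL2_symgrad.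
    apply: filterS2 Du su => y d1 d2; rewrite -/(Dfield s y) d1 d2.
    by rewrite -[RHS]/(1 *: A + symgrad phi y) scale1r sympart_id.
  exact: aeW.
rewrite mip_lin//; last exact: mL2_symgrad.
rewrite mipC mip_cst// mm [X in _ + X]mipC div_free_symgrad//; last by case: hphi.
rewrite frobE big1 => [|i _]; last by rewrite big1// => j _; rewrite mxE mul0r.
by rewrite !mulr0 addr0.
Qed.

End stress.

Theorem theorem23 (R : realType) (b : 3.-tuple 'cV[R]_3) (hb : free b)
    (C : 'cV[R]_3 -> 'M[R]_(3 * 3)) (hC : rigidity_tensor b C)
    (S : 'M[R]_3) (hS : symmx S) :
  exists sigma : 'cV[R]_3 -> 'M[R]_3,
    [/\ stress_minimizer b C S sigma,
        forall tau, stress_minimizer b C S tau ->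
          tau = sigma %[ae lebesgue3],
        stress_solution b C S sigma,
        forall tau, stress_solution b C S tau ->
          tau = sigma %[ae lebesgue3]
      & exists A : 'M[R]_3,
          [/\ symmx A, S = homogenized b C A,
              forall A', symmx A' -> S = homogenized b C A' -> A' = A
            & exists u : 'cV[R]_3 -> 'cV[R]_3,
                [/\ cell_solution b C A u,
                    forall u', cell_solution b C A u' ->
                      u' = u %[ae lebesgue3]
                  & (fun y => tens (compliance_field C y) (sigma y)) = symgrad u
                      %[ae lebesgue3]]]].
Proof.
have [A [sA SA uA]] := homogenized_bij hb hC hS.
have [u hu] := cell_solution_exists hb hC sA.
have [hs Ds] := cell_stress_solution hb hC sA hu; rewrite -SA in hs.
have [hm um] := stress_minimizerP hb hC hs.
exists (fun y => tens (C y) (symgrad u y)); split=> //.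
- by move=> tau /um; apply: filterS => y h _.
- by move=> tau /(stress_solution_unique hb hC hs); apply: filterS => y h _.
exists A; split=> //; exists u; split=> //.
- by move=> u' hu'; apply: filterS (cell_solution_unique hb hC hu' hu).1 => y h _.
- by apply: filterS Ds => y h _.
Qed.
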